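(* Let $G$ be a connected $3$-sparse graph with maximum degree $\Delta$. If $G$ has an edge $xy$ with $d_G(x) + d_G(y) < \Delta + 3$, then $a'(G) \le \Delta + 1$.
   Context: All graphs are finite, simple and undirected. $d_G(v)$ denotes the degree of the vertex $v$ in $G$. A graph $G$ is $3$-sparse if every edge of $G$ is incident on at least one vertex of degree at most $3$ in $G$. A proper edge coloring of $G$ assigns a color to each edge so that no two adjacent edges receive the same color. A cycle is bichromatic with respect to a proper edge coloring if its edges are colored with exactly $2$ colors. An acyclic edge coloring of $G$ is a proper edge coloring of $G$ with no bichromatic cycles. The acyclic chromatic index $a'(G)$ is the minimum number of colors required for an acyclic edge coloring of $G$. *)

(* Defs.v *)
From HB Require Import structures.
From mathcomp Require Import all_boot.

Set Implicit Arguments.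
Unset Strict Implicit.
Unset Printing Implicit Defensive.

Record sgraph := SGraph {
  vertex :> finType;
  adj : rel vertex;
  adj_sym : symmetric adj;
  adj_irrefl : irreflexive adj }.

Section Graphs.
Variable G : sgraph.

Definition deg (x : G) : nat := #|[set y | adj x y]|.

Definition max_deg : nat := \max_(x : G) deg x.

Definition connected : Prop :=
  0 < #|G| /\ forall x y : G, connect (@adj G) x y.

Definition sparse (k : nat) : Prop :=
  forall x y : G, adj x y -> deg x <= k \/ deg y <= k.

Definition is_edge (A : {set G}) : bool :=
  [exists x, exists y, adj x y && (A == [set x; y])].

Definition edge := {A : {set G} | is_edge A}.

Definition proper_edge_coloring k (c : {ffun edge -> 'I_k}) : bool :=
  [forall f : edge, forall g : edge,
    (f != g) && (val f :&: val g != set0) ==> (c f != c g)].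

(* A cycle is the cyclic sequence of its at least three distinct vertices. *)
Definition is_cycle (p : seq G) : bool :=
  (2 < size p) && ucycleb (@adj G) p.

Definition cycle_edges (p : seq G) : {set edge} :=
  [set f | val f \in [seq [set x; next p x] | x <- p]].

Definition bichromatic k (c : {ffun edge -> 'I_k}) (p : seq G) : bool :=
  #|c @: cycle_edges p| == 2.

(* Restricting to sequences of length at most #|G| loses no cycle and keeps the
   predicate boolean; see acyclic_edge_coloringP. *)
Definition acyclic_edge_coloring k (c : {ffun edge -> 'I_k}) : bool :=
  proper_edge_coloring c &&
  [forall p : #|G|.-bseq G, is_cycle p ==> ~~ bichromatic c p].

Lemma acyclic_edge_coloringP k (c : {ffun edge -> 'I_k}) :
  reflect (proper_edge_coloring c /\
           forall p : seq G, is_cycle p -> ~~ bichromatic c p)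
          (acyclic_edge_coloring c).
Proof.
apply: (iffP andP) => -[proper_c acy_c]; split=> //; last first.
  by apply/forallP=> p; apply/implyP; apply: acy_c.
move=> p p_cyc; have p_size : size p <= #|G|.
  by case/and3P: p_cyc => _ _ /card_uniqP <-; apply: max_card.
by have /implyP := forallP acy_c (Bseq p_size); apply.
Qed.

Lemma cycle_edge_inj (p : seq G) : is_cycle p ->
  {in p &, injective (fun x => [set x; next p x])}.
Proof.
case/and3P=> p_gt2 p_cyc p_uniq x y xp yp eq_xy.
have: x \in [set y; next p y] by rewrite -eq_xy set21.
rewrite in_set2 => /orP[/eqP //|/eqP x_ny].
have: y \in [set x; next p x] by rewrite eq_xy set21.
rewrite in_set2 => /orP[/eqP -> //|/eqP y_nx].
have [i s rot_p] := rot_to xp.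
have s_uniq : uniq (x :: s) by rewrite -rot_p rot_uniq.
have: size (x :: s) = size p by rewrite -rot_p size_rot.
move: x_ny; rewrite y_nx -!(next_rot i p_uniq) rot_p.
case: s s_uniq {rot_p} => [|a [|b s]] /=; try by move=> _ _ E; rewrite -E in p_gt2.
rewrite !inE !eqxx !negb_or => /andP[/and3P[x_a x_b _] _] x_next.
by rewrite eq_sym (negbTE x_a) in x_next; rewrite -x_next eqxx in x_b.
Qed.

Lemma card_cycle_edges (p : seq G) : is_cycle p -> #|cycle_edges p| = size p.
Proof.
move=> p_cyc; have /and3P[_ p_adj p_uniq] := p_cyc.
rewrite -(card_imset _ val_inj) -(size_map (fun x => [set x; next p x]) p).
rewrite -(card_uniqP _); last by rewrite map_inj_in_uniq //; apply: cycle_edge_inj.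
apply: eq_card => A; apply/imsetP/idP => [[f + ->]|Ap]; first by rewrite inE.
have A_edge : is_edge A.
  case/mapP: Ap => x xp ->; apply/existsP; exists x; apply/existsP.
  by exists (next p x); rewrite eqxx andbT (next_cycle p_adj).
by exists (exist _ A A_edge); rewrite ?inE.
Qed.

Lemma ex_acyclic_edge_coloring :
  exists k, [exists c : {ffun edge -> 'I_k}, acyclic_edge_coloring c].
Proof.
exists #|{: edge}|; apply/existsP; exists [ffun f => enum_rank f].
have c_inj : injective [ffun f : edge => enum_rank f].
  by move=> f g; rewrite !ffunE => /enum_rank_inj.
apply/acyclic_edge_coloringP; split=> [|p p_cyc].
  apply/forallP=> f; apply/forallP=> g; apply/implyP=> /andP[fg _].
  by rewrite (inj_eq c_inj).
rewrite /bichromatic card_imset // card_cycle_edges //.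
by case/andP: p_cyc => p_gt2 _; rewrite gtn_eqF.
Qed.

Definition acyclic_chromatic_index : nat := ex_minn ex_acyclic_edge_coloring.

End Graphs.

(* Main.v *)
Require Import Defs.
From mathcomp Require Import all_boot zify.

(** A proper colouring is acyclic when every edge is a bridge among the edges of
    its own colour and any second one. The edges of two colours then form paths,
    which end at vertices that miss one of the two colours. Hence three vertices
    that each miss one of the two colours never lie on one path ([three_ends]),
    and the colours at a single vertex can be replaced as soon as no two of its
    neighbours are joined by a path in their new colours ([restarP],
    [recolourP]). The whole proof consists in playing these facts against each
    other.

    Let [D] be the maximum degree, so that there are [D + 1] colours. Sparseness
    bounds the degree sum of an edge by [D + 3]. Deleting an edge lowers the
    degree sums of the adjacent ones, so all subgraphs inherit the property that
    each component with an edge has an edge of degree sum at most [D + 2]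
    ([deficient_cut]). By induction on the number of edges, all edges but one
    edge [x y] of our choice are coloured already ([colourable_deficient]). A
    colour missing at [x] and [y] suits [x y] unless it is blocked: some colour
    present at both ends forms with it a path from [x] to [y]
    ([colourable_edge]). Blocked colours have to occur next to the ends of
    [x y], where there is little room for them. Three kinds of edges occur
    ([colourable_step]).

    - If [x] has degree at most two, a single colour blocks, and it can be
      changed. Both choices force the palette of a neighbour of [y], and the
      edges from [y] to these two neighbours can exchange their colours
      ([colourable_low]).

    - If [x] has degree three, and [y] has degree less than [D] and only
      neighbours of degree at most three, then the neighbours of [y] at which
      the blocking paths arrive have no colours but those of the paths. Such a
      neighbour accepts another colour, which frees a colour at [y]
      ([colourable_small]).

    - Otherwise the edge of small degree sum has an end of degree three, and so
      has its other end, which has a neighbour of larger degree; in particular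
      [D] is at least four. All edges off [x] and [y] are first kept as they are. The
      four edges that join [x] and [y] to further vertices can choose among at
      least two colours each, and it is only for very rigid choices that [x y]
      remains blocked. In these cases a further neighbour of [x] or [y] has
      degree more than three, the palettes of its own neighbours are known, and
      exchanging two colours there cuts the blocking paths ([swap_colours],
      [colourable_twins]). *)

Set Implicit Arguments.
Unset Strict Implicit.
Unset Printing Implicit Defensive.

(** * Forests as relations all of whose edges are bridges *)

Section Relations.
Variable T : finType.
Implicit Types (R : rel T) (x y u v w : T).

Definition joins x y u v :=
  (u == x) && (v == y) || (u == y) && (v == x).

Definition cut_edge R x y u v := R u v && ~~ joins x y u v.
Arguments cut_edge R x y u v /.

Definition add_edge R x y u v := R u v || joins x y u v.
Arguments add_edge R x y u v /.

Definition forest R := forall x y, R x y -> ~~ connect (cut_edge R x y) x y.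

Lemma joinsC x y u v : joins x y u v = joins x y v u.
Proof. by rewrite /joins orbC andbC [(v == y) && _]andbC. Qed.

Lemma joinsCl x y u v : joins x y u v = joins y x u v.
Proof. by rewrite /joins orbC. Qed.

Lemma joinsP x y u v :
  reflect ((u = x /\ v = y) \/ (u = y /\ v = x)) (joins x y u v).
Proof.
apply: (iffP orP) => -[] H; [left|right|left|right].
- by case/andP: H => /eqP-> /eqP->.
- by case/andP: H => /eqP-> /eqP->.
- by case: H => -> ->; rewrite !eqxx.
- by case: H => -> ->; rewrite !eqxx.
Qed.

Lemma forest_eq R R' : R =2 R' -> forest R -> forest R'.
Proof.
move=> eqR fR x y; rewrite -eqR => /fR; apply: contra.
have E : cut_edge R x y =2 cut_edge R' x y by move=> u v; rewrite /= eqR.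
by rewrite (eq_connect E).
Qed.

(** A path that uses the new edge needs it only once. *)
Lemma connect_add_edge R x y u v : symmetric R ->
  connect (add_edge R x y) u v =
  [|| connect R u v, connect R u x && connect R y v
    | connect R u y && connect R x v].
Proof.
move=> symR.
have sub : subrel (connect R) (connect (add_edge R x y)).
  by apply: connect_sub => s t st; apply: connect1; rewrite /= st.
have xy : connect (add_edge R x y) x y by apply: connect1; rewrite /= /joins !eqxx orbT.
have yx : connect (add_edge R x y) y x by apply: connect1; rewrite /= /joins !eqxx !orbT.
apply/idP/idP => [|/or3P[/sub //|/andP[/sub ux /sub yv]|/andP[/sub uy /sub xv]]].
- set S := [pred v | [|| connect R u v, connect R u x && connect R y v
    | connect R u y && connect R x v]].
  case/connectP=> p; elim/last_ind: p v => [|p w IH] v /=; first by move=> _ ->; rewrite connect0.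
  rewrite rcons_path last_rcons => /andP[p_path]; set t := last u p => /= st ->.
  have := IH t p_path erefl; case/orP: st => [tw|].
    have step z : connect R z t -> connect R z w by move=> zt; apply: connect_trans zt (connect1 tw).
    case/or3P=> [/step->//|/andP[-> /step->]|/andP[-> /step->]]; by rewrite ?orbT.
  case/joinsP=> -[-> ->] /or3P[->|/andP[ux ?]|/andP[uy ?]];
    by rewrite ?connect0 ?ux ?uy ?orbT.
- exact: connect_trans ux (connect_trans xy yv).
- exact: connect_trans uy (connect_trans yx xv).
Qed.

Lemma cut_edge_sym R x y : symmetric R -> symmetric (cut_edge R x y).
Proof. by move=> symR u v /=; rewrite symR joinsC. Qed.

Lemma add_edge_sym R x y : symmetric R -> symmetric (add_edge R x y).
Proof. by move=> symR u v /=; rewrite symR joinsC. Qed.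

Lemma connectC R u v : symmetric R -> connect R u v = connect R v u.
Proof. by move=> symR; apply: sym_connect_sym. Qed.

Lemma forest_add_edge R x y :
  symmetric R -> forest R -> ~~ connect R x y -> forest (add_edge R x y).
Proof.
move=> symR fR nxy u v; case: (boolP (joins x y u v)) => [uv _|nuv].
  have sub : subrel (connect (cut_edge (add_edge R x y) u v)) (connect R).
    apply: connect_sub => s t /= /andP[/orP[/connect1 //|st] /negP[]].
    by move: st; case/joinsP: uv => -[-> ->] //; rewrite joinsCl.
  apply: contra nxy => /sub.
  by case/joinsP: uv => -[-> ->] //; rewrite connectC.
rewrite /= (negPf nuv) orbF => Ruv.
have /eq_connect-> : cut_edge (add_edge R x y) u v =2 add_edge (cut_edge R u v) x y.
  move=> s t /=; case: (boolP (joins x y s t)) => [st|_]; last by rewrite !orbF.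
  rewrite !orbT /=; apply: contra nuv => /joinsP uv; apply/joinsP.
  by case/joinsP: st uv => -[-> ->] [[]|[]] -> ->; tauto.
have symC := cut_edge_sym u v symR.
rewrite connect_add_edge // !negb_or (fR _ _ Ruv) /=.
have sub : subrel (connect (cut_edge R u v)) (connect R).
  by apply: connect_sub => s t /= /andP[/connect1].
apply/andP; split; apply: contra nxy => /andP[/sub us /sub tv].
  rewrite connectC // in us; rewrite connectC // in tv.
  exact: connect_trans us (connect_trans (connect1 Ruv) tv).
rewrite symR in Ruv.
exact: connect_trans tv (connect_trans (connect1 Ruv) us).
Qed.

(** Walking along a relation of degree at most two is deterministic once the
    first step is chosen, so two simple walks leaving [u] together never part
    before one of them stops; and it can only stop at the far end. *)
Lemma walks_agree R p q t u :
  (forall a, #|[set b | R a b]| <= 2) -> symmetric R -> R t u ->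
  path R u p -> path R u q -> uniq (t :: u :: p) -> uniq (t :: u :: q) ->
  #|[set b | R (last u p) b]| <= 1 -> #|[set b | R (last u q) b]| <= 1 ->
  last u p = last u q.
Proof.
move=> deg2 symR; elim: p q t u => [|a p IH] [|b q] t u //= Rtu.
- move=> _ /andP[Rub _] _ /andP[] + _ end_u; rewrite !inE !negb_or => /and3P[_ tb _].
  have /subset_leq_card : [set t; b] \subset [set b | R u b].
    by apply/subsetP=> z; rewrite !inE => /orP[]/eqP-> //; rewrite symR.
  by rewrite cards2 tb => /leq_trans/(_ end_u).
- move=> /andP[Rua _] _ /andP[] + _ _ _ end_u; rewrite !inE !negb_or => /and3P[_ ta _].
  have /subset_leq_card : [set t; a] \subset [set b | R u b].
    by apply/subsetP=> z; rewrite !inE => /orP[]/eqP-> //; rewrite symR.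
  by rewrite cards2 ta => /leq_trans/(_ end_u).
- move=> /andP[Rua pa] /andP[Rub qb] /andP[tp up] /andP[tq uq].
  have ab : a = b.
    apply/eqP; apply: contraT => ab.
    have /subset_leq_card : t |: [set a; b] \subset [set b | R u b].
      by apply/subsetP=> z; rewrite !inE => /or3P[]/eqP-> //; rewrite symR.
    rewrite cardsU1 cards2 ab !inE => /leq_trans/(_ (deg2 u)).
    by move: tp tq; rewrite !inE !negb_or => /and3P[_ -> _] /and3P[_ -> _].
  rewrite -ab in qb uq *; apply: IH Rua pa qb up uq.
Qed.

(** Two walks from an end [u] agree, so that they cannot stop at different ends. *)
Lemma three_ends_rel R u v w :
  (forall a, #|[set b | R a b]| <= 2) -> symmetric R ->
  #|[set b | R u b]| <= 1 -> #|[set b | R v b]| <= 1 -> #|[set b | R w b]| <= 1 ->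
  u != v -> u != w -> v != w -> connect R u v -> ~~ connect R u w.
Proof.
move=> deg2 symR end_u end_v end_w uv uw vw /connectP[p0 p0path vE].
apply/negP=> /connectP[q0 q0path wE]; move: end_v end_w uv uw vw; rewrite vE wE.
case/shortenP: p0path => -[|a p] p_path p_uniq _; first by rewrite eqxx.
case/shortenP: q0path => -[|b q] q_path q_uniq _; first by rewrite eqxx.
move=> /= end_v end_w _ _ /eqP[]; move: p_path q_path p_uniq q_uniq => /=.
move=> /andP[Rua pa] /andP[Rub qb] pu qu.
have ab : a = b.
  apply/eqP; apply: contraT => ab.
  have /subset_leq_card : [set a; b] \subset [set b | R u b].
    by apply/subsetP=> z; rewrite !inE => /orP[]/eqP->.
  by rewrite cards2 ab => /leq_trans/(_ end_u).
rewrite -ab in qb qu end_w *; exact: (walks_agree deg2 symR Rua pa qb).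
Qed.

End Relations.

Arguments cut_edge {T} R x y u v /.
Arguments add_edge {T} R x y u v /.

(** * Partial edge colourings *)

Section Colourings.
Variables T K : finType.

(** A colouring of some of the pairs of vertices; the pairs of colour [None]
    are the non-edges, so that the same vertex type serves for all subgraphs. *)
Definition pcol := {ffun T * T -> option K}.
Implicit Types (f g : pcol) (u v w x y : T) (a b c : K) (s : T -> option K).

Definition supp f u v := f (u, v) != None.

(** Locked, so that membership is not unfolded by simplification. *)
Definition palette f u := locked [set a | [exists v, f (u, v) == Some a]].

Definition link f a b u v := (f (u, v) == Some a) || (f (u, v) == Some b).

Definition conn f a b := connect (link f a b).

Record colouring f : Prop := Colouring {
  col_sym : forall u v, f (u, v) = f (v, u);
  col_irr : forall u, f (u, u) = None;
  col_proper : forall u v w a, f (u, v) = Some a -> f (u, w) = Some a -> v = w;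
  col_forest : forall a b, forest (link f a b) }.

Definition clear f y : pcol :=
  [ffun e => if (e.1 == y) || (e.2 == y) then None else f e].

Definition restar f y s : pcol :=
  [ffun e => if e.1 == y then s e.2 else if e.2 == y then s e.1 else f e].

Lemma paletteP f u a : reflect (exists v, f (u, v) = Some a) (a \in palette f u).
Proof. by rewrite /palette -lock inE; apply: (iffP existsP) => -[v] /eqP; exists v. Qed.

Lemma mem_palette f u v a : f (u, v) = Some a -> a \in palette f u.
Proof. by move=> fuv; apply/paletteP; exists v. Qed.

Lemma notin_palette f u a v : a \notin palette f u -> f (u, v) == Some a = false.
Proof. by apply: contraNF => /eqP/mem_palette. Qed.

Lemma col_neq f u v a : colouring f -> f (u, v) = Some a -> v != u.
Proof. by move=> cf fuv; apply/eqP=> vu; rewrite vu (col_irr cf) in fuv. Qed.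

Lemma mem_palette2 f u v a : colouring f -> f (u, v) = Some a -> a \in palette f v.
Proof. by move=> cf; rewrite (col_sym cf) => /mem_palette. Qed.

Lemma link_sym f a b : colouring f -> symmetric (link f a b).
Proof. by move=> cf u v; rewrite /link (col_sym cf). Qed.

Lemma conn_sym f a b u v : colouring f -> conn f a b u v = conn f a b v u.
Proof. by move=> cf; apply/connectC/link_sym. Qed.

Lemma conn0 f a b u : conn f a b u u.
Proof. exact: connect0. Qed.

Lemma conn_swap f a b u v : conn f a b u v = conn f b a u v.
Proof. by apply: eq_connect => s t; rewrite /link orbC. Qed.

Lemma conn_edge f a b u v : f (u, v) = Some a -> conn f a b u v.
Proof. by move=> fuv; apply: connect1; rewrite /link fuv eqxx. Qed.

Lemma conn_trans f a b u v w : conn f a b u v -> conn f a b v w -> conn f a b u w.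
Proof. exact: connect_trans. Qed.

Lemma conn_iso f a b u v :
  a \notin palette f u -> b \notin palette f u -> u != v -> ~~ conn f a b u v.
Proof.
move=> au bu uv; apply/negP=> /connectP[[|w p] /=]; first by move=> _ vu; rewrite vu eqxx in uv.
by rewrite {1}/link !notin_palette.
Qed.

Lemma conn_in f a b u v :
  conn f a b u v -> u != v -> a \notin palette f u -> b \in palette f u.
Proof. by move=> + uv au; apply: contraTT => bu; apply: conn_iso. Qed.

Lemma conn_in_r f a b u v : colouring f ->
  conn f a b u v -> u != v -> a \notin palette f v -> b \in palette f v.
Proof. by move=> cf uv nuv; rewrite conn_sym // in uv; apply: (conn_in uv); rewrite eq_sym. Qed.

Lemma card_link1 f a b u : colouring f ->
  (a \notin palette f u) || (b \notin palette f u) ->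
  #|[set v | link f a b u v]| <= 1.
Proof.
move=> cf nu; apply/card_le1_eqP=> v w; rewrite !inE /link.
by case/orP: nu => nu; rewrite !(notin_palette _ nu) ?orbF /= => /eqP fv /eqP fw;
  apply: (col_proper cf fw fv).
Qed.

Lemma card_link2 f a b u : colouring f -> #|[set v | link f a b u v]| <= 2.
Proof.
move=> cf; have le1 c : #|[set v | f (u, v) == Some c]| <= 1.
  apply/card_le1_eqP=> v w; rewrite !inE => /eqP fv /eqP fw.
  exact: (col_proper cf fw fv).
rewrite (_ : [set _ | _] =
  [set v | f (u, v) == Some a] :|: [set v | f (u, v) == Some b]); last first.
  by apply/setP=> v; rewrite !inE.
apply: leq_trans (leq_card_setU _ _) _; rewrite -[2]/(1 + 1); exact: leq_add.
Qed.

(** A two-coloured component is a path, hence has at most two ends, the vertices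
    that miss one of its two colours. *)
Lemma three_ends f a b u v w : colouring f ->
  (a \notin palette f u) || (b \notin palette f u) ->
  (a \notin palette f v) || (b \notin palette f v) ->
  (a \notin palette f w) || (b \notin palette f w) ->
  u != v -> u != w -> v != w -> conn f a b u v -> ~~ conn f a b u w.
Proof.
move=> cf eu ev ew; apply: three_ends_rel; try exact: card_link1.
  by move=> z; apply: card_link2.
exact: link_sym.
Qed.

Section Star.
Variables (f : pcol) (y : T) (s : T -> option K).
Hypotheses (sy : s y = None) (s_inj : forall u v a, s u = Some a -> s v = Some a -> u = v).

Lemma clear_restar : clear (restar f y s) y = clear f y.
Proof. by apply/ffunP=> -[u v]; rewrite !ffunE /=; case: eqP => //; case: eqP. Qed.

Lemma link_star0 a b :
  (forall v, s v != Some a) -> (forall v, s v != Some b) ->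
  link (restar f y s) a b =2 link (clear f y) a b.
Proof.
move=> sa sb u v; rewrite /link !ffunE /=.
have n z : (s z == Some a) || (s z == Some b) = false.
  by rewrite (negPf (sa z)) (negPf (sb z)).
by have [_|_] := eqVneq u y; have [_|_] := eqVneq v y; rewrite /= ?n.
Qed.

Lemma star_eq w a v : s w = Some a -> (s v == Some a) = (v == w).
Proof. by move=> sw; apply/eqP/eqP=> [sv|->//]; apply: s_inj sw. Qed.

Lemma link_star1 a b w : s w = Some a -> (forall v, v != w -> s v != Some b) ->
  link (restar f y s) a b =2 add_edge (link (clear f y) a b) y w.
Proof.
move=> sw sb u v; rewrite /link /= /joins !ffunE /=.
have wy : y != w by apply: contra_eqN sy => /eqP->; rewrite sw.
have E z : (s z == Some a) || (s z == Some b) = (z == w).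
  rewrite (star_eq _ sw); case: eqP => //= /eqP/sb/negPf //.
have [->|uy] := eqVneq u y; have [->|vy] := eqVneq v y; rewrite /= ?E //.
all: by rewrite ?(negPf wy) ?andbT ?andbF ?orbF.
Qed.

Lemma link_star2 a b v w : s v = Some a -> s w = Some b ->
  link (restar f y s) a b =2 add_edge (add_edge (link (clear f y) a b) y v) y w.
Proof.
move=> sv sw u z; rewrite /link /= /joins !ffunE /=.
have vy : y != v by apply: contra_eqN sy => /eqP->; rewrite sv.
have wy : y != w by apply: contra_eqN sy => /eqP->; rewrite sw.
have E t : (s t == Some a) || (s t == Some b) = (t == v) || (t == w).
  by rewrite (star_eq _ sv) (star_eq _ sw).
have [->|uy] := eqVneq u y; have [->|zy] := eqVneq z y; rewrite /= ?E //.
all: by rewrite ?(negPf wy) ?(negPf vy) ?andbT ?andbF ?orbF.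
Qed.

End Star.

Lemma restar_id f y : colouring f -> restar f y (fun v => f (y, v)) = f.
Proof.
move=> cf; apply/ffunP=> -[u v]; rewrite ffunE /=.
by case: eqP => [->//|_]; case: eqP => [->|//]; rewrite (col_sym cf).
Qed.

Lemma supp_restar f y s u v :
  supp (restar f y s) u v = if u == y then s v != None
                            else if v == y then s u != None else supp f u v.
Proof. by rewrite /supp ffunE /=; case: ifP => // _; case: ifP. Qed.

Lemma clear_star f y u : clear f y (y, u) = None.
Proof. by rewrite ffunE /= eqxx. Qed.

Lemma palette_clear0 f y : palette (clear f y) y = set0.
Proof. by apply/setP=> a; rewrite in_set0; apply/paletteP=> -[v]; rewrite clear_star. Qed.

Lemma palette_clear_sub f y u : palette (clear f y) u \subset palette f u.
Proof.
apply/subsetP=> a /paletteP[v]; rewrite ffunE /=.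
by case: ifP => // _ /mem_palette.
Qed.

Lemma palette_clear_edge f y u a : colouring f -> f (y, u) = Some a ->
  palette (clear f y) u = palette f u :\ a.
Proof.
move=> cf fyu; have uy : u != y.
  by apply/eqP=> uy; move: fyu; rewrite uy (col_irr cf).
apply/setP=> b; rewrite in_setD1; apply/paletteP/andP=> [[v]|[ba /paletteP[v fuv]]].
  rewrite ffunE /= (negPf uy) /=; case: eqP => // vy fuv; split; last exact: mem_palette fuv.
  apply/eqP=> ba; case: vy; rewrite ba in fuv; apply: (col_proper cf fuv _).
  by rewrite (col_sym cf).
exists v; rewrite ffunE /= (negPf uy) /=; case: eqP => // vy.
by move: fuv ba; rewrite vy (col_sym cf) fyu => -[->]; rewrite eqxx.
Qed.

Lemma palette_clear_id f y u : colouring f -> f (y, u) = None -> u != y ->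
  palette (clear f y) u = palette f u.
Proof.
move=> cf fyu uy; apply/setP=> b; apply/paletteP/paletteP=> [[v]|[v fuv]].
  by rewrite ffunE /= (negPf uy) /=; case: eqP => // _ ?; exists v.
exists v; rewrite ffunE /= (negPf uy) /=; case: eqP => // vy.
by move: fuv; rewrite vy (col_sym cf) fyu.
Qed.

Lemma colouring_sub f g : colouring f -> (forall u v, g (u, v) = g (v, u)) ->
  (forall u v a, g (u, v) = Some a -> f (u, v) = Some a) -> colouring g.
Proof.
move=> cf symg sub; split=> // [u|u v w a guv guw|a b u v guv].
- case E: (g (u, u)) => [a|//]; by move/sub: E; rewrite (col_irr cf).
- by apply: (col_proper cf); apply: sub; eassumption.
have subl (s t : T) : link g a b s t -> link f a b s t.
  by case/orP=> /eqP/sub st; rewrite /link st eqxx ?orbT.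
apply: contra (col_forest cf (subl _ _ guv)); apply: connect_sub => s t.
by case/andP=> /subl st nst; apply: connect1; rewrite /= st.
Qed.

Lemma colouring_clear f y : colouring f -> colouring (clear f y).
Proof.
move=> cf; apply: (colouring_sub cf) => [u v|u v a]; rewrite !ffunE /=.
  by rewrite orbC (col_sym cf).
by case: ifP.
Qed.

Lemma conn_clear f y a b u v : conn (clear f y) a b u v -> conn f a b u v.
Proof.
apply: connect_sub => {}u {}v; rewrite /link !ffunE /=.
by case: ifP => // _ uv; apply: connect1.
Qed.

(** The colours at one vertex may be changed at will, as long as no two of its
    neighbours get joined by a path in the two colours that they receive: a
    two-coloured cycle of the new colouring has to pass through that vertex. *)
Lemma restarP f y s : colouring f -> s y = None ->
  (forall u v a, s u = Some a -> s v = Some a -> u = v) ->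
  (forall u a, s u = Some a -> a \notin palette (clear f y) u) ->
  (forall u v a b, u != v -> s u = Some a -> s v = Some b ->
     ~~ conn (clear f y) a b u v) ->
  colouring (restar f y s).
Proof.
move=> cf sy s_inj s_free s_acy; have cg := colouring_clear y cf.
split=> [u v|u|u v w a|a b].
- rewrite !ffunE /=; have [uy|_] := eqVneq u y; have [vy|_] := eqVneq v y; rewrite ?uy ?vy //.
  by rewrite (col_sym cf).
- by rewrite ffunE /=; case: eqP => [->//|_]; rewrite (col_irr cf).
- have off z t : z != y -> t != y -> f (z, t) = clear f y (z, t).
    by move=> zy ty; rewrite ffunE /= (negPf zy) (negPf ty).
  rewrite !ffunE /=; case: eqVneq => [_|uy]; first exact: s_inj.
  case: eqVneq => [->|vy]; case: eqVneq => [->|wy] //.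
  + by move=> /s_free/negP su; rewrite off // => /mem_palette.
  + by rewrite off // => /mem_palette fa /s_free/negP.
  + exact: (col_proper cf).
have symL := link_sym a b cg; have fL := col_forest cg (a := a) (b := b).
have isoL w : w != y -> ~~ connect (link (clear f y) a b) y w.
  by move=> wy; apply: conn_iso; rewrite ?palette_clear0 ?in_set0 // eq_sym.
have ys w c : s w = Some c -> w != y by move=> sw; apply: contra_eqN sy => /eqP<-; rewrite sw.
have star1 c d w : s w = Some c -> (forall v, v != w -> s v != Some d) ->
    forest (link (restar f y s) c d).
  move=> sw sd; have symc := link_sym c d cg.
  apply: (@forest_eq _ (add_edge (link (clear f y) c d) y w)).
    by move=> p q; rewrite (link_star1 _ sy s_inj sw sd).
  apply: forest_add_edge => //; first exact: (col_forest cg).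
  by apply: conn_iso; rewrite ?palette_clear0 ?in_set0 // eq_sym (ys _ _ sw).
have [/existsP[v /eqP sv]|/existsPn na] := boolP [exists v, s v == Some a]; last first.
  have [/existsP[w /eqP sw]|/existsPn nb] := boolP [exists v, s v == Some b].
    apply: (@forest_eq _ (link (restar f y s) b a)); first by move=> p q; rewrite /link orbC.
    by apply: star1 sw _.
  by apply: (@forest_eq _ (link (clear f y) a b)) => // p q; rewrite link_star0.
have [/existsP[w /eqP sw]|/existsPn nb] := boolP [exists v, s v == Some b]; last first.
  by apply: star1 sv _.
have [vw|vw] := eqVneq v w.
  by apply: (star1 _ _ _ sv) => z zv; rewrite (star_eq s_inj _ sw) -vw.
apply: (@forest_eq _ (add_edge (add_edge (link (clear f y) a b) y v) y w)).
  by move=> p q; rewrite (link_star2 _ sy s_inj sv sw).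
have vy := ys _ _ sv; have wy := ys _ _ sw.
apply: forest_add_edge; first exact: add_edge_sym.
  by apply: forest_add_edge => //; apply: isoL.
rewrite connect_add_edge // (negPf (isoL _ wy)) (negPf (isoL _ vy)) connect0 /=.
by rewrite orbF; apply: s_acy sv sw.
Qed.

(** How the paths of [f] arise from those that avoid [y]: with one of the two
    colours missing at [y], a path can only end there; with both present, it can
    pass through. *)
Section Leaf.
Variables (f : pcol) (y : T).
Hypothesis cf : colouring f.
Let cg := colouring_clear y cf.

Let iso a b w : w != y -> conn (clear f y) a b y w = false.
Proof. by move=> wy; apply/negbTE/conn_iso; rewrite ?palette_clear0 ?in_set0 // eq_sym. Qed.

Let sy : f (y, y) = None. Proof. exact: col_irr cf y. Qed.
Let s_inj u v a : f (y, u) = Some a -> f (y, v) = Some a -> u = v.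
Proof. exact: (col_proper cf). Qed.

Lemma conn_leaf1 a b w u v : f (y, w) = Some a -> b \notin palette f y ->
  u != y -> conn f a b u v = if v == y then conn (clear f y) a b u w
                             else conn (clear f y) a b u v.
Proof.
move=> fw fb uy; have symL := link_sym a b cg.
have wy := col_neq cf fw.
have sb v' : v' != w -> f (y, v') != Some b by move=> _; rewrite notin_palette.
rewrite -{1}(restar_id y cf) /conn (eq_connect (link_star1 _ sy s_inj fw sb)).
rewrite connect_add_edge // -!/(conn _ _ _ _ _).
rewrite (conn_sym _ _ _ y cg) iso //=.
case: eqVneq => [->|vy]; last by rewrite iso // andbF orbF.
by rewrite (conn_sym _ _ _ y cg) iso //= conn0 andbT.
Qed.

Lemma conn_skip a b u v : (a \notin palette f y) || (b \notin palette f y) ->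
  u != y -> v != y -> conn f a b u v = conn (clear f y) a b u v.
Proof.
wlog nb : a b / b \notin palette f y => [IH /orP[] nu uy vy|_ uy vy]; last first.
- have [/paletteP[w fw]|na] := boolP (a \in palette f y).
    by rewrite (conn_leaf1 _ fw) // (negPf vy).
  have sa c : c \notin palette f y -> forall t, f (y, t) != Some c.
    by move=> nc t; rewrite notin_palette.
  by rewrite -{1}(restar_id y cf) /conn (eq_connect (link_star0 _ _ (sa _ na) (sa _ nb))).
- by apply: IH => //; rewrite nu orbT.
by rewrite conn_swap IH ?nu ?orbT // conn_swap.
Qed.

Lemma conn_leaf a b w u : f (y, w) = Some a -> b \notin palette f y ->
  u != y -> conn f a b u y = conn (clear f y) a b u w.
Proof. by move=> fw fb uy; rewrite (conn_leaf1 _ fw) // eqxx. Qed.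

Lemma conn_through a b v w p q : f (y, v) = Some a -> f (y, w) = Some b ->
  p != y -> q != y ->
  conn f a b p q = [|| conn (clear f y) a b p q,
      conn (clear f y) a b p v && conn (clear f y) a b w q
    | conn (clear f y) a b p w && conn (clear f y) a b v q].
Proof.
move=> fv fw py qy; have symL := link_sym a b cg.
have vy := col_neq cf fv.
have wy := col_neq cf fw.
rewrite -{1}(restar_id y cf) /conn (eq_connect (link_star2 _ sy s_inj fv fw)).
rewrite connect_add_edge; last exact: add_edge_sym.
rewrite !connect_add_edge // -!/(conn _ _ _ _ _) !conn0 !iso // !(conn_sym _ _ _ y cg) !iso //.
by rewrite !(andbF, andFb, orbF, andbT).
Qed.

(** Otherwise the two edges at [y] would close a cycle. *)
Lemma star_acyclic a b v w : f (y, v) = Some a -> f (y, w) = Some b -> v != w ->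
  ~~ conn (clear f y) a b v w.
Proof.
move=> fv fw vw; have symL := link_sym a b cg.
have vy := col_neq cf fv.
have lw : link f a b y w by rewrite /link fw eqxx orbT.
apply: contra (col_forest cf lw) => vw_conn.
have v_step : cut_edge (link f a b) y w y v.
  by rewrite /= /link fv eqxx /= /joins eqxx /= (negPf vw) (negPf vy) andbF.
apply: connect_trans (connect1 v_step) _.
apply: connect_sub vw_conn => s t st; apply: connect1.
move: st; rewrite /= /link !ffunE /=; case: ifP => // /norP[sy' ty] -> /=.
by rewrite /joins (negPf sy') (negPf ty) andbF.
Qed.

End Leaf.

End Colourings.

Section Recolour.
Variables T K : finType.
Implicit Types (f g : pcol T K) (u v w x y : T) (a b c : K) (al : seq (T * K)).

(** The colours at [y] after the changes listed in [al]; the neighbours that [al]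
    does not mention keep their colours. *)
Definition assign f y al v : option K :=
  foldr (fun p o => if v == p.1 then Some p.2 else o) (f (y, v)) al.

Definition recolour f y al : pcol T K := restar f y (assign f y al).

Lemma assign_in f y al p : uniq (unzip1 al) -> p \in al -> assign f y al p.1 = Some p.2.
Proof.
elim: al => //= q al IH /andP[qal al_uniq]; rewrite inE => /predU1P[->|pal].
  by rewrite eqxx.
case: eqP => [pq|_]; last exact: IH.
by rewrite -pq (map_f fst pal) in qal.
Qed.

Lemma assign_some f y al v : v \in unzip1 al -> assign f y al v != None.
Proof. by elim: al => //= p al IH; rewrite inE; case: (v =P p.1). Qed.

Lemma assign_out f y al v : v \notin unzip1 al -> assign f y al v = f (y, v).
Proof. by elim: al => //= p al IH; rewrite inE negb_or => /andP[/negPf-> /IH]. Qed.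

(** Only the pairs of edges that involve a recoloured one can close a cycle. *)
Lemma recolourP f y al : colouring f -> uniq (unzip1 al) -> uniq (unzip2 al) ->
  y \notin unzip1 al ->
  {in al, forall p, p.2 \notin palette (clear f y) p.1} ->
  {in al, forall p v, f (y, v) = Some p.2 -> v \in unzip1 al} ->
  {in al, forall p v b, v \notin unzip1 al -> f (y, v) = Some b ->
     ~~ conn (clear f y) p.2 b p.1 v} ->
  pairwise (fun p q => ~~ conn (clear f y) p.2 q.2 p.1 q.1) al ->
  colouring (recolour f y al).
Proof.
move=> cf al1 al2 yal al_free al_inj al_out al_pair.
have sP v a : assign f y al v = Some a ->
    (v, a) \in al \/ v \notin unzip1 al /\ f (y, v) = Some a.
  have [/mapP[p pal ->]|vn] := boolP (v \in unzip1 al).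
    by rewrite assign_in // => -[<-]; rewrite -surjective_pairing; left.
  by rewrite assign_out //; right.
have cg := colouring_clear y cf.
have pairP p q : p \in al -> q \in al -> p != q ->
    ~~ conn (clear f y) p.2 q.2 p.1 q.1.
  have symP : symmetric (fun p q => ~~ conn (clear f y) p.2 q.2 p.1 q.1).
    by move=> r t; rewrite conn_sym // conn_swap.
  elim: (al) al_pair => //= r s IH /andP[/allP rs pw]; rewrite !inE.
  case/predU1P=> [->|ps] /predU1P[->|qs]; rewrite ?eqxx //; last exact: IH.
    by move=> _; apply: rs.
  by move=> _; rewrite symP; apply: rs.
apply: restarP => // [|u v a /sP su /sP sv|u a /sP[/al_free//|[_ fu]]|u v a b uv /sP su /sP sv].
- by rewrite assign_out // (col_irr cf).
- have inj2 p q : p \in al -> q \in al -> p.2 = q.2 -> p.1 = q.1.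
    move=> pal qal pq; suff -> : p = q by [].
    rewrite -(nth_index p pal) -(nth_index p qal); congr nth; apply/eqP.
    rewrite -(nth_uniq p.2 _ _ al2) ?size_map ?index_mem //.
    by rewrite !(nth_map p) ?index_mem // !nth_index // pq.
  case: su sv => [ual|[un fu]] [val|[vn fv]].
  + exact: (inj2 _ _ ual val).
  + by case/negP: vn; apply: al_inj ual _ fv.
  + by case/negP: un; apply: al_inj val _ fu.
  + exact: (col_proper cf fu fv).
- by rewrite (palette_clear_edge cf fu) in_setD1 eqxx.
case: su sv => [ual|[un fu]] [val|[vn fv]].
- apply: (pairP (u, a) (v, b)) => //; by apply: contraNneq uv => -[->].
- exact: (al_out _ ual).
- by rewrite conn_swap conn_sym //; apply: (al_out _ val).
- exact: star_acyclic.
Qed.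

Lemma recolourE f y al u v : colouring f -> u != y -> u \notin unzip1 al ->
  recolour f y al (u, v) = f (u, v).
Proof.
move=> cf uy ual; rewrite ffunE /= (negPf uy) assign_out // (col_sym cf y).
by case: eqP => [->|].
Qed.

Lemma recolour_star f y al v : recolour f y al (y, v) = assign f y al v.
Proof. by rewrite ffunE /= eqxx. Qed.

Lemma palette_recolour f y al u : colouring f -> u != y -> u \notin unzip1 al ->
  palette (recolour f y al) u = palette f u.
Proof.
move=> cf uy ual; apply/setP=> a; apply/paletteP/paletteP=> -[v].
  by rewrite recolourE // => fuv; exists v.
by move=> fuv; exists v; rewrite recolourE.
Qed.

Lemma clear_recolour f y al : clear (recolour f y al) y = clear f y.
Proof. exact: clear_restar. Qed.

Lemma clear_clear_recolour f x y al :
  clear (clear (recolour f x al) y) x = clear (clear f y) x.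
Proof.
apply/ffunP=> -[u v]; rewrite !ffunE /=.
by case: (u == x); case: (v == x).
Qed.

Lemma palette_clear_recolour f x y al u : colouring f -> u != x -> u \notin unzip1 al ->
  palette (clear (recolour f x al) y) u = palette (clear f y) u.
Proof.
move=> cf ux ual; apply/setP=> a; apply/paletteP/paletteP=> -[v] guv; exists v;
  by move: guv; rewrite ![clear _ _ _]ffunE recolourE.
Qed.

End Recolour.

(** * Extending a colouring to one more edge *)

Section Extension.
Variables T K : finType.
Implicit Types (e : rel T) (f g : pcol T K) (u v w x y : T) (a b c : K) (al : seq (T * K)).

Definition edeg e u := #|[set v | e u v]|.

Definition colourable e := exists f : pcol T K, colouring f /\ supp f =2 e.

Lemma supp_palette f u v : supp f u v -> exists a, f (u, v) = Some a.
Proof. by rewrite /supp; case: (f _) => // a _; exists a. Qed.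

Lemma edge_supp f u v a : f (u, v) = Some a -> supp f u v.
Proof. by rewrite /supp => ->. Qed.

Lemma card_palette_supp f u : colouring f -> #|palette f u| = #|[set v | supp f u v]|.
Proof.
move=> cf; have Some_inj : injective (@Some K) by move=> ? ? [].
rewrite -(card_imset _ Some_inj) -(card_in_imset (f := fun v => f (u, v))).
  congr #|pred_of_set _|; apply/setP=> o; apply/imsetP/imsetP=> -[].
    by move=> a /paletteP[v fv] ->; exists v => //; rewrite inE (edge_supp fv).
  by move=> v; rewrite inE => /supp_palette[a fv] ->; exists a; rewrite ?(mem_palette fv).
move=> v w; rewrite !inE => /supp_palette[a fv] _ fvw; rewrite fv in fvw.
by apply: (col_proper cf fv); rewrite -fvw.
Qed.

Lemma card_palette e f u (S : {set T}) : colouring f ->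
  (forall v, supp f u v -> e u v) -> {in S, forall v, e u v && (f (u, v) == None)} ->
  #|palette f u| + #|S| <= edeg e u.
Proof.
move=> cf fe Se; rewrite card_palette_supp // -cardsUI.
rewrite (_ : _ :&: _ = set0) ?cards0 ?addn0.
  apply/subset_leq_card/subsetP=> v; rewrite !inE => /orP[/fe//|/Se/andP[]//].
by apply/setP=> v; rewrite !inE /supp; apply/negP=> /andP[fv /Se/andP[_ /eqP fN]]; rewrite fN in fv.
Qed.

Lemma card_palette_le e f u : colouring f -> (forall v, supp f u v -> e u v) -> #|palette f u| <= edeg e u.
Proof.
move=> cf fe; have := @card_palette e f u set0 cf fe; rewrite cards0 addn0; apply=> v.
by rewrite inE.
Qed.

Lemma card_palette_lt e f u v : colouring f -> (forall v, supp f u v -> e u v) ->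
  e u v -> f (u, v) = None -> #|palette f u| < edeg e u.
Proof.
move=> cf fe uv fuv; rewrite -addn1 -(cards1 v); apply: card_palette => // w /set1P->.
by rewrite uv fuv eqxx.
Qed.

Lemma ex_missing (A : {set K}) f u : #|palette f u| + #|A| < #|K| ->
  exists c, (c \notin palette f u) && (c \notin A).
Proof.
move=> lt; have : ~~ [forall c, c \in palette f u :|: A].
  apply/negP=> /forallP full; have : #|K| <= #|palette f u :|: A|.
    by rewrite -cardsT; apply/subset_leq_card/subsetP.
  by move/leq_trans/(_ (leq_card_setU _ _)); rewrite leqNgt lt.
by case/forallPn=> c; rewrite inE negb_or => nc; exists c.
Qed.

Section OneEdge.
Variables (e : rel T) (x y : T) (f : pcol T K).
Hypotheses (e_sym : symmetric e) (e_irr : irreflexive e) (exy : e x y).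
Hypotheses (cf : colouring f) (fe : supp f =2 cut_edge e x y).

Lemma sub_supp u v : supp f u v -> e u v.
Proof. by rewrite fe => /andP[]. Qed.

Lemma hole : f (x, y) = None.
Proof. by apply/eqP; have := fe x y; rewrite /supp /= /joins !eqxx andbF; case: eqP. Qed.

Lemma holeC : f (y, x) = None.
Proof. by rewrite (col_sym cf) hole. Qed.

Lemma neq_ends : x != y.
Proof. by apply/eqP=> xy; move: exy; rewrite xy e_irr. Qed.

Lemma palette_lt_x : #|palette f x| < edeg e x.
Proof. exact: (card_palette_lt cf (@sub_supp x) exy hole). Qed.

Lemma palette_lt_y : #|palette f y| < edeg e y.
Proof. by apply: (card_palette_lt cf (@sub_supp y) _ holeC); rewrite e_sym. Qed.

Lemma palette_le u : #|palette f u| <= edeg e u.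
Proof. exact: (card_palette_le cf (@sub_supp u)). Qed.

(** Recolouring at [y] may colour the missing edge at the same time. *)
Lemma colourable_recolour al : x \in unzip1 al -> {in unzip1 al, forall v, e y v} ->
  colouring (recolour f y al) -> colourable e.
Proof.
move=> xal al_e cr; exists (recolour f y al); split=> // u v.
have star w : (assign f y al w != None) = e y w.
  have [wal|wn] := boolP (w \in unzip1 al).
    by rewrite al_e // assign_some.
  have wx : w != x by apply: contraNneq wn => ->.
  rewrite assign_out // -/(supp f y w) fe /= /joins (negPf wx) andbF orbF.
  by rewrite eq_sym (negPf neq_ends) andbT.
rewrite supp_restar; have [->|uy] := eqVneq u y; first exact: star.
have [->|vy] := eqVneq v y; first by rewrite star e_sym.
by rewrite fe /= /joins (negPf uy) (negPf vy) andbF andbT.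
Qed.

Lemma colourable_assign al : x \in unzip1 al -> {in unzip1 al, forall v, e y v} ->
  uniq (unzip1 al) -> uniq (unzip2 al) ->
  {in al, forall p, p.2 \notin palette (clear f y) p.1} ->
  {in al, forall p v, f (y, v) = Some p.2 -> v \in unzip1 al} ->
  {in al, forall p v b, v \notin unzip1 al -> f (y, v) = Some b ->
     ~~ conn (clear f y) p.2 b p.1 v} ->
  pairwise (fun p q => ~~ conn (clear f y) p.2 q.2 p.1 q.1) al ->
  colourable e.
Proof.
move=> xal al_e al1 al2 al_free al_inj al_out al_pair.
apply: (colourable_recolour xal) => //; apply: recolourP => //.
by apply/negP=> /al_e; rewrite e_irr.
Qed.

Lemma supp_recolour g z al : colouring g -> {in unzip1 al, forall v, supp g z v} ->
  supp (recolour g z al) =2 supp g.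
Proof.
move=> cg al_e u v; have star w : (assign g z al w != None) = supp g z w.
  have [wal|wn] := boolP (w \in unzip1 al).
    by rewrite al_e // assign_some.
  by rewrite assign_out.
rewrite supp_restar; have [->|uy] := eqVneq u z; first exact: star.
have [->|//] := eqVneq v z; first by rewrite star /supp (col_sym cg).
Qed.

(** The new edge may take a colour unless it closes a two-coloured path. *)
Lemma colourable_edge c : c \notin palette f x -> c \notin palette f y ->
  (forall a, a \in palette f x -> a \in palette f y -> ~~ conn f a c x y) ->
  colourable e.
Proof.
move=> cx cy acy; have xy := neq_ends.
apply: (@colourable_recolour [:: (x, c)]) => [|v|]; rewrite ?mem_head //.
  by rewrite inE => /eqP->; rewrite e_sym.
apply: recolourP => //= [|p|p|p]; rewrite ?inE ?(eq_sym y) ?xy // => /eqP-> /=.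
- by rewrite (palette_clear_id cf holeC xy).
- by move=> v fv; rewrite (mem_palette fv) in cy.
move=> v b _ fv; have [bx|bx] := boolP (b \in palette f x).
  have := acy b bx (mem_palette fv); rewrite (conn_leaf cf fv cy xy).
  by rewrite conn_swap.
apply: conn_iso; rewrite ?(palette_clear_id cf holeC xy) //.
by apply: contra_eqN holeC => /eqP->; rewrite fv.
Qed.

End OneEdge.

End Extension.

(** * Edges with an end of degree at most two *)

Section LowDegree.
Variables (T K : finType) (e : rel T) (D : nat) (x y : T).
Hypotheses (e_sym : symmetric e) (e_irr : irreflexive e) (K_card : #|K| = D.+1).
Hypothesis deg_le : forall u, edeg e u <= D.
Hypothesis deg_sum : forall u v, e u v -> edeg e u + edeg e v <= D + 3.
Hypothesis exy : e x y.
Implicit Types f g : pcol T K.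

(** If [a] is the only colour at [x], then only paths that start with [a] block. *)
Lemma one_colour g a : colouring g -> supp g =2 cut_edge e x y -> palette g x = [set a] ->
  colourable K e \/ exists2 w, g (y, w) = Some a &
    forall c, c \notin palette g y -> conn (clear g y) a c x w.
Proof.
move=> cg ge gx; have xy := neq_ends e_irr exy.
have [/existsP[c /and3P[cy ca acy]]|/existsPn none] := boolP [exists c,
  [&& c \notin palette g y, c != a & (a \in palette g y) ==> ~~ conn g a c x y]].
  left; apply: (colourable_edge e_sym e_irr exy cg ge) cy _; rewrite gx ?in_set1 //.
  by move=> b; rewrite in_set1 => /eqP-> ay; rewrite ay in acy.
right; have ay : a \in palette g y.
  apply: contraT => ay; have [|c /andP[cy]] := @ex_missing _ _ [set a] g y.
    rewrite cards1 K_card addn1 ltnS; apply: leq_trans (deg_le y).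
    exact: (palette_lt_y e_sym exy cg ge).
  by rewrite in_set1 => ca; have := none c; rewrite cy ca (negPf ay).
have [w gyw] := paletteP _ _ _ ay; exists w => // c cy; have := none c.
rewrite cy ay (contraNneq _ cy) => /= [|->//].
by rewrite negbK (conn_leaf cg gyw).
Qed.

(** Blocked by [a] as well as by another colour [b] in its place, the colours
    missing at [y] all occur at both ends [w], [w'] of the edges from [y] of
    these two colours; the degree sum leaves no room for other colours there.
    Exchanging the colours of these edges is thus acyclic, and it redirects the
    path from [x] away from [y]. *)
Lemma colourable_low : edeg e x <= 2 -> colourable K (cut_edge e x y) -> colourable K e.
Proof.
move=> x_low [f [cf fe]]; have xy := neq_ends e_irr exy; have fxy := hole fe.
have fyx := holeC cf fe.
have F_y := palette_lt_y e_sym exy cf fe; have F_x := palette_lt_x exy cf fe.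
have [F0|[a ax]] := set_0Vmem (palette f x).
  have [|c /andP[cy _]] := @ex_missing _ _ set0 f y.
    by rewrite cards0 addn0 K_card ltnS (leq_trans (ltnW F_y)).
  by apply: (colourable_edge e_sym e_irr exy cf fe) cy _; rewrite F0 ?in_set0 // => b; rewrite in_set0.
have Fx : palette f x = [set a].
  apply/esym/eqP; rewrite eqEcard sub1set ax cards1.
  by rewrite -ltnS (leq_trans F_x).
have [x1 fx1] := paletteP _ _ _ ax.
have [//|[w fyw w_conn]] := one_colour cf fe Fx.
have [|b /andP[bx1 _]] := @ex_missing _ _ set0 f x1.
  by rewrite cards0 addn0 K_card ltnS (leq_trans (palette_le cf fe x1)).
have ab : a != b by apply: contraNneq bx1 => <-; apply: (mem_palette2 cf fx1).
have x1x := col_neq cf fx1.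
pose f' := recolour f x [:: (x1, b)].
have cf' : colouring f'.
  apply: recolourP => //= [|p|p|p]; rewrite ?in_cons ?in_nil ?orbF ?(eq_sym x) // => /eqP-> /=.
  - by apply: contra bx1; apply/subsetP/palette_clear_sub.
  - by move=> v /mem_palette; rewrite Fx in_set1 eq_sym (negPf ab).
  move=> v c vx1 fv; have := mem_palette fv; rewrite Fx in_set1 => /eqP ca.
  by rewrite ca in fv; rewrite (col_proper cf fv fx1) mem_head in vx1.
have f'e : supp f' =2 cut_edge e x y.
  move=> u v; rewrite -fe; apply: supp_recolour => // z.
  by rewrite inE => /eqP->; apply: edge_supp fx1.
have f'E u v : u != x -> u != x1 -> f' (u, v) = f (u, v).
  move=> ux ux1; rewrite ffunE /= (negPf ux) /assign /= (negPf ux1) (col_sym cf x).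
  by case: eqP => [->|].
have yx1 : y != x1 by apply: contra_eqN fxy => /eqP->; rewrite fx1.
have f'y v : f' (y, v) = f (y, v) by rewrite f'E // eq_sym.
have f'x : palette f' x = [set b].
  apply/eqP; rewrite eqEsubset sub1set; apply/andP; split; last first.
    by apply/paletteP; exists x1; rewrite ffunE /= eqxx /assign /= eqxx.
  apply/subsetP=> c /paletteP[v]; rewrite ffunE /= eqxx /assign /=.
  case: eqP => [_ [->]|vx1 fv]; first by rewrite in_set1.
  have := mem_palette fv; rewrite Fx in_set1 => /eqP ca; rewrite ca in fv.
  by case: vx1; apply: (col_proper cf fv fx1).
have [//|[w' f'yw' w'_conn]] := one_colour cf' f'e f'x.
have fyw' : f (y, w') = Some b by rewrite -f'y.
have w'x : w' != x by apply: contra_eqN fyx => /eqP<-; rewrite fyw'.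
have wx : w != x by apply: contra_eqN fyx => /eqP<-; rewrite fyw.
have w'x1 : w' != x1.
  by apply: contraNneq bx1 => <-; apply: (mem_palette2 cf fyw').
have ww' : w != w' by apply: contra_neq ab => ww'; move: fyw; rewrite ww' fyw' => -[].
have wy := col_neq cf fyw; have w'y := col_neq cf fyw'.
have full z d : f (y, z) = Some d -> (forall c, c \notin palette f y -> c \in palette f z) ->
    palette f z = d |: ~: palette f y.
  move=> fyz cz; apply/esym/eqP; rewrite eqEcard; apply/andP; split.
    apply/subsetP=> c; rewrite in_setU1 in_setC => /predU1P[->|/cz//].
    exact: (mem_palette2 cf fyz).
  have yz : e y z by apply: (sub_supp fe); apply: edge_supp fyz.
  have := deg_sum yz; have := cardsC (palette f y); have := palette_le cf fe z.
  by rewrite cardsU1 in_setC negbK (mem_palette fyz) K_card; move: F_y; clear; lia.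
have Fw : palette f w = a |: ~: palette f y.
  apply: (full _ _ fyw) => c cy; apply: (subsetP (palette_clear_sub f y w)).
  apply: (conn_in_r (colouring_clear y cf) (w_conn c cy)); first by rewrite eq_sym.
  by rewrite (palette_clear_edge cf fyw) in_setD1 eqxx.
have Fw' : palette f w' = b |: ~: palette f y.
  apply: (full _ _ fyw') => c cy; have cy' : c \notin palette f' y.
    by apply: contra cy => /paletteP[v]; rewrite f'y => /mem_palette.
  have : c \in palette f' w'.
    apply: (subsetP (palette_clear_sub f' y w')).
    apply: (conn_in_r (colouring_clear y cf') (w'_conn c cy')); first by rewrite eq_sym.
    by rewrite (palette_clear_edge cf' f'yw') in_setD1 eqxx.
  by case/paletteP=> v; rewrite f'E // => /mem_palette.
have [|c /andP[cy _]] := @ex_missing _ _ set0 f y.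
  by rewrite cards0 addn0 K_card ltnS (leq_trans (ltnW F_y)).
have ay := mem_palette fyw; have b_y := mem_palette fyw'.
have ca : c != a by apply: contraNneq cy => ->.
have cb : c != b by apply: contraNneq cy => ->.
have cg := colouring_clear y cf.
have Gx : palette (clear f y) x = [set a] by rewrite palette_clear_id.
have Gw : palette (clear f y) w = ~: palette f y.
  by rewrite (palette_clear_edge cf fyw) Fw setU1K // in_setC negbK.
have Gw' : palette (clear f y) w' = ~: palette f y.
  by rewrite (palette_clear_edge cf fyw') Fw' setU1K // in_setC negbK.
apply: (@colourable_recolour _ _ _ _ _ _ e_sym e_irr exy fe [:: (x, c); (w, b); (w', a)]).
- by rewrite inE eqxx.
- by move=> v; rewrite !inE => /or3P[]/eqP->; rewrite ?(e_sym y) //;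
    rewrite e_sym; apply: (sub_supp fe); [apply: edge_supp fyw|apply: edge_supp fyw'].
have xw : x != w by rewrite eq_sym.
have xw' : x != w' by rewrite eq_sym.
apply: recolourP => //= [|||p|p|p|].
- by rewrite !inE !negb_or xw xw' ww'.
- by rewrite !inE !negb_or cb ca eq_sym ab.
- by rewrite !inE !negb_or eq_sym xy ![y == _]eq_sym wy w'y.
- by rewrite !in_cons in_nil orbF => /or3P[]/eqP-> /=;
    rewrite ?Gx ?Gw ?Gw' ?in_set1 // in_setC negbK.
- rewrite !in_cons !in_nil !orbF => /or3P[]/eqP-> v /= fv.
  + by rewrite (mem_palette fv) in cy.
  + by rewrite (col_proper cf fv fyw') !inE eqxx !orbT.
  + by rewrite (col_proper cf fv fyw) !inE eqxx !orbT.
- move=> pal v d; rewrite !in_cons in_nil orbF !negb_or => /and3P[vx vw vw'] fv.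
  have dy := mem_palette fv.
  have da : d != a by apply: contraNneq vw => da; rewrite da in fv; apply/eqP/(col_proper cf fv fyw).
  by move: pal; rewrite !in_cons in_nil orbF => /or3P[]/eqP-> /=; apply: conn_iso;
    rewrite ?Gx ?Gw ?Gw' ?in_set1 ?in_setC ?negbK // eq_sym.
rewrite !andbT -andbA; apply/and3P; split.
- by apply: conn_iso; rewrite ?Gx ?in_set1 // eq_sym.
- rewrite conn_swap; apply: (three_ends _ _ _ _ _ _ _ (w_conn c cy)) => //;
    by rewrite ?Gx ?Gw ?Gw' ?in_set1 ?in_setC ?negbK ?ay ?ca ?orbT.
- by apply: conn_iso; rewrite ?Gw ?in_setC ?negbK.
Qed.

End LowDegree.

(** * A vertex of degree less than the maximum whose neighbours have degree at most three *)

Section SmallNeighbours.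
Variables (T K : finType) (e : rel T) (D : nat) (x y : T).
Hypotheses (e_sym : symmetric e) (e_irr : irreflexive e) (K_card : #|K| = D.+1).
Hypothesis deg_le : forall u, edeg e u <= D.
Hypotheses (exy : e x y) (deg_x : edeg e x = 3) (deg_y : edeg e y < D).
Hypothesis small : forall z, e y z -> edeg e z <= 3.

Section Fixed.
Variable f : pcol T K.
Hypotheses (cf : colouring f) (fe : supp f =2 cut_edge e x y).
Let g := clear f y.
Let cg : colouring g := colouring_clear y cf.
Let fxy := hole fe.
Let fyx := holeC cf fe.
Let xy := neq_ends e_irr exy.

Lemma star_edge v a : f (y, v) = Some a -> e y v.
Proof. by move=> fyv; apply: (sub_supp fe); apply: edge_supp fyv. Qed.

Lemma star_neq_x v a : f (y, v) = Some a -> v != x.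
Proof. by move=> fyv; apply: contra_eqN fyx => /eqP<-; rewrite fyv. Qed.

Lemma card_palette_small v a : f (y, v) = Some a -> #|palette g v| <= 2.
Proof.
move=> fyv; have := small (star_edge fyv); have := palette_le cf fe v.
have := mem_palette2 cf fyv.
rewrite /g (palette_clear_edge cf fyv) (cardsD1 a (palette f v)) => ->; lia.
Qed.

Lemma star_free v a : f (y, v) = Some a -> a \notin palette g v.
Proof. by move=> fyv; rewrite /g (palette_clear_edge cf fyv) in_setD1 eqxx. Qed.

Lemma card_missing : 3 <= #|~: palette f y|.
Proof.
by have := cardsC (palette f y); have := palette_lt_y e_sym exy cf fe; rewrite K_card; lia.
Qed.

Lemma palette_x_clear : palette g x = palette f x.
Proof. by rewrite /g palette_clear_id. Qed.

(** If both colours [a1], [a2] at [x] occur at [y], a colour missing at [y] is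
    blocked by a path ending in one of two neighbours of [y] of degree three.
    The one that blocks two colours can then take a third one. *)
Lemma small_two_common a1 a2 y1 y2 (C := ~: palette f y)
    (C1 := [set c in C | conn g a1 c x y1]) (C2 := [set c in C | conn g a2 c x y2]) :
  a1 != a2 -> palette f x = [set a1; a2] -> f (y, y1) = Some a1 -> f (y, y2) = Some a2 ->
  C \subset C1 :|: C2 -> 2 <= #|C1| -> colourable K e.
Proof.
move=> a12 Fx fy1 fy2 C12 C1_ge2; have y1x := star_neq_x fy1; have y2x := star_neq_x fy2.
have G1 : palette g y1 = C1.
  apply/esym/eqP; rewrite eqEcard (leq_trans (card_palette_small fy1)) // andbT.
  apply/subsetP=> c; rewrite in_set => /andP[_ /(conn_in_r cg)]; apply; first by rewrite eq_sym.
  exact: star_free fy1.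
have C2_le : #|C2| <= 2.
  apply: leq_trans (card_palette_small fy2); apply/subset_leq_card/subsetP=> c.
  rewrite in_set => /andP[_ /(conn_in_r cg)]; apply; first by rewrite eq_sym.
  exact: star_free fy2.
have C1_le : #|C1| <= 2 by rewrite -G1 (card_palette_small fy1).
have C_ge := card_missing; have C1C : C1 \subset C by apply/subsetP=> c; rewrite in_set => /andP[].
have /subsetPn[r rC rC1] : ~~ (C \subset C1).
  by apply/negP=> /subset_leq_card; rewrite -/C in C_ge *; lia.
have /subsetPn[c cC1 cC2] : ~~ (C1 \subset C2).
  apply/negP=> C1C2; have C2E : C1 = C2.
    by apply/eqP; rewrite eqEcard C1C2 (leq_trans C2_le).
  by move: rC1; rewrite (_ : r \in C1) // -[C1]setUid {2}C2E (subsetP C12).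
have cC := subsetP C1C _ cC1; rewrite in_setC in cC; rewrite in_setC in rC.
have ca1 : c != a1 by apply: contraNneq cC => ->; apply: mem_palette fy1.
have ca2 : c != a2 by apply: contraNneq cC => ->; apply: mem_palette fy2.
have ra1 : r != a1 by apply: contraNneq rC => ->; apply: mem_palette fy1.
have ra2 : r != a2 by apply: contraNneq rC => ->; apply: mem_palette fy2.
have rc : c != r by apply: contraNneq rC1 => <-.
apply: (@colourable_assign _ _ _ _ _ _ e_sym e_irr exy cf fe [:: (x, c); (y1, r)]) => //=.
- by rewrite mem_head.
- by move=> v; rewrite !inE => /orP[]/eqP->; rewrite ?(star_edge fy1) // e_sym.
- by rewrite inE eq_sym y1x.
- by rewrite inE rc.
- move=> p; rewrite !in_cons orbF => /orP[]/eqP-> /=; last by rewrite -/g G1.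
  by rewrite -/g palette_x_clear Fx in_set2 negb_or ca1.
- move=> p; rewrite !in_cons orbF => /orP[]/eqP-> v /= /mem_palette.
    by rewrite (negPf cC).
  by rewrite (negPf rC).
- move=> p pal v d; rewrite !inE negb_or -/g => /andP[vx vy1] fv.
  have dC : d \notin C by rewrite in_setC negbK (mem_palette fv).
  have dC1 : d \notin C1 by apply: contra dC; apply: (subsetP C1C).
  have da1 : d != a1 by apply: contraNneq vy1 => da; rewrite da in fv; apply/eqP/(col_proper cf fv fy1).
  move: pal; rewrite !in_cons orbF => /orP[]/eqP-> /=; last first.
    by apply: conn_iso; rewrite ?G1 // eq_sym.
  have [da2|da2] := eqVneq d a2.
    rewrite da2 in fv *; rewrite (col_proper cf fv fy2) conn_swap.
    by apply: contra cC2 => xy2; rewrite in_set xy2 in_setC cC.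
  by apply: conn_iso; rewrite ?palette_x_clear ?Fx ?in_set2 ?negb_or ?ca1 ?da1 // eq_sym.
rewrite !andbT -/g; apply: conn_iso; rewrite ?palette_x_clear ?Fx ?in_set2 ?negb_or ?ca1 ?ra1 //.
by rewrite eq_sym.
Qed.

(** The situation that remains when one colour at [x] occurs at [y]: [a1], [a2]
    and the two colours of [B] are the colours that the neighbours of [y] other
    than [y1] leave free at [y], and all four two-coloured paths that start at
    [x] with [a1] or [a2] and go on with a colour of [B] end at [y1]. It is
    symmetric in [a1] and [a2], as [g] does not depend on the colour of [y y1]. *)
Section Locked.
Variables (a1 a2 : K) (x1 x2 y1 : T) (B : {set K}).
Hypotheses (a12 : a1 != a2) (fx1 : f (x, x1) = Some a1) (fx2 : f (x, x2) = Some a2).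
Hypotheses (Fx : palette f x = [set a1; a2]) (yy1 : e y y1) (y1x : y1 != x).
Hypotheses (G1 : palette g y1 = B) (cardB : #|B| = 2) (a1B : a1 \notin B) (a2B : a2 \notin B).
Hypothesis star_out : forall v d, v != y1 -> f (y, v) = Some d -> d \notin a1 |: (a2 |: B).
Hypothesis star_in : forall d, d \notin a1 |: (a2 |: B) -> exists2 v, f (y, v) = Some d & v != y1.
Hypothesis lock1 : forall c, c \in B -> conn g a1 c x y1.
Hypothesis lock2 : forall c, c \in B -> conn g a2 c x y1.

Let x1x : x1 != x := col_neq cf fx1.
Let x2x : x2 != x := col_neq cf fx2.

Lemma nbr_neq_y z a : f (x, z) = Some a -> z != y.
Proof. by move=> fxz; apply: contra_eqN fxy => /eqP<-; rewrite fxz. Qed.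

Lemma clear_nbr z a : f (x, z) = Some a -> g (x, z) = Some a.
Proof. by move=> fxz; rewrite ffunE /= (negPf xy) (negPf (nbr_neq_y fxz)). Qed.

Lemma nbr_neq_y1 z a : f (x, z) = Some a -> a \notin B -> z != y1.
Proof.
move=> fxz; apply: contraNneq => zy1; rewrite -G1 -zy1.
exact: (mem_palette2 cg (clear_nbr fxz)).
Qed.

Let x1y1 := nbr_neq_y1 fx1 a1B.
Let x2y1 := nbr_neq_y1 fx2 a2B.

Lemma pick_B : exists c, c \in B.
Proof. by apply/set0Pn; rewrite -card_gt0 cardB. Qed.

Lemma notin_T d : d \notin a1 |: (a2 |: B) -> [/\ d != a1, d != a2 & d \notin B].
Proof. by rewrite !in_setU1 !negb_or => /and3P[]. Qed.

Lemma neq_B c : c \in B -> (c != a1) && (c != a2).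
Proof. by move=> cB; apply/andP; split; apply: contraTneq cB => ->. Qed.

(** The path from [y1] still ends at [x1], but [a1] now leads from [x] to [x2]. *)
Lemma swap_at_x : a2 \notin palette f x1 -> a1 \notin palette f x2 -> colourable K e.
Proof.
move=> a2x1 a1x2; have [c cB] := pick_B; have /andP[ca1 ca2] := neq_B cB.
have x12 : x1 != x2 by apply: contra_neq a12 => x12; move: fx1; rewrite x12 fx2 => -[].
pose f' := recolour f x [:: (x1, a2); (x2, a1)].
have cf' : colouring f'.
  apply: recolourP => //=; rewrite ?inE ?negb_or ?(eq_sym x) ?x1x ?x2x ?x12 ?(eq_sym a2) ?a12 //.
  - by move=> p; rewrite !in_cons orbF => /orP[]/eqP->; [apply: contra a2x1|apply: contra a1x2];
      apply/subsetP/palette_clear_sub.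
  - move=> p; rewrite !in_cons orbF => /orP[]/eqP-> v /= fv; rewrite !inE.
      by rewrite (col_proper cf fv fx2) eqxx orbT.
    by rewrite (col_proper cf fv fx1) eqxx.
  - move=> p _ v d; rewrite !inE negb_or => /andP[vx1 vx2] fv.
    have := mem_palette fv; rewrite Fx in_set2 => /orP[]/eqP da; rewrite da in fv.
      by rewrite (col_proper cf fv fx1) eqxx in vx1.
    by rewrite (col_proper cf fv fx2) eqxx in vx2.
  rewrite !andbT; apply: conn_iso => //; last by rewrite (palette_clear_edge cf fx1) in_setD1 eqxx.
  by apply: contra a2x1; apply/subsetP/palette_clear_sub.
have fe' : supp f' =2 cut_edge e x y.
  move=> u v; rewrite -fe; apply: supp_recolour => // z; rewrite !inE.
  by case/orP=> /eqP->; [apply: edge_supp fx1|apply: edge_supp fx2].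
have cg' := colouring_clear y cf'.
have f'x v : f' (x, v) = if v == x1 then Some a2 else if v == x2 then Some a1 else f (x, v).
  by rewrite recolour_star.
have F'x : palette f' x \subset [set a1; a2].
  apply/subsetP=> d /paletteP[v]; rewrite f'x in_set2.
  case: eqP => [_ [->]|_]; first by rewrite eqxx orbT.
  case: eqP => [_ [->]|_ /mem_palette]; first by rewrite eqxx.
  by rewrite Fx in_set2.
have G'x d : d != a1 -> d != a2 -> d \notin palette (clear f' y) x.
  move=> da1 da2; apply/negP=> /(subsetP (palette_clear_sub _ _ _))/(subsetP F'x).
  by rewrite in_set2 (negPf da1) (negPf da2).
have G'1 : palette (clear f' y) y1 = B.
  by rewrite palette_clear_recolour //= !inE negb_or !(eq_sym y1) x1y1 x2y1.
have f'y v : f' (y, v) = f (y, v).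
  rewrite recolourE //= 1?eq_sym // !inE negb_or ![y == _]eq_sym.
  by rewrite (nbr_neq_y fx1) (nbr_neq_y fx2).
apply: (@colourable_assign _ _ _ _ _ _ e_sym e_irr exy cf' fe' [:: (x, c); (y1, a1)]) => //=.
- by rewrite mem_head.
- by move=> v; rewrite !inE => /orP[]/eqP->; rewrite // e_sym.
- by rewrite inE eq_sym y1x.
- by rewrite inE ca1.
- by move=> p; rewrite !in_cons orbF => /orP[]/eqP-> /=; rewrite ?G'1 // G'x.
- move=> p pal v; rewrite f'y !inE => fv; apply: contraTT pal; rewrite negb_or => /andP[_ vy1].
  have /notin_T[pa1 _ pB] := star_out vy1 fv; rewrite !in_cons orbF negb_or.
  apply/andP; split; [apply: contraNneq pB|apply: contraNneq pa1] => -> //=.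
- move=> p pal v d; rewrite !inE negb_or f'y => /andP[vx vy1] fv.
  have /notin_T[da1 da2 dB] := star_out vy1 fv.
  by move: pal; rewrite !in_cons orbF => /orP[]/eqP-> /=; apply: conn_iso; rewrite ?G'1 ?G'x // eq_sym.
rewrite !andbT conn_swap (conn_sym _ _ _ _ cg').
have g'x2 : clear f' y (x, x2) = Some a1.
  by rewrite ffunE /= (negPf xy) (negPf (nbr_neq_y fx2)) f'x eq_sym (negPf x12) eqxx.
rewrite (conn_leaf cg' g'x2 (G'x c ca1 ca2) y1x) clear_clear_recolour.
have := lock1 cB; rewrite (conn_sym _ _ _ _ cg) (conn_leaf cg (clear_nbr fx1)) //; last first.
  by rewrite palette_x_clear Fx in_set2 negb_or ca1.
have sub z d : d \notin palette g z -> d \notin palette (clear g x) z.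
  by apply: contra; apply/subsetP/palette_clear_sub.
apply: three_ends; rewrite 1?(eq_sym y1) //; first exact: colouring_clear.
- by rewrite sub // G1.
- by rewrite (palette_clear_edge cg (clear_nbr fx1)) in_setD1 eqxx.
- by rewrite sub //; apply: contra a1x2; apply/subsetP/palette_clear_sub.
Qed.

(** A colour [b] that is missing at [x1] occurs at [y], on an edge to [yb]. *)
Section Shift.
Variables (b : K) (yb : T).
Hypotheses (bx1 : b \notin palette f x1) (fyb : f (y, yb) = Some b) (yby1 : yb != y1).
Hypothesis (a2x1 : a2 \in palette f x1).

Let ybx : yb != x := star_neq_x fyb.
Let bT := notin_T (star_out yby1 fyb).
Let ba1 : b != a1. Proof. by case: bT. Qed.
Let ba2 : b != a2. Proof. by case: bT. Qed.
Let bB : b \notin B. Proof. by case: bT. Qed.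

Let ybx1 : yb != x1.
Proof. by apply: contraNneq bx1 => <-; apply: (mem_palette2 cf fyb). Qed.

(** Recolouring [x x1] with [b] blocks [yb] in the same way as [y1]; then the
    colours of [y y1] and [y yb] can be exchanged. *)
Lemma shift_acyclic : ~~ conn (clear f x) b a2 x1 x2 -> colourable K e.
Proof.
move=> no_conn; pose f' := recolour f x [:: (x1, b)].
have cf' : colouring f'.
  apply: recolourP => //=; rewrite ?inE ?(eq_sym x) //.
  - by move=> p; rewrite !in_cons orbF => /eqP->; apply: contra bx1; apply/subsetP/palette_clear_sub.
  - move=> p; rewrite !in_cons orbF => /eqP-> v /= /mem_palette.
    by rewrite Fx in_set2 (negPf ba1) (negPf ba2).
  - move=> p; rewrite !in_cons orbF => /eqP-> v d; rewrite !inE => /= vx1 fv.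
    have := mem_palette fv; rewrite Fx in_set2 => /orP[]/eqP da; rewrite da in fv.
      by rewrite (col_proper cf fv fx1) eqxx in vx1.
    by rewrite da (col_proper cf fv fx2).
have fe' : supp f' =2 cut_edge e x y.
  by move=> u v; rewrite -fe; apply: supp_recolour => // z; rewrite !inE => /eqP->; apply: edge_supp fx1.
have cg' := colouring_clear y cf'.
have F'x d : d != b -> d != a2 -> d \notin palette (clear f' y) x.
  move=> db da2; apply/negP=> /(subsetP (palette_clear_sub _ _ _))/paletteP[v].
  rewrite recolour_star /assign /=; case: eqP => [_ [bd]|vx1 fv]; first by rewrite bd eqxx in db.
  have := mem_palette fv; rewrite Fx in_set2 (negPf da2) orbF => /eqP da1; rewrite da1 in fv.
  by case: vx1; apply: (col_proper cf fv fx1).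
have G' u : u != x -> u != x1 -> palette (clear f' y) u = palette g u.
  by move=> ux ux1; rewrite palette_clear_recolour //= inE.
have G'1 : palette (clear f' y) y1 = B by rewrite G' // eq_sym.
have f'y v : f' (y, v) = f (y, v).
  by rewrite recolourE //= 1?eq_sym // !inE eq_sym (nbr_neq_y fx1).
have [[c /andP[cB nc]]|all_conn] : (exists c, (c \in B) && ~~ conn (clear f' y) b c x yb) \/
    forall c, c \in B -> conn (clear f' y) b c x yb.
- have [/existsP|/existsPn n] := boolP [exists c, (c \in B) && ~~ conn (clear f' y) b c x yb].
    by left.
  by right=> c cB; have := n c; rewrite cB negbK.
- have /andP[ca1 ca2] := neq_B cB; have cb : c != b by apply: contraNneq bB => <-.
  apply: (@colourable_assign _ _ _ _ _ _ e_sym e_irr exy cf' fe' [:: (x, c); (y1, a1)]) => //=.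
  + by rewrite mem_head.
  + by move=> v; rewrite !inE => /orP[]/eqP->; rewrite // e_sym.
  + by rewrite inE eq_sym y1x.
  + by rewrite inE ca1.
  + by move=> p; rewrite !in_cons orbF => /orP[]/eqP-> /=; rewrite ?G'1 // F'x.
  + move=> p pal v; rewrite f'y !inE => fv; apply: contraTT pal; rewrite negb_or => /andP[_ vy1].
    have /notin_T[pa1 _ pB] := star_out vy1 fv; rewrite !in_cons orbF negb_or.
    by apply/andP; split; [apply: contraNneq pB|apply: contraNneq pa1] => -> //=.
  + move=> p pal v d; rewrite !inE negb_or f'y => /andP[vx vy1] fv.
    have /notin_T[da1 da2 dB] := star_out vy1 fv.
    move: pal; rewrite !in_cons orbF => /orP[]/eqP-> /=; last first.
      by apply: conn_iso; rewrite ?G'1 // eq_sym.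
    have [db|db] := eqVneq d b.
      by rewrite db in fv *; rewrite (col_proper cf fv fyb) conn_swap.
    by apply: conn_iso; rewrite ?F'x // eq_sym.
  by rewrite !andbT; apply: conn_iso; rewrite ?F'x // eq_sym // eq_sym.
have Gb : palette g yb = B.
  apply/esym/eqP; rewrite eqEcard cardB (card_palette_small fyb) andbT.
  apply/subsetP=> c /all_conn bc; rewrite conn_sym // in bc; rewrite -G' //.
  by apply: (conn_in bc) => //; rewrite G' //; apply: star_free fyb.
have [c cB] := pick_B; have /andP[ca1 ca2] := neq_B cB.
have cb : c != b by apply: contraNneq bB => <-.
apply: (@colourable_assign _ _ _ _ _ _ e_sym e_irr exy cf fe [:: (x, c); (y1, b); (yb, a1)]) => //=.
- by rewrite mem_head.
- by move=> v; rewrite !inE => /or3P[]/eqP->; rewrite ?(star_edge fyb) // e_sym.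
- by rewrite !inE negb_or !(eq_sym x) y1x ybx eq_sym yby1.
- by rewrite !inE negb_or cb ca1 ba1.
- by move=> p; rewrite !in_cons orbF => /or3P[]/eqP-> /=; rewrite -/g ?palette_x_clear ?Fx ?G1 ?Gb
    ?in_set2 ?negb_or ?ca1 ?ca2.
- move=> p pal v fv; apply: contraTT pal; rewrite !inE !negb_or => /and3P[_ vy1 vyb].
  have /notin_T[pa1 _ pB] := star_out vy1 fv.
  apply/and3P; split; [apply: contraNneq pB|apply: contraNneq vyb|apply: contraNneq pa1] => pE; rewrite pE //= in fv *.
  by apply/eqP/(col_proper cf fv fyb).
- move=> p pal v d; rewrite !inE !negb_or => /and3P[vx vy1 vyb] fv.
  have /notin_T[da1 da2 dB] := star_out vy1 fv.
  by move: pal; rewrite !in_cons orbF => /or3P[]/eqP-> /=; apply: conn_iso;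
    rewrite -/g ?palette_x_clear ?Fx ?G1 ?Gb ?in_set2 ?negb_or ?ca1 ?ca2 ?da1 // eq_sym.
rewrite !andbT -andbA -/g; apply/and3P; split.
- by apply: conn_iso; rewrite ?palette_x_clear ?Fx ?in_set2 ?negb_or ?ca1 ?ba1 // eq_sym.
- rewrite conn_swap; apply: three_ends (lock1 cB); rewrite ?G1 ?Gb ?a1B //.
  + by rewrite palette_x_clear Fx !in_set2 !negb_or ca1 ca2 orbT.
  + by rewrite eq_sym.
  + by rewrite eq_sym.
  + by rewrite eq_sym.
- by apply: conn_iso; rewrite ?G1 // eq_sym.
Qed.

Section Free.
Hypothesis a2y : a2 \notin palette f y.
Hypothesis x12_conn : conn (clear f x) b a2 x1 x2.

Let b_x : b \notin palette g x.
Proof. by rewrite palette_x_clear Fx in_set2 negb_or ba1. Qed.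

Let b_x1 : b \notin palette g x1.
Proof. by apply: contra bx1; apply/subsetP/palette_clear_sub. Qed.

Lemma b_path a : (a == a1) || (a == a2) -> conn g b a x1 x.
Proof.
case/orP=> /eqP->.
  by rewrite conn_swap conn_sym //; apply: conn_edge (clear_nbr fx1).
rewrite -(conn_skip cf) ?a2y ?orbT //; last exact: nbr_neq_y fx1.
apply: conn_trans (conn_clear x12_conn) _; rewrite conn_swap.
by apply: conn_edge; rewrite (col_sym cf) fx2.
Qed.

(** Since [b] is missing at [x] and [x1], the path from [x] in [b] and a colour
    of [x] ends at [x1]. Hence [x y] can take [b] once [y] has given it up. *)
Lemma b_safe v d : v != x -> d \notin palette g v -> ~~ conn g b d x v.
Proof.
move=> vx dv; have [da|] := boolP ((d == a1) || (d == a2)); last first.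
  by move=> da; apply: conn_iso; rewrite 1?eq_sym // palette_x_clear Fx in_set2.
have x1x_conn := b_path da; have vx1 : v != x1.
  by apply: contraNneq dv => ->; apply: (conn_in x1x_conn).
rewrite conn_sym // in x1x_conn; apply: (three_ends _ _ _ _ _ _ _ x1x_conn) => //.
- by rewrite b_x.
- by rewrite b_x1.
- by rewrite dv orbT.
- by rewrite eq_sym.
- by rewrite eq_sym.
- by rewrite eq_sym.
Qed.

(** The path from [y1] in [a] and a colour of [B] ends at [x]. *)
Lemma y1_safe a v d : (a == a1) || (a == a2) -> v != y1 -> v != x ->
  d \notin palette g v -> ~~ conn g a d y1 v.
Proof.
move=> aa vy1 vx dv; have aB : a \notin B by case/orP: aa => /eqP->.
have [dB|dB] := boolP (d \in B); last by apply: conn_iso; rewrite ?G1 // eq_sym.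
have xy1 : conn g a d x y1 by case/orP: aa => /eqP->; [apply: lock1|apply: lock2].
have /andP[da1 da2] := neq_B dB.
rewrite conn_sym // in xy1; apply: (three_ends _ _ _ _ _ _ _ xy1) => //.
- by rewrite G1 aB.
- by rewrite palette_x_clear Fx !in_set2 !negb_or da1 da2 orbT.
- by rewrite dv orbT.
- by rewrite eq_sym.
- by rewrite eq_sym.
Qed.

(** Whatever changes at [y] give up [b]: [x y] takes it, and [y y1] takes one of
    the colours at [x]. *)
Lemma free_colour a al0 (al := (x, b) :: (y1, a) :: al0) :
  (a == a1) || (a == a2) -> yb \in unzip1 al0 ->
  uniq (unzip1 al) -> uniq (unzip2 al) -> {in unzip1 al0, forall v, e y v} ->
  {in al0, forall p, p.2 \notin palette g p.1} ->
  {in al0, forall p v, f (y, v) = Some p.2 -> v \in unzip1 al} ->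
  {in al0, forall p v d, v \notin unzip1 al -> f (y, v) = Some d ->
     ~~ conn g p.2 d p.1 v} ->
  pairwise (fun p q => ~~ conn g p.2 q.2 p.1 q.1) al0 -> colourable K e.
Proof.
move=> aa yb_al al1 al2 al_e al_free al_inj al_out al_pair.
have aB : a \notin B by case/orP: aa => /eqP->.
have al0_neq p : p \in al0 -> (p.1 != x) && (p.1 != y1).
  move=> pal; move: al1; rewrite /al /= !inE !negb_or => /and3P[/andP[_ xal] yal _].
  by rewrite (contraNneq _ xal) => [|<-]; rewrite ?(contraNneq _ yal) ?map_f // => <-; rewrite map_f.
apply: (@colourable_assign _ _ _ _ _ _ e_sym e_irr exy cf fe al) => //.
- exact: mem_head.
- move=> v; rewrite !in_cons => /or3P[/eqP->|/eqP->|/al_e //]; rewrite // e_sym //.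
- move=> p; rewrite !in_cons => /or3P[/eqP->|/eqP->|/al_free //] //=; last by rewrite -/g G1.
- move=> p; rewrite !in_cons => /or3P[/eqP->|/eqP->|/al_inj pal] v; last exact: pal.
    by move=> fv; rewrite (col_proper cf fv fyb) !inE yb_al !orbT.
  move=> fv; rewrite !inE; have [//|vy1] := eqVneq v y1; first by rewrite orbT.
  have /notin_T[/eqP aa1 /eqP aa2] := star_out vy1 fv.
  by case/orP: aa => /eqP.
- move=> p; rewrite !in_cons => /or3P[/eqP->|/eqP->|/al_out pal] v d; last exact: pal.
    rewrite !inE !negb_or => /and3P[vx _ _] fv; apply: b_safe => //; exact: star_free fv.
  rewrite !inE !negb_or => /and3P[vx vy1 _] fv; apply: y1_safe => //; exact: star_free fv.
rewrite /= -/g al_pair andbT b_safe ?G1 //=; apply/andP; split; apply/allP=> p pal /=.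
  by have /andP[px _] := al0_neq _ pal; apply: b_safe => //; apply: al_free.
by have /andP[px py] := al0_neq _ pal; apply: y1_safe => //; apply: al_free.
Qed.

(** [yb] takes a colour among [a1], [a2] and [B], which form [T0], unless each of
    them is blocked through one of the two other colours [p], [q] at [yb]. The neighbours [yp], [yq] then share
    out [T0], so that [yp] can take a colour from the part of [yq], which frees
    [p] and lifts half of the blockade. *)
Lemma shift_blocked : colourable K e.
Proof.
pose T0 := a1 |: (a2 |: B); pose Q := palette g yb.
have T0_card : #|T0| = 4 by rewrite !cardsU1 cardB a2B !inE negb_or a12 a1B.
have Q_le : #|Q| <= 2 by apply: card_palette_small fyb.
have bT0 : b \notin T0 by rewrite !in_setU1 !negb_or ba1 ba2.
have yby : e y yb := star_edge fyb.
have T0_y1 t v : t \in T0 -> f (y, v) = Some t -> v = y1.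
  move=> tT fv; apply/eqP; apply: contraT => vy1.
  by have := star_out vy1 fv; rewrite -/T0 tT.
pose ok t := [&& t \in T0, t \notin Q &
  [forall v, (v \notin [:: x; y1; yb]) ==> [forall d, (f (y, v) == Some d) ==>
    ~~ conn g t d yb v]]].
have [[t /and3P[tT tQ t_ok]]|bad] : (exists t, ok t) \/
    forall t, t \in T0 -> t \notin Q -> exists v d, [/\ v \notin [:: x; y1; yb],
      f (y, v) = Some d, d \in Q & t \in palette g v].
- have [/existsP|/existsPn none] := boolP [exists t, ok t]; first by left.
  right=> t tT tQ; have := none t; rewrite /ok tT tQ /= => /forallPn[v].
  rewrite negb_imply => /andP[vn /forallPn[d]]; rewrite negb_imply negbK.
  move=> /andP[/eqP fv tv]; exists v, d; split=> //.
    by apply: (conn_in tv) => //; move: vn; rewrite !inE !negb_or eq_sym [v == yb]eq_sym => /and3P[].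
  rewrite conn_swap in tv; apply: (conn_in_r cg tv); last exact: star_free fv.
  by move: vn; rewrite !inE !negb_or eq_sym [v == yb]eq_sym => /and3P[].
- pose a := if t == a1 then a2 else a1.
  have aa : (a == a1) || (a == a2) by rewrite /a; case: ifP; rewrite eqxx ?orbT.
  have ta : a != t by rewrite /a; case: (eqVneq t a1) => [->|ta]; rewrite eq_sym.
  have ba : b != a by rewrite /a; case: ifP.
  have bt : b != t by apply: contraNneq bT0 => ->.
  apply: (@free_colour a [:: (yb, t)]) => //=; rewrite ?mem_head ?inE //.
  + by rewrite negb_or !(eq_sym x) y1x ybx eq_sym yby1.
  + by rewrite negb_or ba bt ta.
  + by move=> v; rewrite inE => /eqP->.
  + by move=> p; rewrite !in_cons orbF => /eqP->.
  + move=> p; rewrite !in_cons orbF => /eqP-> v fv.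
    by rewrite (T0_y1 _ _ tT fv) !inE eqxx !orbT.
  + move=> p; rewrite !in_cons orbF => /eqP-> v d vn fv.
    by have /forallP/(_ v) := t_ok; rewrite vn => /forallP/(_ d); rewrite fv eqxx.
have /subsetPn[t0 t0T t0Q] : ~~ (T0 \subset Q).
  by apply/negP=> /subset_leq_card; rewrite T0_card => /leq_trans/(_ Q_le).
have [yp [p [ypn fyp pQ t0p]]] := bad _ t0T t0Q.
move: (ypn); rewrite !inE !negb_or => /and3P[ypx ypy1 ypyb].
have pT : p \notin T0 := star_out ypy1 fyp.
have Gp_le := card_palette_small fyp.
have /subsetPn[t' + t'p] : ~~ (T0 :\: Q \subset palette g yp).
  apply/negP=> /subset_leq_card H; have := cardsID Q T0; rewrite T0_card.
  have : #|T0 :&: Q| < #|Q|.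
    apply: proper_card; rewrite properE subsetIr /=; apply/subsetPn; exists p => //.
    by rewrite in_setI (negPf pT).
  move: H Q_le Gp_le; clear; lia.
rewrite in_setD => /andP[t'Q t'T].
have [yq [q [yqn fyq qQ t'q]]] := bad _ t'T t'Q.
move: (yqn); rewrite !inE !negb_or => /and3P[yqx yqy1 yqyb].
have qT : q \notin T0 := star_out yqy1 fyq.
have Gq_le := card_palette_small fyq.
have pq : p != q.
  apply: contraNneq t'p => pq; rewrite -pq in fyq.
  by rewrite (col_proper cf fyp fyq).
have QE : Q = [set p; q].
  by apply/esym/eqP; rewrite eqEcard subUset !sub1set pQ qQ cards2 pq.
have T0Q t : t \in T0 -> t \notin Q.
  by move=> tT; rewrite QE in_set2 negb_or; apply/andP; split; apply: contraTneq tT => ->.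
have T0_cover : T0 \subset palette g yp :|: palette g yq.
  apply/subsetP=> t tT; have [v [d [_ fv dQ tv]]] := bad _ tT (T0Q _ tT).
  rewrite in_setU; move: dQ; rewrite QE in_set2 => /orP[]/eqP dE; rewrite dE in fv.
    by rewrite (col_proper cf fyp fv) tv.
  by rewrite (col_proper cf fyq fv) tv orbT.
have := cardsUI (palette g yp) (palette g yq); have := subset_leq_card T0_cover.
rewrite T0_card => T0_le cUI.
have disj t : t \in palette g yp -> t \in palette g yq -> False.
  move=> tp tq; have : 0 < #|palette g yp :&: palette g yq|.
    by rewrite card_gt0; apply/set0Pn; exists t; rewrite in_setI tp.
  move: T0_le cUI Gp_le Gq_le; clear; lia.
have in_T0 : palette g yp :|: palette g yq = T0.
  by apply/esym/eqP; rewrite eqEcard T0_cover T0_card; move: cUI Gp_le Gq_le; clear; lia.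
have pick (A : {set K}) : 2 <= #|A| -> exists2 t, t \in A & t != a1.
  move=> A2; have /set0Pn[t] : A :\ a1 != set0.
    by rewrite -card_gt0; have := cardsD1 a1 A; move: A2; clear; case: (_ \in _) => /=; lia.
  by rewrite in_setD1 => /andP[ta1 tA]; exists t.
have [|t1 t1p t1a] := pick (palette g yp); first by move: T0_le cUI Gq_le; clear; lia.
have [|t3 t3q t3a] := pick (palette g yq); first by move: T0_le cUI Gp_le; clear; lia.
have t1q : t1 \notin palette g yq by apply/negP; apply: disj.
have t3p : t3 \notin palette g yp by apply/negP=> t3p; apply: (disj _ t3p t3q).
have t1T : t1 \in T0 by rewrite -in_T0 in_setU t1p.
have t3T : t3 \in T0 by rewrite -in_T0 in_setU t3q orbT.
have t13 : t1 != t3 by apply: contraNneq t1q => ->.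
(* The colour [a1] is left for [y y1]. *)
apply: (@free_colour a1 [:: (yb, t1); (yp, t3)]) => //=; rewrite ?eqxx ?mem_head //.
- by rewrite !inE !negb_or !(eq_sym x) y1x ybx ypx !(eq_sym y1) yby1 ypy1 eq_sym ypyb.
- rewrite !inE !negb_or ba1 ![a1 == _]eq_sym t1a t3a t13 /= andbT.
  by apply/andP; split; apply: contraNneq bT0 => ->.
- by move=> v; rewrite !inE => /orP[]/eqP->; rewrite // (star_edge fyp).
- by move=> r; rewrite !in_cons orbF => /orP[]/eqP-> /=; rewrite ?T0Q.
- by move=> r; rewrite !in_cons orbF => /orP[]/eqP-> v /T0_y1-> //; rewrite !inE eqxx !orbT.
- move=> r rin v d; rewrite !inE !negb_or => /and4P[vx vy1 vyb vyp] fv.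
  have dT : d \notin T0 := star_out vy1 fv.
  have dp : d != p by apply: contraNneq vyp => dp; rewrite dp in fv; apply/eqP/(col_proper cf fv fyp).
  move: rin; rewrite !in_cons orbF => /orP[]/eqP-> /=; last first.
    by apply: conn_iso; rewrite 1?eq_sym //; apply: contra dT; rewrite -in_T0 in_setU => ->.
  have [dq|dq] := eqVneq d q.
    rewrite dq in fv *; rewrite (col_proper cf fv fyq) conn_sym //.
    by apply: conn_iso => //; apply: star_free fyq.
  by apply: conn_iso; rewrite 1?eq_sym ?(T0Q _ t1T) // -/Q QE in_set2 negb_or dp.
by rewrite !andbT; apply: conn_iso; rewrite ?T0Q // eq_sym.
Qed.

End Free.

End Shift.

(** A colour missing at [x1], other than [a2], has to occur at [y]. *)
Lemma shift_at_x : a2 \notin palette f y -> a2 \in palette f x1 -> colourable K e.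
Proof.
move=> a2y a2x1; have [|b /andP[bx1 _]] := @ex_missing _ _ set0 f x1.
  by rewrite cards0 addn0 K_card ltnS (leq_trans (palette_le cf fe x1)).
have [//|yb fyb yby1] := @star_in b.
  rewrite !in_setU1 !negb_or; apply/and3P; split; apply: contraNneq bx1 || apply: contra bx1.
  - by move->; apply: (mem_palette2 cf fx1).
  - by move->.
  move=> bB; have /andP[ba1 ba2] := neq_B bB.
  have := lock1 bB; rewrite (conn_sym _ _ _ _ cg) (conn_leaf cg (clear_nbr fx1)) //; last first.
    by rewrite palette_x_clear Fx in_set2 negb_or ba1.
  have sub z d : d \in palette (clear g x) z -> d \in palette f z.
    by move/(subsetP (palette_clear_sub _ _ _))/(subsetP (palette_clear_sub _ _ _)).
  rewrite (conn_sym _ _ _ _ (colouring_clear x cg)) => /conn_in b_in; apply/sub/b_in => //.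
  by rewrite (palette_clear_edge cg (clear_nbr fx1)) in_setD1 eqxx.
have [|] := boolP (conn (clear f x) b a2 x1 x2); last exact: (shift_acyclic bx1 fyb).
exact: (shift_blocked bx1 fyb).
Qed.

End Locked.

End Fixed.

(** The colours missing at [y], except [a2], are blocked by paths that arrive at
    the neighbour [y1] of colour [a1]. They fill up the palette of [y1] and are
    thus two colours, [B]; and as [y y1] may have the colour [a2] instead, paths
    that start with [a2] arrive at [y1] as well. *)
Lemma small_one_common (f : pcol T K) a1 a2 : colouring f -> supp f =2 cut_edge e x y -> a1 != a2 ->
  palette f x = [set a1; a2] -> a1 \in palette f y -> a2 \notin palette f y ->
  colourable K e.
Proof.
move=> cf fe a12 Fx a1y a2y; set g := clear f y; have cg := colouring_clear y cf.
have xy := neq_ends e_irr exy; have Gx : palette g x = palette f x := palette_x_clear cf fe.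
have [x1 fx1] : exists x1, f (x, x1) = Some a1 by apply/paletteP; rewrite Fx set21.
have [x2 fx2] : exists x2, f (x, x2) = Some a2 by apply/paletteP; rewrite Fx set22.
have [y1 fy1] := paletteP _ _ _ a1y; have y1x : y1 != x := star_neq_x cf fe fy1.
have yy1 : e y y1 := star_edge fe fy1.
pose B := ~: palette f y :\ a2.
have BP c : c \in B -> [/\ c \notin palette f y, c != a1 & c != a2].
  by rewrite in_setD1 in_setC => /andP[ca2 cy]; split=> //; apply: contraNneq cy => ->.
have star_out v d : v != y1 -> f (y, v) = Some d -> d \notin a1 |: (a2 |: B).
  move=> vy1 fv; have dy := mem_palette fv; rewrite !in_setU1 in_setD1 in_setC dy andbF orbF.
  rewrite negb_or; apply/andP; split; last by apply: contraNneq a2y => <-.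
  by apply: contraNneq vy1 => da1; rewrite da1 in fv; apply/eqP/(col_proper cf fv fy1).
have star_in d : d \notin a1 |: (a2 |: B) -> exists2 v, f (y, v) = Some d & v != y1.
  rewrite !in_setU1 in_setD1 in_setC !negb_or => /and3P[da1 da2]; rewrite da2 negbK.
  by case/paletteP=> v fv; exists v => //; apply: contra_neq da1 => vy1; move: fv; rewrite vy1 fy1 => -[].
have [/existsP[c /andP[/BP[cy ca1 ca2] nc]]|/existsPn lock1] :=
    boolP [exists c, (c \in B) && ~~ conn g a1 c x y1].
  apply: (colourable_edge e_sym e_irr exy cf fe _ cy); first by rewrite Fx in_set2 negb_or ca1.
  move=> a; rewrite Fx in_set2 => /orP[]/eqP->; last by rewrite (negPf a2y).
  by rewrite (conn_leaf cf fy1 cy xy).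
have {}lock1 c : c \in B -> conn g a1 c x y1 by move=> cB; have := lock1 c; rewrite cB negbK.
have G1_sub : B \subset palette g y1.
  apply/subsetP=> c /lock1 xy1; apply: (conn_in_r cg xy1); first by rewrite eq_sym.
  exact: (star_free cf fy1).
have B_ge : 2 <= #|B|.
  by have := card_missing cf fe; rewrite (cardsD1 a2) in_setC a2y.
have G1 : palette g y1 = B.
  by apply/esym/eqP; rewrite eqEcard G1_sub (leq_trans (card_palette_small cf fe fy1)).
have cardB : #|B| = 2.
  by apply/eqP; rewrite eqn_leq B_ge -G1 andbT; apply: (card_palette_small cf fe fy1).
have a1B : a1 \notin B by rewrite in_setD1 in_setC a1y andbF.
have a2B : a2 \notin B by rewrite in_setD1 eqxx.
have [/existsP[c /andP[cB nc]]|/existsPn lock2] :=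
    boolP [exists c, (c \in B) && ~~ conn g a2 c x y1].
  have [cy ca1 ca2] := BP c cB.
  apply: (@colourable_assign _ _ _ _ _ _ e_sym e_irr exy cf fe [:: (x, c); (y1, a2)]) => //=.
  - by rewrite mem_head.
  - by move=> v; rewrite !inE => /orP[]/eqP->; rewrite // e_sym.
  - by rewrite inE eq_sym y1x.
  - by rewrite inE ca2.
  - by move=> p; rewrite !in_cons orbF => /orP[]/eqP-> /=;
      rewrite -/g ?G1 // Gx Fx in_set2 negb_or ca1.
  - move=> p; rewrite !in_cons orbF => /orP[]/eqP-> v /= /mem_palette.
      by rewrite (negPf cy).
    by rewrite (negPf a2y).
  - move=> p pal v d; rewrite !inE negb_or => /andP[vx vy1] fv.
    have := star_out _ _ vy1 fv; rewrite !in_setU1 !negb_or => /and3P[da1 da2 dB].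
    move: pal; rewrite !in_cons orbF => /orP[]/eqP-> /=; apply: conn_iso; rewrite -/g ?G1 //.
    + by rewrite Gx Fx in_set2 negb_or ca1.
    + by rewrite Gx Fx in_set2 negb_or da1.
    + by rewrite eq_sym.
    by rewrite eq_sym.
  by rewrite !andbT conn_swap.
have {}lock2 c : c \in B -> conn g a2 c x y1 by move=> cB; have := lock2 c; rewrite cB negbK.
have [a2x1|a2x1] := boolP (a2 \in palette f x1).
  exact: (@shift_at_x f cf fe a1 a2 x1 x2 y1 B).
have [a1x2|a1x2] := boolP (a1 \in palette f x2); last first.
  exact: (@swap_at_x f cf fe a1 a2 x1 x2 y1 B).
(* The other half of the alternative, with the two colours at [x] exchanged; it
   needs the colouring in which [y y1] has the second of them. *)
pose f1 := recolour f y [:: (y1, a2)].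
have yy1' := col_neq cf fy1.
have cf1 : colouring f1.
  apply: recolourP => //= [|p|p|p]; rewrite ?in_cons ?in_nil ?orbF.
  - by rewrite eq_sym.
  - by move/eqP->; rewrite -/g G1.
  - by move/eqP-> => v /mem_palette; rewrite (negPf a2y).
  move/eqP-> => v d; rewrite inE => vy1 fv.
  have := star_out _ _ vy1 fv; rewrite !in_setU1 !negb_or => /and3P[da1 da2 dB].
  by apply: conn_iso; rewrite -/g ?G1 // eq_sym.
have fe1 : supp f1 =2 cut_edge e x y.
  by move=> u v; rewrite -fe; apply: supp_recolour => // z; rewrite inE => /eqP->; apply: edge_supp fy1.
have f1E u v : u != y -> u != y1 -> f1 (u, v) = f (u, v).
  by move=> uy uy1; rewrite recolourE //= inE.
have F1 u : u != y -> u != y1 -> palette f1 u = palette f u.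
  by move=> uy uy1; rewrite palette_recolour //= inE.
have f1y v : v != y1 -> f1 (y, v) = f (y, v).
  by move=> vy1; rewrite recolour_star assign_out //= inE.
have x2y1 : x2 != y1 := nbr_neq_y1 cf fe G1 fx2 a2B.
have x2y : x2 != y := nbr_neq_y fe fx2.
have xy1 : x != y1 by rewrite eq_sym.
apply: (@shift_at_x f1 cf1 fe1 a2 a1 x2 x1 y1 B) => //;
  rewrite ?clear_recolour ?(f1E x) ?(F1 x) ?(F1 x2) //.
- by rewrite eq_sym.
- by rewrite Fx setUC.
- by move=> v d vy1; rewrite f1y // setUCA; apply: star_out.
- by move=> d; rewrite setUCA => /star_in[v fv vy1]; exists v => //; rewrite f1y.
apply/paletteP=> -[v]; have [->|vy1] := eqVneq v y1.
  by rewrite recolour_star /assign /= eqxx => -[a21]; rewrite a21 eqxx in a12.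
by rewrite f1y // => fv; rewrite (col_proper cf fv fy1) eqxx in vy1.
Qed.

Lemma colourable_small : colourable K (cut_edge e x y) -> colourable K e.
Proof.
case=> f [cf fe]; have xy := neq_ends e_irr exy.
have [a1 [a2 [a12 Fx]]] : exists a1 a2, a1 != a2 /\ palette f x = [set a1; a2].
  apply/cards2P; rewrite (card_palette_supp x cf) -eqSS -deg_x /edeg.
  rewrite (cardsD1 y [set v | e x v]) inE exy add1n eqSS; apply/eqP.
  congr #|pred_of_set _|; apply/setP=> v; rewrite !inE fe /= /joins eqxx (negPf xy) /= orbF.
  by rewrite andbC.
have [a1y|a1y] := boolP (a1 \in palette f y); have [a2y|a2y] := boolP (a2 \in palette f y).
- have [y1 fy1] := paletteP _ _ _ a1y; have [y2 fy2] := paletteP _ _ _ a2y.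
  set C := ~: palette f y; set g := clear f y.
  pose C1 := [set c in C | conn g a1 c x y1]; pose C2 := [set c in C | conn g a2 c x y2].
  have [C12|/subsetPn[c cC]] := boolP (C \subset C1 :|: C2); last first.
    rewrite in_setU negb_or => /andP[].
    rewrite [c \in C1]in_set [c \in C2]in_set cC /= => n1 n2; rewrite in_setC in cC.
    apply: (colourable_edge e_sym e_irr exy cf fe _ cC).
      by rewrite Fx in_set2 negb_or; apply/andP; split; apply: contraNneq cC => ->.
    by move=> a; rewrite Fx in_set2 => /orP[]/eqP-> _;
      [rewrite (conn_leaf cf fy1 cC xy)|rewrite (conn_leaf cf fy2 cC xy)].
  have [C1_ge|C1_lt] := leqP 2 #|C1|; first exact: (small_two_common cf fe a12 Fx fy1 fy2).
  rewrite eq_sym in a12; rewrite setUC in Fx; rewrite setUC in C12.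
  apply: (small_two_common cf fe a12 Fx fy2 fy1) => //.
  have := card_missing cf fe; have := subset_leq_card C12.
  have := leq_card_setU C2 C1; rewrite -/C -/g -/C1 -/C2 => -[]; lia.
- exact: (small_one_common cf fe a12 Fx).
- by rewrite eq_sym in a12; rewrite setUC in Fx; apply: (small_one_common cf fe a12 Fx).
have [|c /andP[cy cx]] := @ex_missing _ _ (palette f x) f y.
  have := palette_lt_y e_sym exy cf fe; have := deg_le y; rewrite Fx cards2 a12 K_card.
  by move: deg_y; lia.
apply: (colourable_edge e_sym e_irr exy cf fe cx cy) => a.
by rewrite Fx in_set2 => /orP[]/eqP->; rewrite ?(negPf a1y) ?(negPf a2y).
Qed.

End SmallNeighbours.

(** * Adjacent vertices of degree three *)

(** Simplifies with the inequalities in the context, in both directions. *)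
Ltac decide_eq := repeat match goal with
  | H : is_true (?a != ?b) |- context [?a == ?b] => rewrite (negbTE H)
  | H : is_true (?a != ?b) |- context [?b == ?a] => rewrite (eq_sym b a) (negbTE H)
  | |- context [?a == ?a] => rewrite eqxx
  end; rewrite ?orbT ?orbF //=.

Section Twins.
Variables (T K : finType) (e : rel T).
Hypotheses (e_sym : symmetric e) (e_irr : irreflexive e).
Implicit Types (f g : pcol T K) (x y : T) (a b c : K).

Lemma clear_id g x : colouring g -> palette g x = set0 -> clear g x = g.
Proof.
move=> cg gx; have xN v : g (x, v) = None.
  by case E: (g (x, v)) => [a|//]; have := mem_palette E; rewrite gx in_set0.
apply/ffunP=> -[u v]; rewrite ffunE /=.
by have [->|_] := eqVneq u x; [rewrite xN|have [->|//] := eqVneq v x; rewrite (col_sym cg) xN].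
Qed.

(** [g] colours all edges but those at the adjacent vertices [x], [y], whose
    further neighbours are [x1], [x2] and [y1], [y2]. *)
Record twins g x y x1 x2 y1 y2 : Prop := Twins {
  tw_col : colouring g;
  tw_supp : forall u v, supp g u v = [&& e u v, u != x, u != y, v != x & v != y];
  tw_x : forall v, e x v = [|| v == y, v == x1 | v == x2];
  tw_y : forall v, e y v = [|| v == x, v == y1 | v == y2];
  tw_nx : x1 != x2; tw_ny : y1 != y2;
  tw_x1 : x1 != y; tw_x2 : x2 != y; tw_y1 : y1 != x; tw_y2 : y2 != x }.

Section Extend.
Variables (g : pcol T K) (x y x1 x2 y1 y2 : T).
Hypothesis tw : twins g x y x1 x2 y1 y2.

Lemma tw_sides : twins g y x y1 y2 x1 x2.
Proof.
case: tw => cg sg ex ey x12 y12 x1y x2y y1x y2x; split=> // u v.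
by rewrite sg [(u != x) && _]andbCA [(v != x) && _]andbC.
Qed.

Lemma tw_swap : twins g x y x2 x1 y1 y2.
Proof.
case: tw => cg sg ex ey x12 y12 x1y x2y y1x y2x; split=> // [v|]; last by rewrite eq_sym.
by rewrite ex [(v == x1) || _]orbC.
Qed.

Lemma tw_swapy : twins g x y x1 x2 y2 y1.
Proof.
case: tw => cg sg ex ey x12 y12 x1y x2y y1x y2x; split=> // [v|]; last by rewrite eq_sym.
by rewrite ey [(v == y1) || _]orbC.
Qed.

Let cg := tw_col tw.
Let exy : e x y. Proof. by rewrite (tw_x tw) eqxx. Qed.

Lemma tw_xy : x != y.
Proof. exact: neq_ends e_irr exy. Qed.

Lemma tw_x1x : x1 != x.
Proof. by apply/eqP=> x1x; have := tw_x tw x1; rewrite x1x e_irr eqxx orbT. Qed.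

Lemma tw_x2x : x2 != x.
Proof. by apply/eqP=> x2x; have := tw_x tw x2; rewrite x2x e_irr eqxx !orbT. Qed.

Lemma tw_y1y : y1 != y.
Proof. by apply/eqP=> x1x; have := tw_y tw y1; rewrite x1x e_irr eqxx orbT. Qed.

Lemma tw_y2y : y2 != y.
Proof. by apply/eqP=> x1x; have := tw_y tw y2; rewrite x1x e_irr eqxx !orbT. Qed.

Lemma tw_gx : palette g x = set0.
Proof.
apply/setP=> a; rewrite in_set0; apply/paletteP=> -[v /edge_supp].
by rewrite (tw_supp tw) eqxx andbF.
Qed.

Lemma supp_recolour_or f z al u v : colouring f ->
  supp (recolour f z al) u v = if u == z then (v \in unzip1 al) || supp f z v
    else if v == z then (u \in unzip1 al) || supp f z u else supp f u v.
Proof.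
move=> cf; have star w : (assign f z al w != None) = (w \in unzip1 al) || supp f z w.
  have [wal|wn] := boolP (w \in unzip1 al); first by rewrite assign_some.
  by rewrite assign_out.
by rewrite supp_restar !star.
Qed.

(** The edges at [x] and [y] get colours missing at their other ends. A
    two-coloured cycle passes through [x] only, through [y] only, through both
    but not along [x y], or along [x y]; each kind has its own hypothesis. *)
Lemma twins_extend p1 p2 q1 q2 r :
  p1 \notin palette g x1 -> p2 \notin palette g x2 ->
  q1 \notin palette g y1 -> q2 \notin palette g y2 ->
  p1 != p2 -> q1 != q2 -> [&& r != p1, r != p2, r != q1 & r != q2] ->
  [&& (x1 == y1) ==> (p1 != q1), (x1 == y2) ==> (p1 != q2),
      (x2 == y1) ==> (p2 != q1) & (x2 == y2) ==> (p2 != q2)] ->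
  ~~ conn g p1 p2 x1 x2 -> ~~ conn g q1 q2 y1 y2 ->
  ((p1 == q1) && (p2 == q2) || (p1 == q2) && (p2 == q1) ->
     ~~ (conn g p1 p2 x1 y1 && conn g p1 p2 x2 y2) &&
     ~~ (conn g p1 p2 x1 y2 && conn g p1 p2 x2 y1)) ->
  ((p1 == q1) ==> ~~ conn g p1 r x1 y1) -> ((p1 == q2) ==> ~~ conn g p1 r x1 y2) ->
  ((p2 == q1) ==> ~~ conn g p2 r x2 y1) -> ((p2 == q2) ==> ~~ conn g p2 r x2 y2) ->
  colourable K e.
Proof.
move=> p1x p2x q1y q2y p12 q12 /and4P[rp1 rp2 rq1 rq2] /and4P[v11 v12 v21 v22].
move=> x_acy y_acy long r11 r12 r21 r22.
have [xy x1x x2x y1y y2y] := And5 tw_xy tw_x1x tw_x2x tw_y1y tw_y2y.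
have [x12 y12 x1y x2y] := And4 (tw_nx tw) (tw_ny tw) (tw_x1 tw) (tw_x2 tw).
have [y1x y2x] := conj (tw_y1 tw) (tw_y2 tw).
pose f1 := recolour g x [:: (x1, p1); (x2, p2)].
have gx v : supp g x v = false by rewrite (tw_supp tw) eqxx andbF.
have gy v : supp g y v = false by rewrite (tw_supp tw) eqxx !andbF.
have gN z v : supp g z v = false -> g (z, v) = None by rewrite /supp; case: (g _).
have cf1 : colouring f1.
  apply: recolourP => //=; rewrite ?inE; decide_eq.
  - by move=> p; rewrite clear_id ?tw_gx // !in_cons orbF => /orP[]/eqP->.
  - by move=> p _ v; rewrite gN.
  - by move=> p _ v b _; rewrite gN.
  by rewrite clear_id ?tw_gx // x_acy.
have f1x : clear f1 x = g by rewrite clear_recolour clear_id ?tw_gx.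
have f1x1 : f1 (x, x1) = Some p1 by rewrite recolour_star /assign /= eqxx.
have f1x2 : f1 (x, x2) = Some p2 by rewrite recolour_star /assign /=; decide_eq.
have F1x : palette f1 x \subset [set p1; p2].
  apply/subsetP=> d /paletteP[v]; rewrite recolour_star /assign /= in_set2 gN //.
  by case: eqP => [_ [->]|_]; [rewrite eqxx|case: eqP => // _ [->]; rewrite eqxx orbT].
have F1 u d : u != x -> d \in palette f1 u ->
    [|| d \in palette g u, (u == x1) && (d == p1) | (u == x2) && (d == p2)].
  move=> ux /paletteP[v]; rewrite ffunE /= (negbTE ux) /assign /= gN //.
  case: eqP => [_|_ /mem_palette->//].
  case: eqP => [_ [->]|_]; first by rewrite eqxx orbT.
  by case: eqP => // _ [->]; rewrite eqxx !orbT.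
have f1y v : supp f1 y v = false.
  by rewrite supp_recolour_or // !(gy, gx) !inE !orbF; decide_eq; case: ifP.
have F1y : palette f1 y = set0.
  by apply/setP=> d; rewrite in_set0; apply/paletteP=> -[v /edge_supp]; rewrite f1y.
pose f2 := recolour f1 y [:: (y1, q1); (y2, q2); (x, r)].
exists f2; split; last first.
  move=> u v; rewrite supp_recolour_or // !f1y !inE !orbF.
  have [->|uy] := eqVneq u y; first by rewrite (tw_y tw) orbA orbC.
  have [->|vy] := eqVneq v y; first by rewrite e_sym (tw_y tw) orbA orbC.
  rewrite supp_recolour_or // !gx !inE !orbF.
  have [->|ux] := eqVneq u x; first by rewrite (tw_x tw) (negbTE vy).
  have [->|vx] := eqVneq v x; first by rewrite e_sym (tw_x tw) (negbTE uy).
  by rewrite (tw_supp tw) ux uy vx vy !andbT.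
have rx : r \notin palette f1 x.
  by apply/negP=> /(subsetP F1x); rewrite in_set2; decide_eq.
have leaf z q : z != x -> q != r -> ((p1 == q) ==> ~~ conn g p1 r x1 z) ->
    ((p2 == q) ==> ~~ conn g p2 r x2 z) -> ~~ conn f1 q r z x.
  move=> zx qr n1 n2; have [p1q|p1q] := eqVneq p1 q.
    by rewrite -p1q (conn_leaf cf1 f1x1) // f1x conn_sym //; rewrite p1q eqxx in n1 *.
  have [p2q|p2q] := eqVneq p2 q.
    by rewrite -p2q (conn_leaf cf1 f1x2) // f1x conn_sym //; rewrite p2q eqxx in n2 *.
  rewrite conn_sym //; apply: conn_iso; rewrite // 1?eq_sym //.
  by apply/negP=> /(subsetP F1x); rewrite in_set2 !(eq_sym q); decide_eq.
apply: recolourP => //=.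
- by rewrite !inE; decide_eq.
- by rewrite !inE; decide_eq.
- by rewrite !inE; decide_eq.
- move=> p; rewrite clear_id // !in_cons orbF => /or3P[]/eqP-> //=.
  + apply/negP=> /(F1 _ _ y1x); rewrite (negbTE q1y) /= => /orP[]/andP[/eqP y1E /eqP qE].
      by rewrite y1E qE !eqxx in v11.
    by rewrite y1E qE !eqxx in v21.
  + apply/negP=> /(F1 _ _ y2x); rewrite (negbTE q2y) /= => /orP[]/andP[/eqP y1E /eqP qE].
      by rewrite y1E qE !eqxx in v12.
    by rewrite y1E qE !eqxx in v22.
- by move=> p _ v fv; have := edge_supp fv; rewrite f1y.
- by move=> p _ v b _ fv; have := edge_supp fv; rewrite f1y.
rewrite clear_id // !andbT; apply/andP; split; last by apply: leaf => //; rewrite eq_sym.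
apply/andP; split; last by apply: leaf => //; rewrite eq_sym.
have [Fq1|nq1] := boolP (q1 \in palette f1 x); last first.
  by rewrite (@conn_skip _ _ f1 x cf1) ?nq1 // f1x.
have [Fq2|nq2] := boolP (q2 \in palette f1 x); last first.
  by rewrite (@conn_skip _ _ f1 x cf1) ?nq2 ?orbT // f1x.
have /subsetP/(_ _ Fq1) := F1x; have /subsetP/(_ _ Fq2) := F1x.
have symg u v : conn g p1 p2 u v = conn g p1 p2 v u by apply: conn_sym.
rewrite !in_set2 => /orP[]/eqP E2 /orP[]/eqP E1; rewrite ?E1 ?E2 in q12 y_acy long *.
- by rewrite eqxx in q12.
- rewrite conn_swap (conn_through cf1 f1x1 f1x2) // f1x conn_swap (negbTE y_acy) /=.
  rewrite !eqxx orbT in long; have := long isT.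
  by rewrite negb_or !(symg y1) [conn _ _ _ x2 y1 && _]andbC.
- rewrite (conn_through cf1 f1x1 f1x2) // f1x (negbTE y_acy) /=.
  rewrite !eqxx in long; have := long isT.
  by rewrite negb_or !(symg y1) [conn _ _ _ x2 y1 && _]andbC.
- by rewrite eqxx in q12.
Qed.

End Extend.

End Twins.

(** * Exchanging two colours at a vertex *)

(** A path that leaves [z] with the edge to [u] does not stop at [u]. *)
Lemma conn_edge_in (T K : finType) (g : pcol T K) (a c : K) (z u w : T) : colouring g ->
  conn g a c z w -> g (z, u) = Some c -> a \notin palette g z -> w != z -> u != w ->
  a \in palette g u.
Proof.
move=> cg zw gzu az wz uw; have cz := colouring_clear z cg.
move: zw; rewrite (conn_sym _ _ _ _ cg) conn_swap (conn_leaf cg gzu az wz).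
rewrite (conn_sym _ _ _ _ cz) => uw_conn; apply: (subsetP (palette_clear_sub g z u)).
by apply: (conn_in uw_conn) => //; rewrite (palette_clear_edge cg gzu) in_setD1 eqxx.
Qed.

(** Exchanges the colours [c] and [c'] at [z], where the edges of these colours
    lead to vertices without further colours than [a] and [b]. This cuts the two
    paths that leave [z] with the colour [c]. *)
Lemma swap_colours (T K : finType) (g : pcol T K) (a b c c' : K) (z u u' v w : T) :
  colouring g -> c != c' -> c != a -> c != b -> c' != a -> c' != b ->
  g (z, u) = Some c -> g (z, u') = Some c' -> a \notin palette g z -> b \notin palette g z ->
  palette g u = c |: [set a; b] -> palette g u' = c' |: [set a; b] ->
  v != z -> w != z -> a \notin palette g v -> b \notin palette g w ->
  conn g a c z v -> conn g b c z w ->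
  exists g', [/\ colouring g' /\ supp g' =2 supp g,
    (forall t d, ~~ ((a \in palette g t) && (b \in palette g t)) ->
       d \notin palette g t -> d \notin palette g' t),
    (forall p q, [&& p != c, p != c', q != c & q != c'] -> conn g' p q =2 conn g p q),
    ~~ conn g' a c z v &
    forall t, b \notin palette g t -> t != z -> t != w -> ~~ conn g' b c t w].
Proof.
move=> cg cc ca cb c'a c'b gu gu' az bz Gu Gu' vz wz av bw zv zw.
have uz := col_neq cg gu; have u'z := col_neq cg gu'; have cgz := colouring_clear z cg.
have uu' : u != u' by apply: contra_neq cc => uu'; move: gu; rewrite uu' gu' => -[].
have Hu : palette (clear g z) u = [set a; b].
  by rewrite (palette_clear_edge cg gu) Gu setU1K // in_set2; decide_eq.
have Hu' : palette (clear g z) u' = [set a; b].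
  by rewrite (palette_clear_edge cg gu') Gu' setU1K // in_set2; decide_eq.
pose g' := recolour g z [:: (u, c'); (u', c)].
have cg' : colouring g'.
  apply: recolourP => //=; rewrite ?inE; decide_eq.
  - by move=> p; rewrite !in_cons orbF => /orP[]/eqP->; rewrite ?Hu ?Hu' in_set2; decide_eq.
  - move=> p; rewrite !in_cons orbF => /orP[]/eqP-> t /= gt; rewrite !inE.
      by rewrite (col_proper cg gt gu') eqxx orbT.
    by rewrite (col_proper cg gt gu) eqxx.
  - move=> p pal t d; rewrite !inE negb_or => /andP[tu tu'] /mem_palette dz.
    have da : d != a by apply: contraTneq dz => ->.
    have db : d != b by apply: contraTneq dz => ->.
    by move: pal; rewrite !in_cons orbF => /orP[]/eqP-> /=; apply: conn_iso;
      rewrite ?Hu ?Hu' ?in_set2; decide_eq.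
  by rewrite !andbT; apply: conn_iso; rewrite ?Hu ?in_set2; decide_eq.
have g'E t d : g' (z, t) = Some d -> [|| d == c, d == c' | g (z, t) == Some d].
  rewrite recolour_star /assign /=; case: eqP => [_ [->]|_]; first by rewrite eqxx orbT.
  by case: eqP => [_ [->]|_ ->]; rewrite eqxx ?orbT.
have g'z d : d \notin palette g z -> d \notin palette g' z.
  move=> dz; apply/paletteP=> -[t /g'E/or3P[]/eqP E].
  - by rewrite E (mem_palette gu) in dz.
  - by rewrite E (mem_palette gu') in dz.
  - by rewrite (mem_palette E) in dz.
have g'u : g' (z, u) = Some c' by rewrite recolour_star /assign /= eqxx.
have g'u' : g' (z, u') = Some c by rewrite recolour_star /assign /=; decide_eq.
have cz : clear g' z = clear g z by apply: clear_recolour.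
have au t : a \notin palette g t -> t != u by apply: contraNneq => ->; rewrite Gu !inE eqxx orbT.
have bu t : b \notin palette g t -> t != u by apply: contraNneq => ->; rewrite Gu !inE eqxx !orbT.
have au' t : a \notin palette g t -> t != u' by apply: contraNneq => ->; rewrite Gu' !inE eqxx orbT.
have bu' t : b \notin palette g t -> t != u' by apply: contraNneq => ->; rewrite Gu' !inE eqxx !orbT.
have sub t d : d \notin palette g t -> d \notin palette (clear g z) t.
  by apply: contra; apply/subsetP/palette_clear_sub.
have vu : conn (clear g z) a c v u.
  by move: zv; rewrite conn_sym // conn_swap (conn_leaf cg gu az vz) conn_swap.
have wu : conn (clear g z) b c w u.
  by move: zw; rewrite conn_sym // conn_swap (conn_leaf cg gu bz wz) conn_swap.
have cu : c \notin palette (clear g z) u by rewrite Hu in_set2; decide_eq.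
have cu' : c \notin palette (clear g z) u' by rewrite Hu' in_set2; decide_eq.
exists g'; split.
- split=> // s t; apply: supp_recolour => // p; rewrite !inE.
  by case/orP=> /eqP->; [apply: edge_supp gu|apply: edge_supp gu'].
- move=> t d tab dt; have [tz|tz] := eqVneq t z; first by rewrite tz in dt *; apply: g'z.
  have tuu : t \notin [:: u; u'].
    by rewrite !inE negb_or; apply/andP; split; apply: contraNneq tab => ->;
      rewrite ?Gu ?Gu' !inE !eqxx !orbT.
  by rewrite palette_recolour.
- move=> p q /and4P[pc pc' qc qc'] s t; apply: eq_connect => {}s {}t; rewrite /link ffunE /=.
  have star r : (assign g z [:: (u, c'); (u', c)] r == Some p) ||
      (assign g z [:: (u, c'); (u', c)] r == Some q) = (g (z, r) == Some p) || (g (z, r) == Some q).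
    rewrite /assign /=; have [->|ru] := eqVneq r u.
      by rewrite gu !(inj_eq Some_inj); decide_eq.
    by have [->|//] := eqVneq r u'; rewrite gu' !(inj_eq Some_inj); decide_eq.
  have [->|_] := eqVneq s z; first exact: star.
  by have [->|//] := eqVneq t z; rewrite star (col_sym cg).
- rewrite conn_sym // conn_swap (conn_leaf cg' g'u' (g'z _ az) vz) cz conn_swap.
  apply: three_ends vu => //; first by rewrite sub.
  + by rewrite cu orbT.
  + by rewrite cu' orbT.
  + exact: au.
  + exact: au'.
move=> t bt tz tw; rewrite (@conn_skip _ _ g' z cg') ?(g'z _ bz) // cz.
rewrite conn_sym //; apply: three_ends wu => //; first by rewrite sub.
- by rewrite cu orbT.
- by rewrite sub.
- exact: bu.
- by rewrite eq_sym.
- by rewrite eq_sym bu.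
Qed.

(** * Colours for the edges at two adjacent vertices of degree three *)

Section OneCommonColour.
Variables (T K : finType) (e : rel T) (D : nat).
Hypotheses (e_sym : symmetric e) (e_irr : irreflexive e) (K_card : #|K| = D.+1).
Hypothesis deg_le : forall u, edeg e u <= D.
Hypothesis sparse3 : forall u v, e u v -> edeg e u <= 3 \/ edeg e v <= 3.
Hypothesis D_ge4 : 4 <= D.
Implicit Types (g : pcol T K).

Lemma fresh (s : seq K) : size s <= 4 -> exists c, c \notin s.
Proof.
move=> s_le; have /subsetPn[c _ cs] : ~~ ([set: K] \subset s); last by exists c.
apply/negP=> /subset_leq_card; rewrite cardsT K_card => H.
by have := leq_trans H (leq_trans (card_size s) s_le); rewrite ltnNge D_ge4.
Qed.

Section Facts.
Variables (g : pcol T K) (x y x1 x2 y1 y2 : T).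
Hypothesis tw : twins e g x y x1 x2 y1 y2.

Let sub v u : supp g v u -> e v u.
Proof. by rewrite (tw_supp tw) => /and5P[]. Qed.

Let hole_x v : g (v, x) == None.
Proof. by have := tw_supp tw v x; rewrite /supp eqxx /= !andbF; case: eqP. Qed.

Let hole_y v : g (v, y) == None.
Proof. by have := tw_supp tw v y; rewrite /supp eqxx /= !andbF; case: eqP. Qed.

Lemma tw_card : #|palette g x1| < edeg e x1.
Proof.
rewrite -addn1 -(cards1 x); apply: (card_palette (tw_col tw) (@sub x1)) => v.
by rewrite inE => /eqP->; rewrite hole_x e_sym (tw_x tw) eqxx orbT.
Qed.

Lemma tw_card2 : (x1 == y1) || (x1 == y2) -> #|palette g x1| + 2 <= edeg e x1.
Proof.
move=> x1y; have <- : #|[set x; y]| = 2 by rewrite cards2 (tw_xy e_irr tw).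
apply: (card_palette (tw_col tw) (@sub x1)) => v; rewrite !inE => /orP[]/eqP->.
  by rewrite hole_x e_sym (tw_x tw) eqxx orbT.
by rewrite hole_y e_sym (tw_y tw) x1y orbT.
Qed.

Lemma tw_miss a : exists2 c, c \notin palette g x1 & c != a.
Proof.
have [|c /andP[cx ca]] := @ex_missing _ _ [set a] g x1.
  by rewrite cards1 K_card addn1 ltnS; apply: leq_trans tw_card (deg_le x1).
by exists c; rewrite // -in_set1.
Qed.

Lemma tw_miss2 a b : (x1 == y1) || (x1 == y2) -> exists2 c, c \notin palette g x1 & (c != a) && (c != b).
Proof.
move=> x1y; have [|c /andP[cx ca]] := @ex_missing _ _ [set a; b] g x1.
  rewrite K_card ltnS; apply: leq_trans (deg_le x1); apply: leq_trans (tw_card2 x1y).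
  by rewrite leq_add2l cards2; case: (_ != _).
by exists c; rewrite // -negb_or -in_set2.
Qed.

Lemma tw_same g' : colouring g' -> supp g' =2 supp g -> twins e g' x y x1 x2 y1 y2.
Proof.
by move=> cg' sg'; case: tw => *; split=> // u v; rewrite sg'.
Qed.

(** Two paths leave [z] with the edge to [u] and go on with [a] and [b]. Next to
    [z], [v], [w], all of degree more than three, there is no further colour at
    [u]. *)
Lemma full_end z u v w a b c : z != x -> z != y -> 3 < edeg e z -> 3 < edeg e v -> 3 < edeg e w ->
  g (z, u) = Some c -> a != b -> c != a -> c != b -> a \notin palette g z -> b \notin palette g z ->
  v != z -> w != z -> conn g a c z v -> conn g b c z w -> palette g u = c |: [set a; b].
Proof.
move=> zx zy z4 v4 w4 gzu ab ca cb az bz vz wz zv zw; have cg := tw_col tw.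
have u3 : edeg e u <= 3 by have [] := sparse3 (sub (edge_supp gzu)); rewrite // leqNgt z4.
have uv : u != v by apply: contraTneq u3 => ->; rewrite -ltnNge.
have uw : u != w by apply: contraTneq u3 => ->; rewrite -ltnNge.
apply/esym/eqP; rewrite eqEcard !subUset !sub1set (mem_palette2 cg gzu).
rewrite (conn_edge_in cg zv gzu az vz uv) (conn_edge_in cg zw gzu bz wz uw) /=.
rewrite !cardsU1 cards1 !inE; decide_eq.
exact: leq_trans (card_palette_le cg (@sub u)) u3.
Qed.

End Facts.

(** Closes goals in which one of the two vertices misses both colours. *)
Ltac iso := solve [ by [] | by apply: conn_iso; decide_eq
  | by rewrite conn_sym //; apply: conn_iso; decide_eq ].

(** Gives the colours [p1], [p2] at [x], [q1], [q2] at [y] and [r] to [x y]; leaves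
    the paths for which no end misses both colours. *)
Ltac extend tw p1 p2 q1 q2 r :=
  apply: (@twins_extend _ _ _ e_sym e_irr _ _ _ _ _ _ _ tw p1 p2 q1 q2 r);
  rewrite /=; decide_eq; rewrite ?implybT ?implybF //; try iso.

(** Exactly the colour [a] occurs at both [x] (on [x x1]) and [y] (on [y y1]), and
    every colour other than [a], [b], [d] is blocked by it. Such a colour then
    occurs at [x1] and at [y1], so that the colours still available for [x x1]
    and [y y1] are among [a], [b], [d]. *)
Section Locked.
Variables (g : pcol T K) (x y x1 x2 y1 y2 : T) (a b d : K).
Hypothesis tw : twins e g x y x1 x2 y1 y2.
Hypotheses (ab : a != b) (ad : a != d) (bd : b != d).
Hypotheses (ax1 : a \notin palette g x1) (bx2 : b \notin palette g x2).
Hypotheses (ay1 : a \notin palette g y1) (dy2 : d \notin palette g y2).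
Hypotheses (x1y1 : x1 != y1).
Hypotheses (x_acy : ~~ conn g a b x1 x2) (y_acy : ~~ conn g a d y1 y2).
Hypothesis lock : forall c, c \notin [:: a; b; d] -> conn g a c x1 y1.

Let cg := tw_col tw.
Let x12 := tw_nx tw.
Let y12 := tw_ny tw.

Lemma lock_in c : c \notin palette g x1 -> c != a -> (c == b) || (c == d).
Proof.
move=> cx1 ca; apply: contraNT cx1; rewrite negb_or => /andP[cb cd].
by apply: (conn_in (lock _)) => //; rewrite !inE; decide_eq.
Qed.

Lemma lock_iny c : c \notin palette g y1 -> c != a -> (c == b) || (c == d).
Proof.
move=> cy1 ca; apply: contraNT cy1; rewrite negb_or => /andP[cb cd].
have := @lock c; rewrite conn_sym // => xy; apply: (conn_in (xy _)) => //.
  by rewrite !inE; decide_eq.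
by rewrite eq_sym.
Qed.

Lemma card_locked (A : {set K}) : (forall c, c \notin [:: a; b; d] -> c \in A) -> D <= #|A| + 2.
Proof.
move=> sub; pose S := [set c in [:: a; b; d]].
have KS : #|K| <= #|A :|: S|.
  rewrite -cardsT; apply/subset_leq_card/subsetP=> c _; rewrite in_setU in_set.
  by have [_|/sub->//] := boolP (c \in [:: a; b; d]); rewrite orbT.
have S3 : #|S| <= 3 by rewrite cardsE; apply: card_size.
have := leq_trans KS (leq_card_setU A S); rewrite K_card; move: S3; clear; lia.
Qed.

Lemma card_x1 : D <= #|palette g x1| + 2.
Proof.
apply: card_locked => c cn; apply: (conn_in (lock cn)) => //.
Qed.

Lemma card_y1 : D <= #|palette g y1| + 2.
Proof.
apply: card_locked => c cn; have := lock cn; rewrite conn_sym // => yx.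
by apply: (conn_in yx); rewrite // eq_sym.
Qed.

(** The path locking [c] ends at [x1] and [y1], hence nowhere else. *)
Lemma lock_only c v : c \notin [:: a; b; d] -> v != x1 -> v != y1 ->
  (a \notin palette g v) || (c \notin palette g v) ->
  [/\ ~~ conn g a c x1 v, ~~ conn g a c y1 v & ~~ conn g a c v y1].
Proof.
move=> cn vx vy ev; have xy := lock cn; have yx := xy; rewrite conn_sym // in yx.
have n : ~~ conn g a c y1 v.
  by apply: (three_ends _ _ _ _ _ _ _ yx); rewrite ?ay1 ?ax1 // eq_sym.
split=> //; last by rewrite conn_sym.
by apply: (three_ends _ _ _ _ _ _ _ xy); rewrite ?ay1 ?ax1 // eq_sym.
Qed.

(** A common neighbour has two uncoloured edges, hence a third free colour [t].
    The neighbour [x1] has the free colour [b] or [d] besides [a]. *)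
Lemma shared_far : x2 = y2 -> colourable K e.
Proof.
move=> x2y2; move: dy2 y_acy y12 (tw_miss2 (tw_sides (tw_swapy (tw_swap tw)))); move: (tw).
rewrite -x2y2 eqxx /= => twz dz yz_acy y1z miss2.
have [c cn] := @fresh [:: a; b; d] isT.
have := cn; rewrite !inE !negb_or => /and3P[ca cb cd].
have [l lx1 la] := tw_miss tw a; have lbd := lock_in lx1 la.
have [t tz /andP[td tb]] := miss2 d b isT.
have [tE|ta] := eqVneq t a.
  have [_ _ n] : [/\ ~~ conn g a c x1 x2, ~~ conn g a c y1 x2 & ~~ conn g a c x2 y1].
    by apply: lock_only => //; rewrite -?tE ?tz // eq_sym.
  rewrite tE in tz; case/orP: lbd => /eqP lE; rewrite lE in lx1.
    by extend twz b a a d c.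
  by extend twz d a a b c.
have [n1 n2 _] : [/\ ~~ conn g a t x1 x2, ~~ conn g a t y1 x2 & ~~ conn g a t x2 y1].
  by apply: lock_only; rewrite ?tz ?orbT ?inE //; decide_eq.
case/orP: lbd => /eqP lE; rewrite lE in lx1.
  by extend twz a t a d b.
by extend twz a b a t d.
Qed.

(** At the common neighbour [x1] the colours [a], [b], [d] are all free, so that
    no path in two of them gets through it. A path in [c] and another colour
    joins at most two of the vertices involved, so one of two candidate
    colourings is acyclic. *)
Lemma shared_cross : x1 = y2 -> colourable K e.
Proof.
move=> x1y2; move: dy2 y_acy y12 (tw_miss2 tw); move: (tw).
rewrite -x1y2 eqxx orbT => twz dz yz_acy y1z miss2.
have [t tz /andP[ta td]] := miss2 a d isT.
have bz : b \notin palette g x1.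
  by have /orP[/eqP<-//|/eqP tE] := lock_in tz ta; rewrite tE eqxx in td.
have [c cn] := @fresh [:: a; b; d] isT.
have := cn; rewrite !inE !negb_or => /and3P[ca cb cd].
have [x2y1|x2y1] := eqVneq x2 y1.
  (* The edge of colour [c] at [x1] ends at a vertex of degree three, which
     cannot see all of [a], [b], [d]: one of them does not lock [c]. *)
  have [t' t'z /andP[t'a t'b]] : exists2 t, t \notin palette g x2 & (t != a) && (t != b).
    by apply: (tw_miss2 (tw_swap tw)); rewrite x2y1 eqxx.
  have dw : d \notin palette g x2.
    rewrite x2y1 in t'z *; have := lock_iny t'z t'a.
    by rewrite (negbTE t'b) => /eqP<-.
  have aw : a \notin palette g x2 by rewrite x2y1.
  have [nb|yb] := boolP (conn g b c x1 x2); last first.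
    by rewrite -x2y1 in twz; extend twz b a b d c.
  have [nd|yd] := boolP (conn g d c x1 x2); last first.
    by rewrite -x2y1 in twz; extend twz d b d a c.
  have := lock cn; rewrite -x2y1 => na; have cx1 := conn_in na x12 ax1.
  have [u gx1u] := paletteP _ _ _ cx1.
  have x1_deg : 4 <= edeg e x1.
    have := tw_card2 tw; rewrite x1y2 eqxx orbT -x1y2 => /(_ isT); have := card_x1.
    by move: D_ge4; clear; lia.
  have x2_deg : 4 <= edeg e x2.
    have := tw_card2 (tw_swap tw); rewrite x2y1 eqxx => /(_ isT); have := card_y1.
    by move: D_ge4; clear; lia.
  have ex1u : e x1 u by have := edge_supp gx1u; rewrite (tw_supp tw) => /and5P[].
  have u_deg : edeg e u <= 3 by have [] := sparse3 ex1u; rewrite // leqNgt x1_deg.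
  have ux2 : u != x2 by apply: contraTneq u_deg => ->; rewrite -ltnNge.
  have x21 : x2 != x1 by rewrite eq_sym.
  have := conn_edge_in cg na gx1u ax1 x21 ux2; have := conn_edge_in cg nb gx1u bz x21 ux2.
  have := conn_edge_in cg nd gx1u dz x21 ux2 => du bu au.
  have : #|a |: (b |: (d |: [set c]))| <= #|palette g u|.
    apply: subset_leq_card; rewrite !subUset !sub1set au bu du /=.
    exact: (mem_palette2 cg gx1u).
  have := @card_palette_le _ _ e g u cg; rewrite !cardsU1 cards1 !inE; decide_eq.
  move=> Gu; have {}Gu : #|palette g u| <= edeg e u.
    by apply: Gu => v; rewrite (tw_supp tw) => /and5P[].
  by move/leq_trans/(_ Gu)/leq_trans/(_ u_deg).
have [t' t'x2 t'b] := tw_miss (tw_swap tw) b.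
have [tE|t'a] := eqVneq t' a.
  rewrite tE in t'x2.
  have [_ _ n] : [/\ ~~ conn g a c x1 x2, ~~ conn g a c y1 x2 & ~~ conn g a c x2 y1].
    by apply: lock_only => //; rewrite ?t'x2 // eq_sym.
  by extend twz b a a d c.
have [tE|t'd] := eqVneq t' d.
  rewrite tE in t'x2; have [s sy1 sa] := tw_miss (tw_sides tw) a.
  have sbd := lock_iny sy1 sa.
  case/orP: sbd => /eqP sE.
    rewrite sE in sy1; have [n|n] := boolP (conn g b c x2 y1); last by extend twz a b b d c.
    have n' : ~~ conn g b c x1 y1.
      rewrite conn_sym //; rewrite conn_sym // in n; apply: (three_ends _ _ _ _ _ _ _ n);
        rewrite ?sy1 ?bx2 ?bz //; decide_eq.
    by extend twz b d b a c.
  rewrite sE in sy1; have [n|n] := boolP (conn g d c x2 y1); last by extend twz a d d b c.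
  have n' : ~~ conn g d c x2 x1.
    by apply: (three_ends _ _ _ _ _ _ _ n); rewrite ?sy1 ?dz ?t'x2 //; decide_eq.
  by extend twz b d a d c.
have [n _ _] : [/\ ~~ conn g a t' x1 x2, ~~ conn g a t' y1 x2 & ~~ conn g a t' x2 y1].
  by apply: lock_only; rewrite ?t'x2 ?orbT ?inE //; decide_eq.
by extend twz a t' a d b.
Qed.

Section Distinct.
Hypotheses (x1y2 : x1 != y2) (x2y1 : x2 != y1) (x2y2 : x2 != y2).

(** With the fourth colour [t] on [x x2], the colour [b] suits [x y], unless it is
    blocked by [a]; then [b] occurs at [x1] and [y1], and [d] is free there. *)
Lemma new_colour_x2 t : t \notin palette g x2 -> t \notin [:: a; b; d] -> colourable K e.
Proof.
move=> tx2 tn; have := tn; rewrite !inE !negb_or => /and3P[ta tb td].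
have [n _ _] : [/\ ~~ conn g a t x1 x2, ~~ conn g a t y1 x2 & ~~ conn g a t x2 y1].
  by apply: lock_only; rewrite ?tx2 ?orbT //; decide_eq.
have [nb|yb] := boolP (conn g a b x1 y1); last by extend tw a t a d b.
have bx1 : b \in palette g x1 by apply: (conn_in nb).
have by1 : b \in palette g y1.
  by rewrite conn_sym // in nb; apply: (conn_in nb) => //; rewrite eq_sym.
have dx1 : d \notin palette g x1.
  have [l lx1 la] := tw_miss tw a.
  by case/orP: (lock_in lx1 la) => /eqP lE; rewrite lE ?bx1 in lx1.
have dy1 : d \notin palette g y1.
  have [l ly1 la] := tw_miss (tw_sides tw) a.
  by case/orP: (lock_iny ly1 la) => /eqP lE; rewrite lE ?by1 in ly1.
have [s sy2 sd] := tw_miss (tw_sides (tw_swapy tw)) d.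
have [sE|sa] := eqVneq s a.
  rewrite sE in sy2; have [c cn] := @fresh [:: a; b; d] isT.
  have := cn; rewrite !inE !negb_or => /and3P[ca cb cd].
  have [n' _ _] : [/\ ~~ conn g a c x1 y2, ~~ conn g a c y1 y2 & ~~ conn g a c y2 y1].
    by apply: lock_only; rewrite ?sy2 //; decide_eq.
  by extend tw a b d a c.
have [sE|sb] := eqVneq s b.
  rewrite sE in sy2; have [c] := @fresh [:: a; b; d; t] isT.
  rewrite !inE !negb_or => /and4P[ca cb cd ct].
  by extend tw a t d b c.
have [_ n' _] : [/\ ~~ conn g a s x1 y2, ~~ conn g a s y1 y2 & ~~ conn g a s y2 y1].
  by apply: lock_only; rewrite ?sy2 ?orbT ?inE //; decide_eq.
by extend tw a b a s d.
Qed.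

(** If [l] blocks in the same way as [a], the neighbours of [x1] along the blocked
    colours are full; exchanging two of these colours at [x1] unblocks them. *)
Lemma cut_lock l : l != a -> (l == b) || (l == d) -> l \notin palette g x1 -> l \notin palette g y2 ->
  ~~ ((a \in palette g x2) && (l \in palette g x2)) ->
  3 < edeg e x1 -> 3 < edeg e y1 -> 3 < edeg e y2 ->
  (forall c, c \notin [:: a; b; d] -> conn g l c x1 y2) -> colourable K e.
Proof.
move=> la lbd lx1 ly2 ax2 x14 y14 y24 lock'; have [c cn] := @fresh [:: a; b; d] isT.
have := cn; rewrite !inE !negb_or => /and3P[ca cb cd].
have [c'] := @fresh [:: a; b; d; c] isT.
rewrite !inE !negb_or => /and4P[c'a c'b c'd c'c].
have c'n : c' \notin [:: a; b; d] by rewrite !inE; decide_eq.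
have cl : c != l by case/orP: lbd => /eqP->.
have c'l : c' != l by case/orP: lbd => /eqP->.
have [u gu] := paletteP _ _ _ (conn_in (lock cn) x1y1 ax1).
have [u' gu'] := paletteP _ _ _ (conn_in (lock c'n) x1y1 ax1).
have x1x := tw_x1x e_irr tw; have x1y := tw_x1 tw.
have y1x1 : y1 != x1 by rewrite eq_sym.
have y2x1 : y2 != x1 by rewrite eq_sym.
have al : a != l by rewrite eq_sym.
have Gu := full_end tw x1x x1y x14 y14 y24 gu al ca cl ax1 lx1 y1x1 y2x1 (lock cn) (lock' _ cn).
have Gu' := full_end tw x1x x1y x14 y14 y24 gu' al c'a c'l ax1 lx1 y1x1 y2x1 (lock c'n) (lock' _ c'n).
have cc' : c != c' by rewrite eq_sym.
have [g' [[cg' sg'] pal same cut _]] := swap_colours cg cc' ca cl c'a c'l gu gu' ax1 lx1 Gu Gu'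
  y1x1 y2x1 ay1 ly2 (lock cn) (lock' _ cn).
have tw' := tw_same tw cg' sg'.
have px1 : a \notin palette g' x1 by apply: pal => //; rewrite (negbTE ax1).
have px2 : b \notin palette g' x2 by apply: pal.
have py1 : a \notin palette g' y1 by apply: pal => //; rewrite (negbTE ay1).
have py2 : d \notin palette g' y2 by apply: pal => //; rewrite (negbTE ly2) andbF.
have ax : ~~ conn g' a b x1 x2 by rewrite same //; decide_eq.
have ay : ~~ conn g' a d y1 y2 by rewrite same //; decide_eq.
by extend tw' a b a d c.
Qed.

(** From here on each of [x1], [x2], [y1], [y2] has a second free colour among
    [a], [b], [d], besides its present colour. In [free_pq_rs] these are [p], [q]
    at [x1], [x2] and [r], [s] at [y1], [y2]; in [free_pq] they are [p], [q] at
    [x1], [x2]. A vertex at which two colours are free cuts the paths in these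
    colours. Moreover, the path in [c] and a second colour that starts at one of
    the four vertices ends at one of the others at most. Hence one of two or
    three assignments is acyclic, or [cut_lock] applies. *)
Lemma free_bd_ba : b \notin palette g x1 -> d \notin palette g x2 ->
  b \notin palette g y1 -> a \notin palette g y2 -> colourable K e.
Proof.
move=> bx1 dx2 by1 ay2; have [c cn] := @fresh [:: a; b; d] isT.
have := cn; rewrite !inE !negb_or => /and3P[ca cb cd].
have [n _ _] : [/\ ~~ conn g a c x1 y2, ~~ conn g a c y1 y2 & ~~ conn g a c y2 y1].
  by apply: lock_only; rewrite ?ay2 //; decide_eq.
have [yb|nb] := boolP (conn g b c x2 y1); last first.
  extend tw a b b a c.
  have nx1 : ~~ conn g a b x1 y1 by iso.
  have nx2 : ~~ conn g a b x2 y1 by iso.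
  by rewrite (negbTE nx1) (negbTE nx2) andbF.
have n' : ~~ conn g b c x1 y1.
  rewrite conn_sym //; rewrite conn_sym // in yb.
  by apply: (three_ends _ _ _ _ _ _ _ yb); rewrite ?bx1 ?bx2 ?by1 //; decide_eq.
by extend tw b d b a c.
Qed.

Lemma free_bd_db : b \notin palette g x1 -> d \notin palette g x2 ->
  d \notin palette g y1 -> b \notin palette g y2 -> colourable K e.
Proof.
move=> bx1 dx2 dy1 by2; have [c cn] := @fresh [:: a; b; d] isT.
have := cn; rewrite !inE !negb_or => /and3P[ca cb cd].
have [yd|nd] := boolP (conn g d c x2 y2); last by extend tw b d a d c.
have n1 : ~~ conn g d c x2 y1.
  by apply: (three_ends _ _ _ _ _ _ _ yd); rewrite ?dx2 ?dy1 ?dy2 //; decide_eq.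
have [yb|nb] := boolP (conn g b c x1 y2); last first.
  extend tw b d d b c.
  have nx1 : ~~ conn g b d x2 y1 by iso.
  have nx2 : ~~ conn g b d x2 y2 by iso.
  by rewrite (negbTE nx1) (negbTE nx2) !andbF.
have n2 : ~~ conn g b c x2 y2.
  rewrite conn_sym //; rewrite conn_sym // in yb.
  by apply: (three_ends _ _ _ _ _ _ _ yb); rewrite ?bx1 ?bx2 ?by2 //; decide_eq.
by extend tw a b d b c.
Qed.

Lemma free_da_ba : d \notin palette g x1 -> a \notin palette g x2 ->
  b \notin palette g y1 -> a \notin palette g y2 ->
  3 < edeg e x1 -> 3 < edeg e y1 -> 3 < edeg e y2 -> colourable K e.
Proof.
move=> dx1 ax2 by1 ay2 x14 y14 y24.
have [/existsP[c /andP[cn nc]]|/existsPn lock'] :=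
    boolP [exists c, (c \notin [:: a; b; d]) && ~~ conn g d c x1 y2].
  have := cn; rewrite !inE !negb_or => /and3P[ca cb cd].
  have [_ _ n] : [/\ ~~ conn g a c x1 x2, ~~ conn g a c y1 x2 & ~~ conn g a c x2 y1].
    by apply: lock_only; rewrite ?ax2 //; decide_eq.
  extend tw d a a d c.
  have nx1 : ~~ conn g d a x1 y1 by iso.
  have nx2 : ~~ conn g d a x1 y2 by iso.
  by rewrite (negbTE nx1) (negbTE nx2).
apply: (@cut_lock d); rewrite ?eqxx ?orbT // 1?eq_sym // ?(negbTE ax2) //.
by move=> c cn; have := lock' c; rewrite cn negbK.
Qed.

Lemma free_bd_bb : b \notin palette g x1 -> d \notin palette g x2 ->
  b \notin palette g y1 -> b \notin palette g y2 ->
  3 < edeg e x1 -> 3 < edeg e y1 -> 3 < edeg e y2 -> colourable K e.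
Proof.
move=> bx1 dx2 by1 by2 x14 y14 y24.
have [/existsP[c /andP[cn nc]]|/existsPn lock'] :=
    boolP [exists c, (c \notin [:: a; b; d]) && ~~ conn g b c x1 y2].
  have := cn; rewrite !inE !negb_or => /and3P[ca cb cd].
  by extend tw b d a b c.
apply: (@cut_lock b); rewrite ?eqxx ?orbT // 1?eq_sym // ?(negbTE bx2) ?andbF //.
by move=> c cn; have := lock' c; rewrite cn negbK.
Qed.

Lemma free_ba : b \notin palette g x1 -> a \notin palette g x2 -> colourable K e.
Proof.
move=> bx1 ax2; have [c cn] := @fresh [:: a; b; d] isT.
have := cn; rewrite !inE !negb_or => /and3P[ca cb cd].
have [_ _ n] : [/\ ~~ conn g a c x1 x2, ~~ conn g a c y1 x2 & ~~ conn g a c x2 y1].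
  by apply: lock_only; rewrite ?ax2 //; decide_eq.
by extend tw b a a d c.
Qed.

Lemma free_dd : d \notin palette g x1 -> d \notin palette g x2 ->
  (b \notin palette g x1) || (b \notin palette g y1) -> colourable K e.
Proof.
move=> dx1 dx2 bxy; have n : ~~ conn g a b x1 y1 by case/orP: bxy => bn; iso.
extend tw a d a d b.
have nx1 : ~~ conn g a d x1 y1 by iso.
have nx2 : ~~ conn g a d x1 y2 by iso.
by rewrite (negbTE nx1) (negbTE nx2).
Qed.

End Distinct.
End Locked.

(** If at most two of the [D + 1] colours are free, then at least [D - 1] edges are
    coloured. *)
Lemma deg_big g v p q : #|palette g v| < edeg e v ->
  (forall c, c \notin [:: p; q] -> c \in palette g v) -> 3 < edeg e v.
Proof.
move=> lt sub; pose S := [set c in [:: p; q]].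
have KS : #|K| <= #|palette g v :|: S|.
  rewrite -cardsT; apply/subset_leq_card/subsetP=> c _; rewrite in_setU in_set.
  by have [_|/sub->//] := boolP (c \in [:: p; q]); rewrite orbT.
have S3 : #|S| <= 2 by rewrite cardsE; apply: card_size.
have := leq_trans KS (leq_card_setU (palette g v) S); rewrite K_card.
by move: S3 lt D_ge4; clear; lia.
Qed.

Lemma one_common_distinct g x y x1 x2 y1 y2 a b d : twins e g x y x1 x2 y1 y2 ->
  a != b -> a != d -> b != d ->
  a \notin palette g x1 -> b \notin palette g x2 -> a \notin palette g y1 -> d \notin palette g y2 ->
  x1 != y1 -> ~~ conn g a b x1 x2 -> ~~ conn g a d y1 y2 ->
  (forall c, c \notin [:: a; b; d] -> conn g a c x1 y1) ->
  x1 != y2 -> x2 != y1 -> x2 != y2 -> colourable K e.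
Proof.
move=> tw ab ad bd ax1 bx2 ay1 dy2 x1y1 x_acy y_acy lock x1y2 x2y1 x2y2; have cg := tw_col tw.
have da : d != a by rewrite eq_sym.
have db : d != b by rewrite eq_sym.
have y1x1 : y1 != x1 by rewrite eq_sym.
have y2x1 : y2 != x1 by rewrite eq_sym.
have y1x2 : y1 != x2 by rewrite eq_sym.
have y2x2 : y2 != x2 by rewrite eq_sym.
have tw' := tw_sides tw.
have lock' c : c \notin [:: a; d; b] -> conn g a c y1 x1.
  by move=> cn; rewrite conn_sym // lock //; move: cn; rewrite !inE [(c == b) || _]orbC.
have [/existsP[t /andP[tx2 tn]]|/existsPn old_x2] :=
    boolP [exists t, (t \notin palette g x2) && (t \notin [:: a; b; d])].
  exact: (new_colour_x2 tw ab ad bd ax1 bx2 ay1 dy2 x1y1 x_acy y_acy lock x1y2 x2y1 x2y2 tx2 tn).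
have [/existsP[t /andP[ty2 tn]]|/existsPn old_y2] :=
    boolP [exists t, (t \notin palette g y2) && (t \notin [:: a; d; b])].
  exact: (new_colour_x2 tw' ad ab db ay1 dy2 ax1 bx2 y1x1 y_acy x_acy lock' y1x2 y2x1 y2x2 ty2 tn).
have X1 : (b \notin palette g x1) || (d \notin palette g x1).
  have [l lx1 la] := tw_miss tw a.
  by case/orP: (lock_in ax1 x1y1 lock lx1 la) => /eqP<-; rewrite lx1 ?orbT.
have Y1 : (d \notin palette g y1) || (b \notin palette g y1).
  have [l lx1 la] := tw_miss tw' a.
  by case/orP: (lock_in ay1 y1x1 lock' lx1 la) => /eqP<-; rewrite lx1 ?orbT.
have X2 : (a \notin palette g x2) || (d \notin palette g x2).
  have [l lx2 lb] := tw_miss (tw_swap tw) b; have := old_x2 l; rewrite lx2 negbK !inE (negbTE lb).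
  by case/orP=> /eqP<-; rewrite lx2 ?orbT.
have Y2 : (a \notin palette g y2) || (b \notin palette g y2).
  have [l lx2 lb] := tw_miss (tw_swap tw') d; have := old_y2 l; rewrite lx2 negbK !inE (negbTE lb).
  by case/orP=> /eqP<-; rewrite lx2 ?orbT.
have S : b \notin palette g x1 -> a \notin palette g x2 -> colourable K e.
  by move=> ? ?; apply: (@free_ba g x y x1 x2 y1 y2 a b d).
have S' : d \notin palette g y1 -> a \notin palette g y2 -> colourable K e.
  by move=> ? ?; apply: (@free_ba g y x y1 y2 x1 x2 a d b).
have O : d \notin palette g x1 -> d \notin palette g x2 ->
    (b \notin palette g x1) || (b \notin palette g y1) -> colourable K e.
  by move=> ? ? ?; apply: (@free_dd g x y x1 x2 y1 y2 a b d).
have O' : b \notin palette g y1 -> b \notin palette g y2 ->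
    (d \notin palette g y1) || (d \notin palette g x1) -> colourable K e.
  by move=> ? ? ?; apply: (@free_dd g y x y1 y2 x1 x2 a d b).
have in_x1 c : c != a -> c != b -> c != d -> c \in palette g x1.
  by move=> ? ? ?; apply: (conn_in (lock c _)); rewrite // !inE; decide_eq.
have in_y1 c : c != a -> c != b -> c != d -> c \in palette g y1.
  by move=> ? ? ?; apply: (conn_in (lock' c _)); rewrite // !inE; decide_eq.
have in_x2 c : c != a -> c != b -> c != d -> c \in palette g x2.
  by move=> ? ? ?; have := old_x2 c; rewrite !inE; decide_eq; rewrite andbT negbK.
have in_y2 c : c != a -> c != b -> c != d -> c \in palette g y2.
  by move=> ? ? ?; have := old_y2 c; rewrite !inE; decide_eq; rewrite andbT negbK.
have x1_lt := tw_card tw; have x2_lt := tw_card (tw_swap tw).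
have y1_lt := tw_card tw'; have y2_lt := tw_card (tw_swap tw').
have [X1b|X1b] := boolP (b \notin palette g x1).
  have [X2d|X2d] := boolP (d \notin palette g x2); last first.
    by rewrite (negbTE X2d) orbF in X2; apply: S.
  have [X1d|X1d] := boolP (d \notin palette g x1); first by apply: O; rewrite ?X1b.
  have [Y1d|Y1d] := boolP (d \notin palette g y1).
    have [Y2a|Y2a] := boolP (a \notin palette g y2); first exact: S'.
    rewrite (negbTE Y2a) /= in Y2.
    exact: (@free_bd_db g x y x1 x2 y1 y2 a b d).
  rewrite (negbTE Y1d) /= in Y1; rewrite !negbK in X1d Y1d.
  have [Y2a|Y2a] := boolP (a \notin palette g y2).
    exact: (@free_bd_ba g x y x1 x2 y1 y2 a b d).
  rewrite (negbTE Y2a) /= in Y2; rewrite negbK in Y2a.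
  apply: (@free_bd_bb g x y x1 x2 y1 y2 a b d) => //.
  - apply: (@deg_big g x1 a b) => // c; rewrite !inE negb_or => /andP[ca cb].
    by have [->//|cd] := eqVneq c d; apply: in_x1.
  - apply: (@deg_big g y1 a b) => // c; rewrite !inE negb_or => /andP[ca cb].
    by have [->//|cd] := eqVneq c d; apply: in_y1.
  apply: (@deg_big g y2 b d) => // c; rewrite !inE negb_or => /andP[cb cd].
  by have [->//|ca] := eqVneq c a; apply: in_y2.
rewrite (negbTE X1b) /= in X1; rewrite negbK in X1b.
have [Y1d|Y1d] := boolP (d \notin palette g y1).
  have [Y2a|Y2a] := boolP (a \notin palette g y2); first exact: S'.
  rewrite (negbTE Y2a) /= in Y2; rewrite negbK in Y2a.
  have [Y1b|Y1b] := boolP (b \notin palette g y1); first by apply: O'; rewrite ?Y1d.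
  rewrite negbK in Y1b.
  have [X2a|X2a] := boolP (a \notin palette g x2).
    exact: (@free_bd_ba g y x y1 y2 x1 x2 a d b).
  rewrite (negbTE X2a) /= in X2; rewrite negbK in X2a.
  apply: (@free_bd_bb g y x y1 y2 x1 x2 a d b) => //.
  - apply: (@deg_big g y1 a d) => // c; rewrite !inE negb_or => /andP[ca cd].
    by have [->//|cb] := eqVneq c b; apply: in_y1.
  - apply: (@deg_big g x1 a d) => // c; rewrite !inE negb_or => /andP[ca cd].
    by have [->//|cb] := eqVneq c b; apply: in_x1.
  apply: (@deg_big g x2 b d) => // c; rewrite !inE negb_or => /andP[cb cd].
  by have [->//|ca] := eqVneq c a; apply: in_x2.
rewrite (negbTE Y1d) /= in Y1; rewrite negbK in Y1d.
have [X2d|X2d] := boolP (d \notin palette g x2); first by apply: O; rewrite ?Y1 ?orbT.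
rewrite (negbTE X2d) orbF in X2.
have [Y2b|Y2b] := boolP (b \notin palette g y2); first by apply: O'; rewrite ?X1 ?orbT.
rewrite (negbTE Y2b) orbF in Y2; rewrite negbK in Y2b.
apply: (@free_da_ba g x y x1 x2 y1 y2 a b d) => //.
- apply: (@deg_big g x1 a d) => // c; rewrite !inE negb_or => /andP[ca cd].
  by have [->//|cb] := eqVneq c b; apply: in_x1.
- apply: (@deg_big g y1 a b) => // c; rewrite !inE negb_or => /andP[ca cb].
  by have [->//|cd] := eqVneq c d; apply: in_y1.
apply: (@deg_big g y2 a d) => // c; rewrite !inE negb_or => /andP[ca cd].
by have [->//|cb] := eqVneq c b; apply: in_y2.
Qed.

Lemma one_common_colour g x y x1 x2 y1 y2 a b d : twins e g x y x1 x2 y1 y2 ->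
  a != b -> a != d -> b != d ->
  a \notin palette g x1 -> b \notin palette g x2 -> a \notin palette g y1 -> d \notin palette g y2 ->
  x1 != y1 -> ~~ conn g a b x1 x2 -> ~~ conn g a d y1 y2 -> colourable K e.
Proof.
move=> tw ab ad bd ax1 bx2 ay1 dy2 x1y1 x_acy y_acy; have cg := tw_col tw.
have [/existsP[c /andP[cn nc]]|/existsPn lock] :=
    boolP [exists c, (c \notin [:: a; b; d]) && ~~ conn g a c x1 y1].
  have := cn; rewrite !inE !negb_or => /and3P[ca cb cd].
  by extend tw a b a d c.
have {}lock c : c \notin [:: a; b; d] -> conn g a c x1 y1.
  by move=> cn; have := lock c; rewrite cn negbK.
have [x2y2|x2y2] := eqVneq x2 y2; first exact: (@shared_far g x y x1 x2 y1 y2 a b d).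
have [x1y2|x1y2] := eqVneq x1 y2; first exact: (@shared_cross g x y x1 x2 y1 y2 a b d).
have [y1x2|y1x2] := eqVneq y1 x2; last first.
  by rewrite eq_sym in y1x2; apply: (@one_common_distinct g x y x1 x2 y1 y2 a b d).
apply: (@shared_cross g y x y1 y2 x1 x2 a d b) => //; rewrite 1?eq_sym //.
  exact: tw_sides.
by move=> c cn; rewrite conn_sym // lock //; move: cn; rewrite !inE [(c == b) || _]orbC.
Qed.

(** A free colour [t] at [x1] is blocked by a path from [x2] to [y2], which keeps
    [x1] apart from [x2]: [x x1] can take [t], and one common colour is left. *)
Lemma extra_colour g x y x1 x2 y1 y2 a b t : twins e g x y x1 x2 y1 y2 -> a != b ->
  a \notin palette g x1 -> b \notin palette g x2 -> a \notin palette g y1 -> b \notin palette g y2 ->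
  x1 != y1 -> x2 != y2 -> ~~ conn g a b y1 y2 ->
  (forall c, c \notin [:: a; b] -> conn g a c x1 y1 || conn g b c x2 y2) ->
  t \notin palette g x1 -> t \notin [:: a; b] -> colourable K e.
Proof.
move=> tw ab ax1 bx2 ay1 by2 x1y1 x2y2 y_acy bad tx1 tn; have cg := tw_col tw.
have := tn; rewrite !inE negb_or => /andP[ta tb]; have x12 := tw_nx tw.
have bt_path : conn g b t x2 y2.
  by case/orP: (bad _ tn) => // /conn_in; rewrite (negbTE tx1) => /(_ x1y1 ax1).
have x1y2 : x1 != y2.
  apply: contraNneq tx1 => ->; move: bt_path; rewrite conn_sym // => /conn_in; apply=> //.
  by rewrite eq_sym.
have x_acy : ~~ conn g b t x2 x1.
  by apply: (three_ends _ _ _ _ _ _ _ bt_path); rewrite ?bx2 ?by2 ?tx1 ?orbT //; decide_eq.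
apply: (@one_common_colour g x y x2 x1 y2 y1 b t a) => //; decide_eq.
  exact: tw_swap (tw_swapy tw).
by rewrite conn_swap conn_sym.
Qed.

(** At [x1], the paths of both colours [a] and [b] can be cut at once. *)
Lemma cut_two g x y x1 x2 y1 y2 a b c c' : twins e g x y x1 x2 y1 y2 -> a != b ->
  a \notin palette g x1 -> b \notin palette g x1 -> b \notin palette g x2 ->
  a \notin palette g y1 -> b \notin palette g y2 ->
  x1 != y1 -> x1 != y2 -> x2 != y1 -> x2 != y2 ->
  ~~ conn g a b x1 x2 -> ~~ conn g a b y1 y2 ->
  3 < edeg e x1 -> 3 < edeg e y1 -> 3 < edeg e y2 ->
  c != c' -> c \notin [:: a; b] -> c' \notin [:: a; b] ->
  conn g a c x1 y1 -> conn g b c x1 y2 -> conn g a c' x1 y1 -> conn g b c' x1 y2 ->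
  colourable K e.
Proof.
move=> tw ab ax1 bx1 bx2 ay1 by2 x1y1 x1y2 x2y1 x2y2 x_acy y_acy x14 y14 y24 cc'.
rewrite !inE !negb_or => /andP[ca cb] /andP[c'a c'b] ac bc ac' bc'; have cg := tw_col tw.
have x1x := tw_x1x e_irr tw; have x1y := tw_x1 tw; have x12 := tw_nx tw.
have [u gu] := paletteP _ _ _ (conn_in ac x1y1 ax1).
have [u' gu'] := paletteP _ _ _ (conn_in ac' x1y1 ax1).
have y1x1 : y1 != x1 by rewrite eq_sym.
have y2x1 : y2 != x1 by rewrite eq_sym.
have Gu := full_end tw x1x x1y x14 y14 y24 gu ab ca cb ax1 bx1 y1x1 y2x1 ac bc.
have Gu' := full_end tw x1x x1y x14 y14 y24 gu' ab c'a c'b ax1 bx1 y1x1 y2x1 ac' bc'.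
have [g' [[cg' sg'] pal same cut_a cut_b]] := swap_colours cg cc' ca cb c'a c'b gu gu' ax1 bx1
  Gu Gu' y1x1 y2x1 ay1 by2 ac bc.
have tw' := tw_same tw cg' sg'.
have px1 : a \notin palette g' x1 by apply: pal => //; rewrite (negbTE ax1).
have px1' : b \notin palette g' x1 by apply: pal => //; rewrite (negbTE ax1).
have px2 : b \notin palette g' x2 by apply: pal; rewrite // (negbTE bx2) andbF.
have py1 : a \notin palette g' y1 by apply: pal => //; rewrite (negbTE ay1).
have py2 : b \notin palette g' y2 by apply: pal => //; rewrite (negbTE by2) andbF.
have ax : ~~ conn g' a b x1 x2 by rewrite same //; decide_eq.
have ay : ~~ conn g' a b y1 y2 by rewrite same //; decide_eq.
have cut_b' : ~~ conn g' b c x2 y2 by apply: cut_b; rewrite // eq_sym.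
extend tw' a b a b c.
have nx1 : ~~ conn g' a b x1 y1 by iso.
have nx2 : ~~ conn g' a b x1 y2 by iso.
by rewrite (negbTE nx1) (negbTE nx2).
Qed.

(** When [a] and [b] are the only free colours at the four further neighbours,
    they can also be exchanged at [x]. A blocked colour is then blocked by two
    paths from the same neighbour of [x]. Of three blocked colours two concern
    the same neighbour, and there they can be exchanged. *)
Lemma two_common_colours g x y x1 x2 y1 y2 a b : twins e g x y x1 x2 y1 y2 -> a != b ->
  a \notin palette g x1 -> b \notin palette g x2 -> a \notin palette g y1 -> b \notin palette g y2 ->
  x1 != y1 -> x2 != y2 -> ~~ conn g a b x1 x2 -> ~~ conn g a b y1 y2 ->
  ~~ (conn g a b x1 y1 && conn g a b x2 y2) && ~~ (conn g a b x1 y2 && conn g a b x2 y1) ->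
  colourable K e.
Proof.
move=> tw ab ax1 bx2 ay1 by2 x1y1 x2y2 x_acy y_acy long; have cg := tw_col tw.
have ba : b != a by rewrite eq_sym.
have x12 := tw_nx tw; have y12 := tw_ny tw.
have [/existsP[c /and3P[cn n1 n2]]|/existsPn none] := boolP [exists c,
    [&& c \notin [:: a; b], ~~ conn g a c x1 y1 & ~~ conn g b c x2 y2]].
  have := cn; rewrite !inE !negb_or => /andP[ca cb].
  by extend tw a b a b c.
have bad c : c \notin [:: a; b] -> conn g a c x1 y1 || conn g b c x2 y2.
  by move=> cn; have := none c; rewrite cn -negb_or negbK.
have twx := tw_swap (tw_swapy tw); have twy := tw_sides tw; have twxy := tw_swap (tw_swapy twy).
have badx c : c \notin [:: b; a] -> conn g b c x2 y2 || conn g a c x1 y1.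
  by move=> cn; rewrite orbC bad //; move: cn; rewrite !inE orbC.
have bady c : c \notin [:: a; b] -> conn g a c y1 x1 || conn g b c y2 x2.
  by move=> cn; rewrite ![conn _ _ _ _ x1]conn_sym // ![conn _ _ _ _ x2]conn_sym // bad.
have badxy c : c \notin [:: b; a] -> conn g b c y2 x2 || conn g a c y1 x1.
  by move=> cn; rewrite orbC bady //; move: cn; rewrite !inE orbC.
have x_acy' : ~~ conn g b a x2 x1 by rewrite conn_swap conn_sym.
have y_acy' : ~~ conn g b a y2 y1 by rewrite conn_swap conn_sym.
have y1x1 : y1 != x1 by rewrite eq_sym.
have y2x2 : y2 != x2 by rewrite eq_sym.
have no_extra (v : T) : (forall t, t \notin palette g v -> t \notin [:: a; b] -> colourable K e) ->
    colourable K e \/ forall t, t \notin [:: a; b] -> t \in palette g v.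
  move=> ext; have [/existsP[t /andP[tv tn]]|/existsPn old] :=
      boolP [exists t, (t \notin palette g v) && (t \notin [:: a; b])].
    by left; apply: ext tv tn.
  by right=> t tn; have := old t; rewrite tn andbT negbK.
have sw t : t \notin [:: a; b] -> t \notin [:: b; a] by rewrite !inE orbC.
have [//|in_x1] := no_extra x1 (fun t => extra_colour tw ab ax1 bx2 ay1 by2 x1y1 x2y2 y_acy bad).
have [//|in_y1] := no_extra y1 (fun t => extra_colour twy ab ay1 by2 ax1 bx2 y1x1 y2x2 x_acy bady).
have [|//|in_x2] := no_extra x2.
  by move=> t tx2 /sw tn; apply: (extra_colour twx ba bx2 ax1 by2 ay1 x2y2 x1y1 y_acy' badx tx2).
have [|//|in_y2] := no_extra y2.
  by move=> t ty2 /sw tn; apply: (extra_colour twxy ba by2 ay1 bx2 ax1 y2x2 y1x1 x_acy' badxy ty2).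
have other g' x' y' z z' w w' : twins e g' x' y' z z' w w' ->
    (forall t, t \notin [:: a; b] -> t \in palette g' z) ->
    [/\ (a \notin palette g' z) && (b \notin palette g' z), z != w & z != w'].
  move=> twz in_z.
  have sub t : t \notin palette g' z -> (t == a) || (t == b).
    by apply: contraNT => tn; apply: in_z; rewrite !inE.
  have [/andP[zw zw']|] := boolP ((z != w) && (z != w')); last first.
    rewrite negb_and !negbK => /(tw_miss2 twz a b)[t tz /andP[/negbTE ta /negbTE tb]].
    by have := sub _ tz; rewrite ta tb.
  have [t tz ta] := tw_miss twz a; have [s sz sb] := tw_miss twz b.
  have := sub _ tz; rewrite (negbTE ta) => /eqP <-.
  by have := sub _ sz; rewrite (negbTE sb) orbF => /eqP <-; rewrite tz sz.
have [/andP[_ bx1] _ x1y2] := other _ _ _ _ _ _ _ tw in_x1.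
have [/andP[ax2 _] x2y1 _] := other _ _ _ _ _ _ _ (tw_swap tw) in_x2.
have [/andP[_ by1] _ _] := other _ _ _ _ _ _ _ twy in_y1.
have [/andP[ay2 _] _ _] := other _ _ _ _ _ _ _ (tw_swap twy) in_y2.
have [/existsP[c /and3P[cn n1 n2]]|/existsPn none'] := boolP [exists c,
    [&& c \notin [:: a; b], ~~ conn g b c x1 y2 & ~~ conn g a c x2 y1]].
  have := cn; rewrite !inE !negb_or => /andP[ca cb].
  extend tw b a a b c.
  have nx1 : ~~ conn g b a x1 y1 by iso.
  have nx2 : ~~ conn g b a x1 y2 by iso.
  by rewrite (negbTE nx1) (negbTE nx2).
have bad' c : c \notin [:: a; b] -> conn g b c x1 y2 || conn g a c x2 y1.
  by move=> cn; have := none' c; rewrite cn -negb_or negbK.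
have class1 c : c \notin [:: a; b] -> conn g a c x1 y1 -> conn g b c x1 y2.
  move=> cn ac; case/orP: (bad' _ cn) => // ac'; rewrite conn_sym // in ac; rewrite conn_sym // in ac'.
  have := three_ends cg _ _ _ y1x1 _ x12 ac; rewrite ac' ay1 ax1 ax2 eq_sym x2y1.
  by move/(_ isT isT isT isT).
have class2 c : c \notin [:: a; b] -> conn g b c x2 y2 -> conn g a c x2 y1.
  move=> cn bc; case/orP: (bad' _ cn) => // bc'; rewrite conn_sym // in bc; rewrite conn_sym // in bc'.
  have x21 : x2 != x1 by rewrite eq_sym.
  have := three_ends cg _ _ _ y2x2 _ x21 bc; rewrite bc' by2 bx1 bx2 eq_sym x1y2.
  by move/(_ isT isT isT isT).
have [x14 x24 y14 y24] : [/\ 3 < edeg e x1, 3 < edeg e x2, 3 < edeg e y1 & 3 < edeg e y2].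
  split; [apply: deg_big in_x1|apply: deg_big in_x2|apply: deg_big in_y1|apply: deg_big in_y2].
  - exact: tw_card tw.
  - exact: tw_card (tw_swap tw).
  - exact: tw_card twy.
  - exact: tw_card (tw_swap twy).
have pair c c' : c != c' -> c \notin [:: a; b] -> c' \notin [:: a; b] ->
    conn g a c x1 y1 = conn g a c' x1 y1 -> colourable K e.
  move=> cc' cn c'n; have [ac|nac] := boolP (conn g a c x1 y1) => E.
    by apply: (@cut_two g x y x1 x2 y1 y2 a b c c') => //; apply: class1.
  have bc : conn g b c x2 y2 by have := bad _ cn; rewrite (negbTE nac).
  have bc' : conn g b c' x2 y2 by have := bad _ c'n; rewrite -E.
  by apply: (@cut_two g x y x2 x1 y2 y1 b a c c') => //; first [exact: sw|exact: class2|idtac].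
have [c1 n1] := @fresh [:: a; b] isT.
have [c2] := @fresh [:: a; b; c1] isT; rewrite !inE !negb_or => /and3P[c2a c2b c21].
have [c3] := @fresh [:: a; b; c1; c2] isT; rewrite !inE !negb_or => /and4P[c3a c3b c31 c32].
have n3 : c3 \notin [:: a; b] by rewrite !inE negb_or c3a.
have n2 : c2 \notin [:: a; b] by rewrite !inE negb_or c2a.
have [E|E1] := eqVneq (conn g a c1 x1 y1) (conn g a c2 x1 y1); first by apply: (pair c1 c2); rewrite // eq_sym.
have [E|E2] := eqVneq (conn g a c1 x1 y1) (conn g a c3 x1 y1); first by apply: (pair c1 c3); rewrite // eq_sym.
apply: (pair c2 c3); rewrite // 1?eq_sym //.
by move: E1 E2; do 3!case: (conn _ _ _ _ _).
Qed.

Lemma two_more_nbrs x y : e x y -> edeg e x = 3 ->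
  exists x1 x2, [/\ x1 != x2, x1 != y, x2 != y & forall v, e x v = [|| v == y, v == x1 | v == x2]].
Proof.
move=> exy; rewrite /edeg (cardsD1 y) inE exy => -[/eqP/cards2P[x1 [x2 [x12 N]]]].
have inN v : (v != y) && e x v = (v == x1) || (v == x2).
  by have /setP/(_ v) := N; rewrite !inE.
exists x1, x2; split=> // [||v].
- by have := inN x1; rewrite eqxx => /andP[].
- by have := inN x2; rewrite eqxx orbT => /andP[].
by rewrite -inN; case: (eqVneq v y) => [->|].
Qed.

Lemma clearC (f : pcol T K) x y : clear (clear f x) y = clear (clear f y) x.
Proof. by apply/ffunP=> -[u v]; rewrite !ffunE /=; do 2!case: ifP. Qed.

Lemma colourable_twins x y : e x y -> edeg e x = 3 -> edeg e y = 3 ->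
  colourable K (cut_edge e x y) -> colourable K e.
Proof.
move=> exy dx dy [f [cf fe]]; have xy := neq_ends e_irr exy.
have eyx : e y x by rewrite e_sym.
have [x1 [x2 [x12 x1y x2y Nx]]] := two_more_nbrs exy dx.
have [y1 [y2 [y12 y1x y2x Ny]]] := two_more_nbrs eyx dy.
have f_edge u v : e u v -> ~~ joins x y u v -> exists a, f (u, v) = Some a.
  by move=> uv nj; apply: supp_palette; rewrite fe /= uv.
have [p1 fp1] : exists a, f (x, x1) = Some a.
  by apply: f_edge; rewrite ?Nx ?eqxx ?orbT // /joins; decide_eq.
have [p2 fp2] : exists a, f (x, x2) = Some a.
  by apply: f_edge; rewrite ?Nx ?eqxx ?orbT // /joins; decide_eq.
have [q1 fq1] : exists a, f (y, y1) = Some a.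
  by apply: f_edge; rewrite ?Ny ?eqxx ?orbT // /joins; decide_eq.
have [q2 fq2] : exists a, f (y, y2) = Some a.
  by apply: f_edge; rewrite ?Ny ?eqxx ?orbT // /joins; decide_eq.
pose g := clear (clear f x) y; have gE : g = clear (clear f y) x := clearC f x y.
have cfx := colouring_clear x cf; have cfy := colouring_clear y cf.
have cg : colouring g := colouring_clear y cfx.
have tw : twins e g x y x1 x2 y1 y2.
  split=> // u v; rewrite /supp !ffunE /=.
  have [uy|uy] := eqVneq u y; first by rewrite !andbF.
  have [vy|vy] := eqVneq v y; first by rewrite !andbF.
  have [ux|ux] := eqVneq u x; first by rewrite !andbF.
  have [vx|vx] := eqVneq v x; first by rewrite !andbF.
  by rewrite -/(supp f u v) fe /= /joins; decide_eq; rewrite !andbT.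
have pal_x z c : f (x, z) = Some c -> c \notin palette g z.
  move=> fz; apply: contra (subsetP (palette_clear_sub (clear f x) y z) c) _.
  by rewrite (palette_clear_edge cf fz) in_setD1 eqxx.
have pal_y z c : f (y, z) = Some c -> c \notin palette g z.
  move=> fz; rewrite gE; apply: contra (subsetP (palette_clear_sub (clear f y) x z) c) _.
  by rewrite (palette_clear_edge cf fz) in_setD1 eqxx.
have [p1x p2x q1y q2y] := And4 (pal_x _ _ fp1) (pal_x _ _ fp2) (pal_y _ _ fq1) (pal_y _ _ fq2).
have neq_col u v w c d : v != w -> f (u, v) = Some c -> f (u, w) = Some d -> c != d.
  by move=> vw fv fw; apply: contraNneq vw => cd; rewrite cd in fv; apply/eqP/(col_proper cf fv fw).
have p12 := neq_col _ _ _ _ _ x12 fp1 fp2; have q12 := neq_col _ _ _ _ _ y12 fq1 fq2.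
have same_end z c : f (x, z) = Some c -> f (y, z) = Some c -> False.
  rewrite ![f (_, z)](col_sym cf) => fx fy.
  by move: xy; rewrite (col_proper cf fx fy) eqxx.
have x_acy : ~~ conn g p1 p2 x1 x2.
  by apply: contra (star_acyclic cf fp1 fp2 x12); apply: conn_clear.
have y_acy : ~~ conn g q1 q2 y1 y2.
  by rewrite gE; apply: contra (star_acyclic cf fq1 fq2 y12); apply: conn_clear.
have x1_x := col_neq cf fp1; have x2_x := col_neq cf fp2.
have long : (p1 == q1) && (p2 == q2) || (p1 == q2) && (p2 == q1) ->
    ~~ (conn g p1 p2 x1 y1 && conn g p1 p2 x2 y2) && ~~ (conn g p1 p2 x1 y2 && conn g p1 p2 x2 y1).
  have fyx1 : clear f y (x, x1) = Some p1 by rewrite ffunE /=; decide_eq.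
  have fyx2 : clear f y (x, x2) = Some p2 by rewrite ffunE /=; decide_eq.
  have : ~~ conn (clear f y) q1 q2 y1 y2 := star_acyclic cf fq1 fq2 y12.
  move=> nc pq; have {}nc : ~~ conn (clear f y) p1 p2 y1 y2.
    by case/orP: pq => /andP[/eqP-> /eqP->] //; rewrite conn_swap.
  move: nc; rewrite (conn_through cfy fyx1 fyx2) // -gE !negb_or => /and3P[_ n1 n2].
  by rewrite ![conn _ _ _ _ y1]conn_sym // n1 andbC andbC [conn _ _ _ x1 y2 && _]andbC n2.
have tws := tw_swap tw; have twy := tw_swapy tw; have twsy := tw_swapy tws.
have x_acy' : ~~ conn g p2 p1 x2 x1 by rewrite conn_swap conn_sym.
have y_acy' : ~~ conn g q2 q1 y2 y1 by rewrite conn_swap conn_sym.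
have [E11|N11] := eqVneq p1 q1.
  have x1y1 : x1 != y1 by apply/eqP=> x1y1; apply: (same_end x1 p1); rewrite // x1y1 E11.
  have [E22|N22] := eqVneq p2 q2.
    have x2y2 : x2 != y2 by apply/eqP=> x2y2; apply: (same_end x2 p2); rewrite // x2y2 E22.
    rewrite -E11 -E22 in q1y q2y y_acy long.
    apply: (two_common_colours tw p12) => //; apply: long; by rewrite !eqxx.
  rewrite -E11 in q1y q12 y_acy.
  exact: (one_common_colour tw p12 q12 N22).
have [E12|N12] := eqVneq p1 q2.
  have x1y2 : x1 != y2 by apply/eqP=> x1y1; apply: (same_end x1 p1); rewrite // x1y1 E12.
  have [E21|N21] := eqVneq p2 q1.
    have x2y1 : x2 != y1 by apply/eqP=> x2y2; apply: (same_end x2 p2); rewrite // x2y2 E21.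
    rewrite -E12 -E21 in q1y q2y y_acy' long.
    apply: (two_common_colours twy p12) => //; rewrite andbC; apply: long; by rewrite !eqxx orbT.
  rewrite -E12 eq_sym in q2y q12 y_acy'.
  exact: (one_common_colour twy p12 q12 N21).
have p21 : p2 != p1 by rewrite eq_sym.
have [E21|N21] := eqVneq p2 q1.
  have x2y1 : x2 != y1 by apply/eqP=> x2y2; apply: (same_end x2 p2); rewrite // x2y2 E21.
  rewrite -E21 in q1y q12 y_acy.
  exact: (one_common_colour tws p21 q12 N12).
have [E22|N22] := eqVneq p2 q2.
  have x2y2 : x2 != y2 by apply/eqP=> x2y2; apply: (same_end x2 p2); rewrite // x2y2 E22.
  rewrite -E22 eq_sym in q2y q12 y_acy'.
  exact: (one_common_colour twsy p21 q12 N11).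
have [c] := @fresh [:: p1; p2; q1; q2] isT; rewrite !inE !negb_or => /and4P[c1 c2 c3 c4].
by extend tw p1 p2 q1 q2 c.
Qed.

End OneCommonColour.

(** * Induction on the number of edges *)

Section Induction.
Variables (T K : finType) (D : nat).
Hypothesis K_card : #|K| = D.+1.
Implicit Types (e : rel T) (x y : T).

(** With all degrees at least three, an edge [w z] of small degree sum has an end
    [w] of degree three; if [z] has a neighbour of degree more than three, then
    sparseness makes the degree of [z] three as well. *)
Lemma colourable_step e : symmetric e -> irreflexive e -> (forall u, edeg e u <= D) ->
  (forall u v, e u v -> edeg e u <= 3 \/ edeg e v <= 3) ->
  (exists w z, e w z /\ edeg e w + edeg e z <= D + 2) ->
  (forall x y, e x y -> colourable K (cut_edge e x y)) -> colourable K e.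
Proof.
move=> e_sym e_irr deg_le sparse3 [w [z [wz deg_wz]]] cut_col.
have [/existsP[x /existsP[y /andP[xy x2]]]|none] :=
    boolP [exists x, exists y, e x y && (edeg e x <= 2)].
  apply: (@colourable_low T K e D x y) => // [u v uv|]; last exact: cut_col.
  by have := deg_le u; have := deg_le v; case: (sparse3 u v uv); clear; lia.
have deg_ge x y : e x y -> 3 <= edeg e x.
  move=> xy; rewrite ltnNge; apply: contra none => x2; apply/existsP; exists x.
  by apply/existsP; exists y; rewrite xy.
have {deg_wz} [{}w [{}z [{}wz w3 deg_wz]]] : exists w z, [/\ e w z, edeg e w = 3 & edeg e w + edeg e z <= D + 2].
  have zw : e z w by rewrite e_sym.
  have w_ge := deg_ge _ _ wz; have z_ge := deg_ge _ _ zw.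
  case: (sparse3 _ _ wz) => le3.
    by exists w, z; split=> //; apply/eqP; rewrite eqn_leq le3.
  by exists z, w; split; rewrite // 1?addnC //; apply/eqP; rewrite eqn_leq le3.
have z_lt : edeg e z < D by move: deg_wz; rewrite w3; clear; lia.
have zw : e z w by rewrite e_sym.
have [/existsP[u /andP[zu u4]]|small] := boolP [exists u, e z u && (3 < edeg e u)]; last first.
  apply: (@colourable_small T K e D w z) => // [u zu|]; last exact: cut_col.
  by rewrite leqNgt; apply: contra small => u4; apply/existsP; exists u; rewrite zu.
have z3 : edeg e z = 3.
  apply/eqP; rewrite eqn_leq (deg_ge _ _ zw) andbT.
  by have [] := sparse3 _ _ zu; rewrite // leqNgt u4.
apply: (@colourable_twins T K e D _ _ _ _ _ _ w z) => //; last exact: cut_col.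
exact: leq_trans u4 (deg_le u).
Qed.

Lemma edeg_cut e x y u : edeg (cut_edge e x y) u <= edeg e u.
Proof. by apply/subset_leq_card/subsetP=> v; rewrite !inE => /andP[]. Qed.

Lemma edeg_cut_lt e x y : e x y -> edeg (cut_edge e x y) x < edeg e x.
Proof.
move=> xy; rewrite /edeg [X in _ < X](cardsD1 y) inE xy add1n ltnS.
apply/subset_leq_card/subsetP=> v; rewrite !inE => /andP[-> nj]; rewrite andbT.
by apply: contra nj => /eqP->; rewrite /joins !eqxx.
Qed.

(** Some edge of each component has a degree sum below the maximum that
    sparseness allows. *)
Definition deficient e := forall u v, e u v ->
  exists w z, [/\ connect e u w, e w z & edeg e w + edeg e z <= D + 2].

(** Deleting an edge lowers the degree sums of the edges that touch it, and some
    of these are in each component that the deletion affects. *)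
Lemma deficient_cut e x y : symmetric e -> (forall u, edeg e u <= D) ->
  (forall u v, e u v -> edeg e u <= 3 \/ edeg e v <= 3) -> e x y ->
  deficient e -> deficient (cut_edge e x y).
Proof.
move=> e_sym deg_le sparse3 exy def u v uv; pose e' := cut_edge e x y.
have e'_sym : symmetric e' := cut_edge_sym x y e_sym.
have e'e s t : e' s t -> e s t by case/andP.
have at_end z : z \in [:: x; y] -> connect e' u z ->
    exists w z, [/\ connect e' u w, e' w z & edeg e' w + edeg e' z <= D + 2].
  move=> zxy uz; have z_lt : edeg e' z < edeg e z.
    move: zxy; rewrite !inE => /orP[]/eqP->; first exact: edeg_cut_lt.
    rewrite (_ : edeg e' y = edeg (cut_edge e y x) y); first by apply: edeg_cut_lt; rewrite e_sym.
    by apply: eq_card => t; rewrite !inE /= joinsCl.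
  have [t zt] : exists t, e' z t.
    have [<-|uz'] := eqVneq u z; first by exists v.
    move: uz; rewrite (connectC _ _ e'_sym) => /connectP[[|t p] /=]; first by move=> _ uz; rewrite uz eqxx in uz'.
    by case/andP=> zt _ _; exists t.
  exists z, t; split=> //; have := edeg_cut e x y t; have := deg_le z; have := deg_le t.
  by have := sparse3 _ _ (e'e _ _ zt); move: z_lt; rewrite -/e'; clear; lia.
have [ux|nux] := boolP (connect e' u x); first by apply: (at_end x); rewrite // inE eqxx.
have [uy|nuy] := boolP (connect e' u y); first by apply: (at_end y); rewrite // !inE eqxx orbT.
have same w : connect e u w -> connect e' u w.
  case/connectP=> p; elim/last_ind: p w => [|p t IH] w /=; first by move=> _ ->; apply: connect0.
  rewrite rcons_path last_rcons => /andP[p_path st] ->; have us := IH _ p_path erefl.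
  apply: (connect_trans us); apply: connect1; rewrite /e' /= st; apply/joinsP=> -[] [sE _].
    by rewrite -sE us in nux.
  by rewrite -sE us in nuy.
have [w [z [uw wz deg_wz]]] := def _ _ (e'e _ _ uv); exists w, z; split; first exact: same.
  rewrite /= wz; apply/joinsP=> -[] [wE _]; have := same _ uw; rewrite wE.
    by rewrite (negbTE nux).
  by rewrite (negbTE nuy).
by apply: leq_trans deg_wz; apply: leq_add; apply: edeg_cut.
Qed.

Lemma colourable_deficient e : symmetric e -> irreflexive e -> (forall u, edeg e u <= D) ->
  (forall u v, e u v -> edeg e u <= 3 \/ edeg e v <= 3) -> deficient e -> colourable K e.
Proof.
move: {2}_.+1 (ltnSn #|[set p | e p.1 p.2]|) => n.
elim: n e => // n IH e e_le e_sym e_irr deg_le sparse3 def.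
have [/existsP[u /existsP[v uv]]|none] := boolP [exists u, exists v, e u v]; last first.
  have e0 u v : e u v = false.
    by apply: contraNF none => uv; apply/existsP; exists u; apply/existsP; exists v.
  exists [ffun=> None]; split; last by move=> u v; rewrite e0 /supp ffunE.
  split=> [u v|u|u v w a|a b u v]; rewrite ?ffunE //.
  by rewrite /link !ffunE.
apply: colourable_step => //.
  by have [w [z [_ wz deg_wz]]] := def _ _ uv; exists w, z.
move=> x y xy; apply: IH.
- rewrite -ltnS; apply: leq_trans e_le; rewrite ltnS; apply: proper_card; rewrite properE.
  apply/andP; split; first by apply/subsetP=> p; rewrite !inE => /andP[].
  by apply/subsetPn; exists (x, y); rewrite !inE //= xy /joins !eqxx.
- exact: cut_edge_sym.
- by move=> z; rewrite /= e_irr.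
- by move=> z; apply: leq_trans (edeg_cut _ _ _ _) (deg_le z).
- move=> s t /andP[st _].
  by case: (sparse3 _ _ st) => H; [left|right]; apply: leq_trans (edeg_cut _ _ _ _) H.
- exact: deficient_cut.
Qed.

End Induction.

(** * From colourings of pairs of vertices to colourings of edges *)

Section Edges.
Variables (G : sgraph) (K : finType) (k : nat).

Lemma set2_inj (T : finType) (u v u' v' : T) : u != v -> [set u; v] = [set u'; v'] ->
  (u = u' /\ v = v') \/ (u = v' /\ v = u').
Proof.
move=> uv E; have := set21 u v; have := set22 u v; rewrite !E !in_set2.
case/orP=> /eqP vE /orP[]/eqP uE; rewrite ?vE ?uE ?eqxx in uv *; by [left|right|].
Qed.

(** The rest of a two-coloured cycle would join the ends of its first edge. *)
Lemma chromatic_index_le : colourable 'I_k (@adj G) -> acyclic_chromatic_index G <= k.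
Proof.
case=> g [cg gE]; have g_sym := col_sym cg.
have g_edge u v : adj u v -> exists a, g (u, v) = Some a.
  by move=> uv; apply: supp_palette; rewrite gE.
have ex_col (f : edge G) : exists a, [exists u, exists v,
    (val f == [set u; v]) && (g (u, v) == Some a)].
  have /existsP[u /existsP[v /andP[uv /eqP fE]]] := valP f; have [a guv] := g_edge _ _ uv.
  exists a; apply/existsP; exists u; apply/existsP; exists v.
  by rewrite fE guv !eqxx.
pose c : {ffun edge G -> 'I_k} := [ffun f => xchoose (ex_col f)].
have cE f u v : val f = [set u; v] -> g (u, v) = Some (c f).
  move=> fE; have := xchooseP (ex_col f); rewrite (_ : xchoose _ = c f) ?ffunE //.
  case/existsP=> u' /existsP[v' /andP[/eqP fE' /eqP guv']].
  have uv' : u' != v' by rewrite eq_sym; apply: col_neq cg guv'.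
  by have [[<- <-]|[<- <-]] := set2_inj uv' (etrans (esym fE') fE); rewrite // g_sym.
rewrite /acyclic_chromatic_index; case: ex_minnP => m _ /(_ k); apply; apply/existsP; exists c.
apply/acyclic_edge_coloringP; split.
  apply/forallP=> f; apply/forallP=> h; apply/implyP=> /andP[fh /set0Pn[u]].
  have ends (i : edge G) : u \in val i -> exists v, val i = [set u; v].
    have /existsP[s /existsP[t /andP[_ /eqP->]]] := valP i; rewrite in_set2.
    by case/orP=> /eqP->; [exists t|exists s; rewrite setUC].
  rewrite in_setI => /andP[/ends[v fE] /ends[w hE]]; apply: contra fh => /eqP chf.
  have gv := cE _ _ _ fE; have gw := cE _ _ _ hE; rewrite -chf in gw.
  by apply/eqP/val_inj; rewrite fE hE (col_proper cg gv gw).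
move=> p p_cyc; apply/negP=> /cards2P[a [b [_ col_p]]].
have /and3P[p_gt2 p_adj p_uniq] := p_cyc.
have p_link u : u \in p -> link g a b u (next p u).
  move=> up; have uv := next_cycle p_adj up; pose A := [set u; next p u].
  have A_edge : is_edge A by apply/existsP; exists u; apply/existsP; exists (next p u); rewrite uv eqxx.
  have : c (exist _ A A_edge) \in c @: cycle_edges p.
    by apply: imset_f; rewrite inE; apply: map_f.
  by rewrite col_p in_set2 /link (cE (exist _ A A_edge) u (next p u)).
have := cycle_from_next p_uniq p_link.
case: p p_gt2 p_uniq {p_cyc p_adj col_p p_link} => [|u [|v [|w p]]] //= _.
move=> /andP[un /andP[vn _]] /and3P[uv vw p_path].
have symL := link_sym a b cg; move: (col_forest cg uv); rewrite connectC; last exact: cut_edge_sym.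
move/negP; apply; have avoid q : q \in w :: p -> (q != u) && (q != v).
  move=> qp; apply/andP; split; first by apply: contraNneq un => <-; rewrite in_cons qp orbT.
  by apply: contraNneq vn => <-.
have vw' : cut_edge (link g a b) u v v w.
  have /andP[wu wv] := avoid w (mem_head w p).
  by rewrite /= vw /= /joins (negbTE wu) (negbTE wv) !andbF.
apply: connect_trans (connect1 vw') _; clear vw vw' un vn uv.
elim: p w avoid p_path => [|q p IH] w avoid /=; rewrite ?andbT.
  move=> wu; apply: connect1; have /andP[wu' wv] := avoid w (mem_head _ _).
  by rewrite /= wu /= /joins (negbTE wu') (negbTE wv).
move=> /andP[wq p_path]; have /andP[wu wv] := avoid w (mem_head _ _).
have wq' : cut_edge (link g a b) u v w q by rewrite /= wq /= /joins (negbTE wu) (negbTE wv).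
apply: connect_trans (connect1 wq') _; apply: IH p_path => t tp.
by apply: avoid; rewrite in_cons tp orbT.
Qed.

End Edges.

Theorem theorem1 (G : sgraph) (G_connected : connected G)
    (G_sparse : sparse G 3) (x y : G) (xy_edge : adj x y)
    (xy_deg : deg x + deg y < max_deg G + 3) :
  acyclic_chromatic_index G <= max_deg G + 1.
Proof.
apply: chromatic_index_le; apply: (@colourable_deficient _ _ (max_deg G)).
- by rewrite card_ord addn1.
- exact: adj_sym.
- exact: adj_irrefl.
- by move=> u; apply: (leq_bigmax u).
- exact: G_sparse.
move=> u v _; exists x, y; split=> //; first by case: G_connected => _; apply.
by move: xy_deg; rewrite addnS ltnS.
Qed.
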